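(* $p\text{-}\#\mathrm{HOM}(\mathcal P^* )$ is $\#\mathrm{para}_{\beta}\text{-}\mathrm{L}$-complete with respect to $\le^{\mathrm{plog}}_{\mathrm{pars}}$.
   Context: For structures $\mathcal A,\mathcal B$ over a vocabulary $\tau$, a homomorphism from $\mathcal A$ to $\mathcal B$ is a map $h:\mathrm{dom}(\mathcal A)\to\mathrm{dom}(\mathcal B)$ such that for all $R\in\tau$ and all $(a_1,\dots,a_{\mathrm{ar}(R)})\in R^{\mathcal A}$, $(h(a_1),\dots,h(a_{\mathrm{ar}(R)}))\in R^{\mathcal B}$. For $n\ge2$, $P_n$ is the $\{E\}$-structure with universe $\{1,\dots,n\}$ and $E^{P_n}=\{(i,i+1),(i+1,i)\mid 1\le i<n\}$; $\mathcal P$ is the class of structures isomorphic to some $P_n$. For a structure $\mathcal A$, $\mathcal A^*$ is the expansion of $\mathcal A$ by a fresh unary relation symbol $C_a$ with $C_a^{\mathcal A^*}=\{a\}$ for each $a\in\mathrm{dom}(\mathcal A)$; $\mathcal P^*=\{\mathcal A^*\mid\mathcal A\in\mathcal P\}$. $p\text{-}\#\mathrm{HOM}(\mathcal P^* )$ is the problem: given a pair of structures $(\mathcal A,\mathcal B)$ with $\mathcal A\in\mathcal P^*$ ($\mathcal B$ arbitrary) and $k\in\mathbb N$, with parameter $k$, output the number of homomorphisms from $\mathcal A$ to $\mathcal B$ if $|\mathrm{dom}(\mathcal A)|\le k$, and $0$ otherwise. Machine model: inputs $(x,k)$ with parameter $k$; TMs with random access to the input; a nondeterministic TM is a deterministic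 TM with a read-only choice tape (not counted for space), a nondeterministic step being one where the choice-tape head visits a new cell; $\#\mathrm{acc}_M(x,k)$ is the number of accepting computation paths. A $\mathrm{para}\text{-}\mathrm{L}$-machine uses space $O(\log|x|+f(k))$ for a computable $f$; $k$-bounded means reading at most $f(k)\cdot\log|x|$ choice-tape bits for a computable $f$; read-once access means the choice-tape head moves only one way. $\#\mathrm{para}_{\beta}\text{-}\mathrm{L}$: functions $F=\#\mathrm{acc}_M$ for a $k$-bounded nondeterministic $\mathrm{para}\text{-}\mathrm{L}$-machine $M$ with read-once access. $F\le^{\mathrm{plog}}_{\mathrm{pars}}F'$: a $\mathrm{para}\text{-}\mathrm{L}$ oracle TM (oracle tape exempt from space bounds) computes $F$ with oracle $F'$ by making one query, whose parameter is bounded by a computable function of the input parameter, and returning its answer. Complete = member of the class and every function of the class reduces to it. *)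

(* Defs.v *)
From mathcomp Require Import all_boot.
Set Implicit Arguments. Unset Strict Implicit. Unset Printing Implicit Defensive.

(* A vocabulary is a list of arities: relation symbol i has arity nth 0 tau i.
   A structure has universe {0,...,sdom-1}; relation i is given by the list
   (read as a set) of its tuples. *)
Record structure := Struct { sdom : nat; srels : seq (seq (seq nat)) }.

Definition rel_of (S : structure) (i : nat) : seq (seq nat) := nth [::] (srels S) i.

Definition wf_struct (tau : seq nat) (S : structure) : bool :=
  (size (srels S) == size tau) &&
  all (fun p => all (fun t => (size t == p.1) && all (fun a => a < sdom S) t) p.2)
      (zip tau (srels S)).

Definition ext_map m n (h : {ffun 'I_m -> 'I_n}) (j : nat) : nat :=
  match (insub j : option 'I_m) with Some i => val (h i) | None => 0 end.

Arguments ext_map : clear implicits.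
Arguments ext_map {m n}.
Definition is_hom (tau : seq nat) (A B : structure)
    (h : {ffun 'I_(sdom A) -> 'I_(sdom B)}) : bool :=
  all (fun i => all (fun t => map (ext_map h) t \in rel_of B i) (rel_of A i))
      (iota 0 (size tau)).

Arguments is_hom : clear implicits.
Definition nhom (tau : seq nat) (A B : structure) : nat :=
  #|[pred h : {ffun 'I_(sdom A) -> 'I_(sdom B)} | is_hom tau A B h]|.

Definition same_set (s1 s2 : seq (seq nat)) : bool :=
  all (fun t => t \in s2) s1 && all (fun t => t \in s1) s2.

(* edge relation of P_n transported along sg (vertex i+1 of P_n |-> sg i) *)
Definition path_edges (n : nat) (sg : nat -> nat) : seq (seq nat) :=
  flatten [seq [:: [:: sg i; sg i.+1]; [:: sg i.+1; sg i]] | i <- iota 0 n.-1].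

(* A (over vocabulary tau) is in P-star: tau consists of one binary symbol e
   (the edge symbol E) whose interpretation makes A isomorphic to some P_n,
   n >= 2, together with exactly one unary symbol C_a = g a for every
   element a, interpreted as {a}. *)
Definition in_Pstar (tau : seq nat) (A : structure) : bool :=
  let n := sdom A in
  [&& 2 <= n, size tau == n.+1 &
  [exists e : 'I_(size tau),
    [&& nth 0 tau e == 2,
     [exists sg : {ffun 'I_n -> 'I_n},
        injectiveb sg && same_set (rel_of A e) (path_edges n (ext_map sg))] &
     [exists g : {ffun 'I_n -> 'I_(size tau)},
        injectiveb g &&
        [forall a : 'I_n, [&& g a != e, nth 0 tau (g a) == 1 &
                              same_set (rel_of A (g a)) [:: [:: val a]]]]]]]].

(* A list of naturals [n1; ...; nl] is encoded as 1^n1 0 1^n2 0 ... 1^nl 0. *)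
Fixpoint dec_nats (acc : nat) (s : seq bool) : option (seq nat) :=
  match s with
  | [::] => if acc == 0 then Some [::] else None
  | true :: s' => dec_nats acc.+1 s'
  | false :: s' => omap (cons acc) (dec_nats 0 s')
  end.

Definition split_at (n : nat) (s : seq nat) : option (seq nat * seq nat) :=
  if n <= size s then Some (take n s, drop n s) else None.

Definition parse_rel (ar : nat) (s : seq nat) : option (seq (seq nat) * seq nat) :=
  if s is m :: s' then
    if split_at (m * ar) s' is Some (body, rest)
    then Some (reshape (nseq m ar) body, rest) else None
  else None.

Fixpoint parse_rels (tau : seq nat) (s : seq nat)
    : option (seq (seq (seq nat)) * seq nat) :=
  match tau with
  | [::] => Some ([::], s)
  | a :: tau' =>
      if parse_rel a s is Some (r, s1) then
        if parse_rels tau' s1 is Some (rs, s2) then Some (r :: rs, s2) else None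
      else None
  end.

Definition parse_struct (tau : seq nat) (s : seq nat) : option (structure * seq nat) :=
  if s is n :: s' then
    if parse_rels tau s' is Some (rs, s2) then Some (Struct n rs, s2) else None
  else None.

Definition parse_instance (s : seq nat) : option (seq nat * structure * structure) :=
  if s is r :: s' then
    if split_at r s' is Some (tau, s1) then
      if parse_struct tau s1 is Some (A, s2) then
        if parse_struct tau s2 is Some (B, s3) then
          if s3 is [::] then Some (tau, A, B) else None
        else None
      else None
    else None
  else None.

Definition p_hom_Pstar (x : seq bool) (k : nat) : nat :=
  if obind parse_instance (dec_nats 0 x) is Some (tau, A, B) then
    if [&& wf_struct tau A, wf_struct tau B, in_Pstar tau A & sdom A <= k]
    then nhom tau A B else 0
  else 0.

Inductive move := MoveL | MoveS | MoveR.
Definition mv (m : move) (p : nat) : nat :=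
  match m with MoveL => p.-1 | MoveS => p | MoveR => p.+1 end.

(* input symbols; IBlank is returned for addresses outside the input *)
Inductive isym := I0 | I1 | ISep | IBlank.

Definition input_word (x : seq bool) (k : nat) : seq isym :=
  map (fun b : bool => if b then I1 else I0) x ++ ISep :: nseq k I1.

(* A TM with: random access to the input (the input symbol read is the one at
   the address written in binary, least significant bit first, on the index
   tape), one work tape over 'I_(tm_g.+1) (0 = blank), a read-only choice tape
   (cell 0 is a left end marker, cells 1,2,... hold the choice bits), and a
   write-only output/oracle tape over option bool.  The transition reads
   (state, input symbol, work symbol, index symbol, choice symbol) and returns
   (new state, work symbol written, work move, index symbol written,
    index move, choice move, output symbol emitted (if any)). *)
Record TM := {
  tm_q : nat;
  tm_g : nat;
  tm_start : 'I_tm_q.+1;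
  tm_acc : 'I_tm_q.+1;
  tm_rej : 'I_tm_q.+1;
  tm_delta : 'I_tm_q.+1 -> isym -> 'I_tm_g.+1 -> bool -> option bool ->
     'I_tm_q.+1 * 'I_tm_g.+1 * move * bool * move * move * option (option bool)
}.

Record config (M : TM) := Config {
  c_state : 'I_(tm_q M).+1;
  c_work : seq 'I_(tm_g M).+1; c_wpos : nat;
  c_index : seq bool; c_ipos : nat;
  c_cpos : nat;
  c_out : seq (option bool) }.

Definition bin_val (s : seq bool) : nat := foldr (fun (b : bool) v => b + v.*2) 0 s.

Definition step (M : TM) (w : seq isym) (ch : nat -> bool) (c : config M) : config M :=
  let q := c_state c in
  if (q == tm_acc M) || (q == tm_rej M) then c else
  let a := nth IBlank w (bin_val (c_index c)) in
  let g := nth ord0 (c_work c) (c_wpos c) in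
  let b := nth false (c_index c) (c_ipos c) in
  let h := if c_cpos c is p.+1 then Some (ch p) else None in
  let: (q', g', mw, b', mi, mc, o) := @tm_delta M q a g b h in
  @Config M q' (set_nth ord0 (c_work c) (c_wpos c) g') (mv mw (c_wpos c))
            (set_nth false (c_index c) (c_ipos c) b') (mv mi (c_ipos c))
            (mv mc (c_cpos c))
            (if o is Some s then rcons (c_out c) s else c_out c).

Arguments step : clear implicits.
Definition init (M : TM) : config M := @Config M (tm_start M) [::] 0 [::] 0 0 [::].

Arguments init : clear implicits.
Definition run (M : TM) (w : seq isym) (ch : nat -> bool) (t : nat) : config M :=
  iter t (step M w ch) (init M).

Arguments run : clear implicits.
Definition cspace (M : TM) (c : config M) : nat := (c_wpos c).+1 + (c_ipos c).+1.

Arguments cspace : clear implicits.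
Definition lg (n : nat) : nat := (trunc_log 2 n).+1.

Definition choice_move (M : TM) q a g b h : move :=
  let: (_, _, _, _, _, mc, _) := @tm_delta M q a g b h in mc.

Arguments choice_move : clear implicits.
Definition deterministic (M : TM) : Prop :=
  forall q a g b h, choice_move M q a g b h = MoveS.

Definition read_once (M : TM) : Prop :=
  forall q a g b h, choice_move M q a g b h <> MoveL.

Definition computable (f : nat -> nat) : Prop :=
  exists M : TM, forall n, exists t,
    c_state (run M (input_word (nseq n true) 0) (fun _ => false) t) = tm_acc M /\
    c_out (run M (input_word (nseq n true) 0) (fun _ => false) t)
      = nseq (f n) (Some true).

Definition paraL (M : TM) : Prop :=
  exists f, computable f /\ exists c0, forall x k ch t,
    cspace M (run M (input_word x k) ch t) <= c0 * lg (size x) + f k.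

Definition k_bounded (M : TM) : Prop :=
  exists f, computable f /\ forall x k ch t,
    c_cpos (run M (input_word x k) ch t) <= f k * lg (size x).

(* w is an accepting computation path: running with choice bits w, the machine
   accepts having visited exactly the choice cells 1..|w|. *)
Definition acc_path (M : TM) (x : seq bool) (k : nat) (w : seq bool) : Prop :=
  exists t,
    c_state (run M (input_word x k) (fun i => nth false w i) t) = tm_acc M /\
    \max_(s < t.+1) c_cpos (run M (input_word x k) (fun i => nth false w i) s)
      = size w.

Definition counts_acc (M : TM) (F : seq bool -> nat -> nat) : Prop :=
  forall x k, exists s : seq (seq bool),
    [/\ uniq s, (forall w, w \in s <-> acc_path M x k w) & size s = F x k].

Definition sharp_para_beta_L (F : seq bool -> nat -> nat) : Prop :=
  exists M : TM, [/\ paraL M, k_bounded M, read_once M & counts_acc M F].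

Definition query_word (y : seq bool) (k' : nat) : seq (option bool) :=
  map Some y ++ None :: nseq k' (Some true).

(* F <=^plog_pars F' : a deterministic para-L machine writes a single query
   (y,k') on its (space-exempt) oracle tape, with k' <= g(k), g computable,
   and the answer F'(y,k') is returned as F(x,k). *)
Definition plog_pars_red (F F' : seq bool -> nat -> nat) : Prop :=
  exists M : TM, [/\ deterministic M, paraL M &
   exists g, computable g /\
   forall x k, exists t y k',
     [/\ c_state (run M (input_word x k) (fun _ => false) t) = tm_acc M,
         c_out (run M (input_word x k) (fun _ => false) t) = query_word y k',
         k' <= g k & F x k = F' y k']].

Definition complete_for (C : (seq bool -> nat -> nat) -> Prop)
    (red : (seq bool -> nat -> nat) -> (seq bool -> nat -> nat) -> Prop)
    (F : seq bool -> nat -> nat) : Prop :=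
  C F /\ forall F', C F' -> red F' F.

(* Main.v *)
(* Hardness.  Let M be a k-bounded machine that reads its choice bits once.  Cut
   its choice string into b = f(k) + 1 blocks of l = log |x| bits.  A vertex of
   the target structure is a triple (i, s, y): a layer i, a number s coding the
   configuration of M before block i, and a block y.  It is joined to
   (i + 1, s', y') when M, started in s and fed with y, reaches s'; the color of
   the i-th path vertex consists of the vertices of layer i, with s initial for
   i = 0 and s accepting for i = b.  Homomorphisms from the starred path on b + 1
   vertices are then the accepting choice strings; bits not read by M are forced
   to be 0, so that every accepting path is counted once.

   Membership.  The walk along a path is found deterministically: start at an
   end and always leave towards the neighbor not just visited.  A homomorphism
   is a sequence of n <= k elements of B, each guessed with log |x| bits and
   compared with its predecessor only.

   Space.  [L] is the class of functions of the input word and of registers given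
   by arithmetic expressions with primitive recursion all of whose intermediate
   values are polynomial in the arguments.  Such expressions are compiled into
   counter programs, and these into Turing machines keeping the registers as
   binary tracks of the work tape.  A computable bound f enters a function of [L]
   through the least T such that T bounds a simulated computation of f(k): T
   depends on k only, hence is an admissible parameter. *)
Require Import Defs.
From mathcomp Require Import all_boot.
From Stdlib Require Import FunctionalExtensionality.
From mathcomp Require Import zify.
Set Implicit Arguments. Unset Strict Implicit. Unset Printing Implicit Defensive.

(** * Counter programs on Turing machines *)

(** Blocks, rather than single bits, label the vertices because a vertex per bit would give a path
    of length [f(k) * log |x|], which no function of the parameter bounds. Two obstacles shape the
    hardness proof. A machine may run forever without reading its next bit, so the arc relation has
    to detect divergence: configurations are numbers up to a cap, a run of more than cap steps
    repeats one, and the number 0, which codes no configuration, absorbs the failed run. Moreover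
    the number of configurations has a factor [2 ^ O(f(k))], which is not polynomial in [|x|]; [T]
    is therefore also required to dominate this factor, so that the cap is polynomial in [|x|] and
    [T]. Counting up to [T] costs space logarithmic in [|x| + k + T], and the function giving [T]
    from [k] is computable by the same search machine run on [1^k]. Both halves of the theorem meet
    in one normal form: a step function is folded over [b] guessed blocks, and the functions from
    ['I_b] to ['I_(2 ^ l)] with accepted result are counted. *)

Definition nb (v i : nat) : bool := odd (v %/ 2 ^ i).

Lemma nb0n v : nb v 0 = odd v.
Proof. by rewrite /nb expn0 divn1. Qed.

Lemma nbS v i : nb v i.+1 = nb v./2 i.
Proof. by rewrite /nb expnS divnMA divn2. Qed.

Lemma nb_small v i : v < 2 ^ i -> nb v i = false.
Proof. by move=> h; rewrite /nb divn_small. Qed.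

Lemma nb_zero i : nb 0 i = false.
Proof. by rewrite /nb div0n. Qed.

(* [z] is the position where the carry of [v + 1] stops. *)
Lemma nb_succ v : exists z, [/\ forall i, i < z -> nb v i, nb v z = false,
   forall i, nb v.+1 i = if i < z then false else if i == z then true else nb v i
   & 2 ^ z <= v.+1].
Proof.
have [n] := ubnP v; elim: n v => // n IH v lev.
case ov: (odd v); last first.
  exists 0; split=> //; first by rewrite nb0n.
  case=> [|i]; first by rewrite nb0n /= ov.
  by rewrite !nbS /= uphalf_half ov.
have [|z [h1 h2 h3 h4]] := IH v./2.
  move: lev (odd_double_half v); rewrite ov; lia.
exists z.+1; split.
- by case=> [|i] hi; rewrite ?nb0n // nbS h1.
- by rewrite nbS h2.
- case=> [|i]; first by rewrite nb0n /= ov.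
  by rewrite !nbS /= uphalf_half ov add1n h3 ltnS eqSS.
- rewrite expnS; move: (odd_double_half v); rewrite ov; lia.
Qed.

Lemma bin_val_nb s v : (forall i, nth false s i = nb v i) -> bin_val s = v.
Proof.
elim: s v => [|b s IH] v h /=.
  have {}h i : nb v i = false by rewrite -h nth_nil.
  case: v h => // v h; have [z [_ _ h3 _]] := nb_succ v.
  by have := h3 z; rewrite h ltnn eqxx.
rewrite (IH v./2) ?(h 0 : b = _) ?nb0n ?odd_double_half // => i.
by rewrite -nbS -h.
Qed.

(** Index 0 is left free and decodes to the default value: an unwritten work cell, which holds
    symbol 0, is thus read as [rblank]. *)
Definition fenc (T : finType) (x : T) : 'I_#|T|.+1 := lift ord0 (enum_rank x).
Definition fdec (T : finType) (d : T) (i : 'I_#|T|.+1) : T :=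
  if unlift ord0 i is Some j then enum_val j else d.

Lemma fencK (T : finType) (d : T) : cancel (@fenc T) (fdec d).
Proof. by move=> x; rewrite /fdec liftK enum_rankK. Qed.

Lemma fdec0 (T : finType) (d : T) : fdec d ord0 = d.
Proof. by rewrite /fdec unlift_none. Qed.

Definition isym_nat (a : isym) : nat :=
  match a with I0 => 0 | I1 => 1 | ISep => 2 | IBlank => 3 end.

(** The targets of [IDec], [ISym] and [IChoice] are taken on failure: register zero, another symbol,
    choice bit 0. *)
Inductive instr :=
  | IInc of nat | IDec of nat & nat | IJmp of nat | ISym of isym & nat
  | IEmit of option bool | IChoice of nat | IAcc | IRej.

Definition upd (T : Type) (f : nat -> T) (r : nat) (x : T) : nat -> T :=
  fun r' => if r' == r then x else f r'.

Section Machine.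
Variables (P : seq instr) (m : nat).

(** A cell carries two flags, for the left end and for the marked prefix, and one bit of each
    register. Beyond the marked prefix all registers have zero bits, so a scan for a one knows where
    to give up. *)
Notation rsym := ((bool * bool) * {ffun 'I_m.+1 -> bool})%type.
Definition rblank : rsym := (false, false, [ffun => false]).
Definition rset (f : {ffun 'I_m.+1 -> bool}) r b : {ffun 'I_m.+1 -> bool} :=
  [ffun i : 'I_m.+1 => if val i == r then b else f i].

Notation ctrl := (('I_(size P).+1 * 'I_4) + 'I_3)%type.
Definition cst (pc ph : nat) : ctrl := inl (inord pc, inord ph).
Definition c_init : ctrl := inr (inord 0).
Definition c_yes : ctrl := inr (inord 1).
Definition c_no : ctrl := inr (inord 2).

(* Phases: 0 fetch/scan right, 1 return to the left end, 2 restore the ones of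
   a borrow on the way back, 3 read the choice cell just entered. *)
Definition rdelta_nat (pc ph : nat) (a : isym) (s : rsym) (h : option bool) :
    ctrl * rsym * move * move * option (option bool) :=
  match ph with
  | 0 => match nth IRej P pc with
    | IInc r => if s.2 (inord r) then (cst pc 0, (s.1, rset s.2 r false), MoveR, MoveS, None)
                else (cst pc.+1 1, (s.1.1, true, rset s.2 r true), MoveS, MoveS, None)
    | IDec r t =>
        if ~~ s.1.2 then (cst t 1, s, MoveS, MoveS, None) else
        if s.2 (inord r) then
          (if s.1.1 then cst pc.+1 0 else cst pc 2,
           (s.1, rset s.2 r false), MoveL, MoveS, None)
        else (cst pc 0, s, MoveR, MoveS, None)
    | IJmp t => (cst t 0, s, MoveS, MoveS, None)
    | ISym a' t => (cst (if isym_nat a == isym_nat a' then pc.+1 else t) 0,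
                    s, MoveS, MoveS, None)
    | IEmit o => (cst pc.+1 0, s, MoveS, MoveS, Some o)
    | IChoice t => (cst pc 3, s, MoveS, MoveR, None)
    | IAcc => (c_yes, s, MoveS, MoveS, None)
    | IRej => (c_no, s, MoveS, MoveS, None)
    end
  | 1 => if s.1.1 then (cst pc 0, s, MoveS, MoveS, None)
         else (cst pc 1, s, MoveL, MoveS, None)
  | 2 => match nth IRej P pc with
    | IDec r t => (if s.1.1 then cst pc.+1 0 else cst pc 2,
                   (s.1, rset s.2 r true), MoveL, MoveS, None)
    | _ => (c_no, s, MoveS, MoveS, None)
    end
  | _ => match nth IRej P pc with
    | IChoice t => (cst (if h == Some true then pc.+1 else t) 0, s, MoveS, MoveS, None)
    | _ => (c_no, s, MoveS, MoveS, None)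
    end
  end.

Definition rdelta (q : ctrl) a s h :=
  match q with
  | inr _ => (cst 0 0, (true, true, s.2), MoveS, MoveS, None)
  | inl (pc, ph) => rdelta_nat (val pc) (val ph) a s h
  end.

(* The index tape is kept equal to track 0, and both heads move in lockstep. *)
Definition rTM : TM := {|
  tm_q := #|{: ctrl}|; tm_g := #|{: rsym}|;
  tm_start := fenc c_init; tm_acc := fenc c_yes; tm_rej := fenc c_no;
  tm_delta := fun q a g _ h =>
    let: (q', s', mw, mc, o) := rdelta (fdec c_no q) a (fdec rblank g) h in
    (fenc q', fenc s', mw, s'.2 ord0, mw, mc, o) |}.

Lemma rTM_read_once : read_once rTM.
Proof.
move=> q a g b h; rewrite /choice_move /=.
case E: (rdelta _ _ _ _) => [[[[q' s'] mw] mc] o]; move: E.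
rewrite /rdelta; case: (fdec c_no q) => [[pc ph]|i]; last by case=> _ _ _ <-.
by rewrite /rdelta_nat; case: (val ph) => [|[|[|n]]]; try case: (nth _ _ _) => [r|r t|t|a' t|o'|t||];
   repeat (case: ifP => _); case=> _ _ _ <-.
Qed.

Definition not_choice i := if i is IChoice _ then false else true.

Lemma rTM_det : all not_choice P -> deterministic rTM.
Proof.
move=> hP q a g b h; rewrite /choice_move /=.
case E: (rdelta _ _ _ _) => [[[[q' s'] mw] mc] o]; move: E.
rewrite /rdelta; case: (fdec c_no q) => [[pc ph]|i]; last by case=> _ _ _ <-.
have hpc : not_choice (nth IRej P (val pc)).
  by have [/(all_nthP IRej hP)//|ge] := ltnP (val pc) (size P); rewrite nth_default.
by move: hpc; rewrite /rdelta_nat; case: (val ph) => [|[|[|n]]]; try case: (nth _ _ _) => [r|r t|t|a' t|o'|t||] //= _;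
   repeat (case: ifP => _); case=> _ _ _ <-.
Qed.

Definition rep (c : config rTM) pc ph p U (B : nat -> nat -> bool) :=
  [/\ c_state c = fenc (cst pc ph), c_wpos c = p /\ c_ipos c = p,
      forall i, fdec rblank (nth ord0 (c_work c) i) = (i == 0, i < U, [ffun r => B (val r) i])
    & forall i, nth false (c_index c) i = B 0 i].

Variables (w : seq isym) (ch : nat -> bool).
Notation stp := (step rTM w ch).

Definition chsym k := if k is p.+1 then Some (ch p) else None.

Lemma fenc_inj (T : finType) : injective (@fenc T).
Proof. by move=> x y; apply: can_inj (fencK x) x y. Qed.

Lemma cst_run pc ph : (fenc (cst pc ph) == tm_acc rTM) || (fenc (cst pc ph) == tm_rej rTM) = false.
Proof. by rewrite !(inj_eq (@fenc_inj _)). Qed.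

(** A step rewrites only the scanned cell [p]; the new tracks [B'] and the new mark [U'] are
    computed there and must agree with the old ones elsewhere. *)
Lemma micro c pc ph p U B pc' ph' s' mw mc o U' B' :
  rep c pc ph p U B -> pc <= size P -> ph < 4 ->
  rdelta_nat pc ph (nth IBlank w (bin_val (c_index c)))
     (p == 0, p < U, [ffun r => B (val r) p]) (chsym (c_cpos c)) = (cst pc' ph', s', mw, mc, o) ->
  s' = (p == 0, p < U', [ffun r => B' (val r) p]) ->
  (forall r i, i != p -> B' r i = B r i) -> (forall i, i != p -> (i < U') = (i < U)) ->
  [/\ rep (stp c) pc' ph' (mv mw p) U' B', c_cpos (stp c) = mv mc (c_cpos c) &
      c_out (stp c) = if o is Some x then rcons (c_out c) x else c_out c].
Proof.
case: c => st wk wp ix ip cp out [/= -> [-> ->] hw hi] hpc hph hd hs hB hU.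
rewrite /step /= cst_run fencK hw /rdelta /cst /= !inordK // -/(chsym cp) hd /=.
split=> //; split=> //= i; rewrite nth_set_nth /=.
  case: eqP => [->|/eqP ne]; first by rewrite fencK hs.
  by rewrite hw hU //; congr (_, _, _); apply/ffunP=> r; rewrite !ffunE hB.
by rewrite hs /= ffunE; case: eqP => [->//|/eqP ne]; rewrite hB.
Qed.

Lemma micro_halt c pc ph p U B q' s' mw mc o :
  rep c pc ph p U B -> pc <= size P -> ph < 4 ->
  rdelta_nat pc ph (nth IBlank w (bin_val (c_index c)))
     (p == 0, p < U, [ffun r => B (val r) p]) (chsym (c_cpos c)) = (q', s', mw, mc, o) ->
  [/\ c_state (stp c) = fenc q', c_wpos (stp c) = mv mw p, c_ipos (stp c) = mv mw p,
      c_cpos (stp c) = mv mc (c_cpos c) &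
      c_out (stp c) = if o is Some x then rcons (c_out c) x else c_out c].
Proof.
case: c => st wk wp ix ip cp out [/= -> [-> ->] hw hi] hpc hph hd.
by rewrite /step /= cst_run fencK hw /rdelta /cst /= !inordK // -/(chsym cp) hd /=.
Qed.

End Machine.

Lemma lg_ge z V : 2 ^ z <= V -> z < lg V.
Proof. by move=> h; rewrite /lg ltnS trunc_log_max. Qed.

Section Run.
Variables (P : seq instr) (m : nat) (w : seq isym) (ch : nat -> bool) (V : nat).
Notation stp := (step (rTM P m) w ch).

(** The space bound is carried through every intermediate configuration. Registers up to [V] occupy
    at most [lg V] cells, and each of the two heads contributes its position plus one. *)
Definition reach (c : config (rTM P m)) (Q : config (rTM P m) -> Prop) :=
  exists n, Q (iter n stp c) /\ forall i, i <= n -> cspace _ (iter i stp c) <= 2 * (lg V).+1.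

Lemma reach_step c Q : c_wpos c <= lg V -> c_ipos c <= lg V -> reach (stp c) Q -> reach c Q.
Proof.
move=> h1 h2 [n [q h]]; exists n.+1; rewrite iterSr; split=> // -[|i] hi.
  by rewrite /cspace /=; lia.
by rewrite iterSr; apply: h.
Qed.

Lemma reach_refl c (Q : _ -> Prop) : c_wpos c <= lg V -> c_ipos c <= lg V -> Q c -> reach c Q.
Proof. by move=> h1 h2; exists 0; split=> // -[|] //= _; rewrite /cspace; lia. Qed.

Lemma rep_ext c pc ph p U B B' : (forall r i, B r i = B' r i) ->
  @rep P m c pc ph p U B -> rep c pc ph p U B'.
Proof.
move=> e [h1 h2 h3 h4]; split=> // i; last by rewrite h4.
by rewrite h3; congr (_, _); apply/ffunP=> r; rewrite !ffunE.
Qed.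

Lemma reach_micro c Q pc ph p U B pc' ph' mw mc o U' B' :
  rep c pc ph p U B -> pc <= size P -> ph < 4 -> p <= lg V ->
  rdelta_nat P pc ph (nth IBlank w (bin_val (c_index c)))
     (p == 0, p < U, [ffun r : 'I_m.+1 => B (val r) p]) (chsym ch (c_cpos c)) =
   (cst P pc' ph', (p == 0, p < U', [ffun r => B' (val r) p]), mw, mc, o) ->
  (forall r i, i != p -> B' r i = B r i) -> (forall i, i != p -> (i < U') = (i < U)) ->
  (forall c1, rep c1 pc' ph' (mv mw p) U' B' -> c_cpos c1 = mv mc (c_cpos c) ->
      c_out c1 = (if o is Some x then rcons (c_out c) x else c_out c) -> reach c1 Q) ->
  reach c Q.
Proof.
move=> hr h1 h2 h3 h4 h6 h7 h8; have [a1 a2 a3] := micro hr h1 h2 h4 erefl h6 h7.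
by case: hr => _ [w1 w2] _ _; apply: reach_step; rewrite ?w1 ?w2 //; apply: h8.
Qed.

Lemma reach_return c p pc U B Q : rep c pc 1 p U B -> pc <= size P -> p <= lg V ->
  (forall c1, rep c1 pc 0 0 U B -> c_cpos c1 = c_cpos c -> c_out c1 = c_out c -> reach c1 Q) ->
  reach c Q.
Proof.
elim: p c => [|p IH] c hr hpc hp h.
  by apply: (reach_micro hr) => //=.
apply: (reach_micro hr) => //= c1 hr1 e1 e2.
apply: IH hr1 _ _ _; rewrite ?(ltnW hp) // => c3 hr3 e3 e4.
by apply: h; rewrite ?e3 ?e4.
Qed.

(* Registers as binary tracks; [U] is the number of marked cells. *)
Definition srep (c : config (rTM P m)) pc (R : nat -> nat) cp o :=
  exists U, [/\ rep c pc 0 0 U (fun r i => nb (R r) i), 0 < U <= lg V,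
    forall r, r <= m -> R r < 2 ^ U, c_cpos c = cp & c_out c = o].

(** The carry stops at a position [z] with [2 ^ z <= R r + 1 <= V], so the head stays within [lg V]
    cells; this is what [R r < V] is for. *)
Lemma run_inc c Q pc R cp o r : srep c pc R cp o -> nth IRej P pc = IInc r -> pc < size P ->
  r <= m -> R r < V ->
  (forall c1, srep c1 pc.+1 (upd R r (R r).+1) cp o -> reach c1 Q) -> reach c Q.
Proof.
move=> [U [hr /andP[hU0 hU] hb hcp ho]] hP hpc hrm hV h.
have [z [z1 z2 z3 z4]] := nb_succ (R r).
have zU : z <= U.
  have [//|lt] := leqP z U; have := z1 _ lt; by rewrite nb_small ?hb.
have zV : z < lg V by apply: lg_ge; apply: leq_trans z4 _.
(* Tracks after the carry has passed [j] cells: the lowest [j] bits of register [r] are cleared. *)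
pose B j r' i := if (r' == r) && (i < j) then false else nb (R r') i.
have main j c0 : j <= z -> rep c0 pc 0 j U (B j) -> c_cpos c0 = cp -> c_out c0 = o -> reach c0 Q.
  elim: {j}(z - j) {-2}j (erefl (z - j)) c0 => [|d IH] j ed c0 jz0 hr0 e1 e2.
    have {}ed : j = z by lia. subst j.
    have jz : nb (R r) z = false by [].
    apply: (reach_micro (U' := maxn U z.+1) (B' := fun r' i => nb (upd R r (R r).+1 r') i) hr0); rewrite ?(ltnW hpc) ?(ltnW zV) //=.
    + rewrite hP ffunE /= inordK ?ltnS // /B eqxx ltnn /= jz.
      have -> : z < maxn U z.+1 by lia.
      congr (_, (_, _), _, _, _); apply/ffunP=> i; rewrite !ffunE /= /upd /B; case: eqP => // _.
      by rewrite z3 ltnn eqxx.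
    + move=> r' i ne; rewrite /upd /B; case: eqP => //= ->; rewrite z3 (negPf ne); by case: ifP.
    + by move=> i ne; lia.
    move=> c1 hr1 e3 e4; apply: (reach_return hr1) => //; rewrite ?(ltnW zV) // => c3 hr3 e5 e6.
    apply: h; exists (maxn U z.+1); split=> //.
    - lia.
    - move=> r' r'm; have le : 2 ^ U <= 2 ^ maxn U z.+1 by rewrite leq_exp2l // leq_maxl.
      rewrite /upd; case: eqP => [e|_]; last exact: leq_trans (hb _ r'm) le.
      (* If [R r + 1] equals [2 ^ U], its only one is at position [U]; the carry stopped there and
         the mark has grown. *)
      have := hb _ hrm; rewrite leq_eqVlt => /orP[/eqP e1'|lt]; last exact: leq_trans lt le.
      have [e0|ne] := eqVneq z U.
        rewrite e1' ltn_exp2l //; lia.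
      have bU : nb (R r).+1 U by rewrite e1' /nb divnn expn_gt0.
      by move: bU; rewrite z3 ltnNge zU eq_sym (negPf ne) nb_small ?hb.
    - by rewrite e5 e3.
    - by rewrite e6 e4.
  have jz : j < z by lia.
  apply: (reach_micro (U' := U) (B' := B j.+1) hr0); rewrite ?(ltnW hpc) //=.
  + lia.
  + rewrite hP ffunE /= inordK ?ltnS // /B eqxx ltnn /= z1 //.
    congr (_, (_, _), _, _, _); apply/ffunP=> i; rewrite !ffunE /= /B; case: eqP => [->|] //=; by rewrite leqnn.
  + move=> r' i ne; rewrite /B; case: eqP => //= _; by rewrite ltnS leq_eqVlt (negPf ne).
  move=> c1 hr1 e3 e4; apply: (IH j.+1) hr1 _ _ => //; try lia; by rewrite ?e3 ?e4.
apply: (main 0 c); rewrite ?subn0 //; apply: rep_ext hr => r' i; by rewrite /B ltn0 andbF.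
Qed.

Lemma run_dec0 c Q pc R cp o r t : srep c pc R cp o -> nth IRej P pc = IDec r t -> pc < size P ->
  r <= m -> t <= size P -> R r = 0 ->
  (forall c1, srep c1 t R cp o -> reach c1 Q) -> reach c Q.
Proof.
move=> [U [hr /andP[hU0 hU] hb hcp ho]] hP hpc hrm ht hV h.
have main j c0 : j <= U -> rep c0 pc 0 j U (fun r i => nb (R r) i) -> c_cpos c0 = cp -> c_out c0 = o -> reach c0 Q.
  elim: {j}(U - j) {-2}j (erefl (U - j)) c0 => [|d IH] j ed c0 jU hr0 e1 e2.
    have {}ed : j = U by lia. subst j.
    apply: (reach_micro (U' := U) hr0); rewrite ?(ltnW hpc) //=.
    + by rewrite hP /= ltnn /=.
    move=> c1 hr1 e3 e4; apply: (reach_return hr1) => // c3 hr3 e5 e6.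
    by apply: h; exists U; split; rewrite ?hU0 ?e5 ?e3 ?e6 ?e4.
  have jU' : j < U by lia.
  apply: (reach_micro (U' := U) hr0); rewrite ?(ltnW hpc) //=.
  + lia.
  + by rewrite hP /= jU' ffunE /= inordK ?ltnS // hV nb_zero.
  move=> c1 hr1 e3 e4; apply: (IH j.+1) hr1 _ _ => //; try lia; by rewrite ?e3 ?e4.
exact: (main 0 c).
Qed.

(** Decrementing undoes the successor: with [z] the carry position of [v], the scan finds the lowest
    one of [v + 1] at [z], and the way back turns the zeros below it into ones. *)
Lemma run_dec c Q pc R cp o r t v : srep c pc R cp o -> nth IRej P pc = IDec r t -> pc < size P ->
  r <= m -> R r = v.+1 ->
  (forall c1, srep c1 pc.+1 (upd R r v) cp o -> reach c1 Q) -> reach c Q.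
Proof.
move=> [U [hr /andP[hU0 hU] hb hcp ho]] hP hpc hrm hV h.
have [z [z1 z2 z3 z4]] := nb_succ v; rewrite -hV in z3 z4.
have zU : z < U.
  have : nb (R r) z by rewrite z3 ltnn eqxx.
  have [//|le] := ltnP z U; rewrite nb_small //; apply: leq_trans (hb _ hrm) _.
  by rewrite leq_exp2l.
(* The head is at [p] on its way back; above [p], register [r] already has the bits of [v]. *)
pose B p r' i := if (r' == r) && (p < i) then nb v i else nb (R r') i.
have fin c1 : rep c1 pc.+1 0 0 U (fun r' i => nb (upd R r v r') i) -> c_cpos c1 = cp -> c_out c1 = o -> reach c1 Q.
  move=> hr1 e1 e2; apply: h; exists U; split; rewrite ?hU0 // => r' r'm.
  rewrite /upd; case: eqP => [e|_]; last exact: hb.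
  have := hb _ hrm; rewrite hV; lia.
have back p c0 : p < z -> rep c0 pc 2 p U (B p) -> c_cpos c0 = cp -> c_out c0 = o -> reach c0 Q.
  elim: p c0 => [|p IH] c0 pz hr0 e1 e2.
    apply: (reach_micro (U' := U) (B' := fun r' i => nb (upd R r v r') i) hr0); rewrite ?(ltnW hpc) //=.
    + rewrite hP; congr (_, (_, _), _, _, _); apply/ffunP=> i; rewrite !ffunE /= /upd /B; case: eqP => // _ /=.
      by rewrite z1.
    + by move=> r' i ne; rewrite /upd /B lt0n ne andbT; case: eqP.
    by move=> c1 hr1 e3 e4; apply: fin; rewrite ?e3 ?e4.
  apply: (reach_micro (U' := U) (B' := B p) hr0); rewrite ?(ltnW hpc) //=.
  + lia.
  + rewrite hP; congr (_, (_, _), _, _, _); apply/ffunP=> i; rewrite !ffunE /= /B; case: eqP => // _ /=.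
    by rewrite leqnn z1.
  + move=> r' i ne; rewrite /B; case: eqP => //= _; by have -> : (p < i) = (p.+1 < i) by lia.
  by move=> c1 hr1 e3 e4; apply: IH hr1 _ _; rewrite ?e3 ?e4 ?(ltnW pz).
have main j c0 : j <= z -> rep c0 pc 0 j U (fun r i => nb (R r) i) -> c_cpos c0 = cp -> c_out c0 = o -> reach c0 Q.
  elim: {j}(z - j) {-2}j (erefl (z - j)) c0 => [|d IH] j ed c0 jz hr0 e1 e2.
    have {}ed : j = z by lia. subst j.
    have bz : nb (R r) z by rewrite z3 ltnn eqxx.
    have above r' i : i != z -> B z.-1 r' i = nb (R r') i.
      move=> ne; rewrite /B; case: eqP => //= ->; case: ifP => // lt.
      rewrite z3 (negPf ne); case: ifP => //; lia.
    case: (posnP z) => [z0|z0].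
      apply: (reach_micro (U' := U) (B' := fun r' i => nb (upd R r v r') i) hr0); rewrite ?(ltnW hpc) //=.
      + lia.
      + rewrite hP /= zU ffunE /= inordK ?ltnS // bz z0.
        congr (_, (_, _), _, _, _); apply/ffunP=> i; rewrite !ffunE /= /upd; case: eqP => // _.
        by rewrite -z0 z2.
      + move=> r' i ne; rewrite -above // /B /upd; case: eqP => //= e.
        have -> : z.-1 < i by lia.
        by [].
      by rewrite z0 => c1 hr1 e3 e4; apply: fin; rewrite ?e3 ?e4.
    apply: (reach_micro (U' := U) (B' := B z.-1) hr0); rewrite ?(ltnW hpc) //=.
    + lia.
    + rewrite hP /= zU ffunE /= inordK ?ltnS // bz eqn0Ngt z0.
      congr (_, (_, _), _, _, _); apply/ffunP=> i; rewrite !ffunE /= /B; case: eqP => // _ /=.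
      by rewrite prednK // leqnn z2.
    by move=> c1 hr1 e3 e4; apply: (back _ _ _ hr1); rewrite ?e3 ?e4 //=; lia.
  have jz' : j < z by lia.
  have jU : j < U by lia.
  apply: (reach_micro (U' := U) hr0); rewrite ?(ltnW hpc) //=.
  + lia.
  + by rewrite hP /= jU ffunE /= inordK ?ltnS // z3 jz'.
  move=> c1 hr1 e3 e4; apply: (IH j.+1) hr1 _ _ => //; try lia; by rewrite ?e3 ?e4.
exact: (main 0 c).
Qed.

Lemma run_jmp c Q pc R cp o t : srep c pc R cp o -> nth IRej P pc = IJmp t -> pc < size P ->
  (forall c1, srep c1 t R cp o -> reach c1 Q) -> reach c Q.
Proof.
move=> [U [hr hU hb hcp ho]] hP hpc h.
apply: (reach_micro (U' := U) (B' := fun r i => nb (R r) i) hr); rewrite ?(ltnW hpc) //=; first by rewrite hP.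
by move=> c1 hr1 e3 e4; apply: h; exists U; split; rewrite ?e3 ?e4.
Qed.

Lemma run_sym c Q pc R cp o a t : srep c pc R cp o -> nth IRej P pc = ISym a t -> pc < size P ->
  (forall c1, srep c1 (if isym_nat (nth IBlank w (R 0)) == isym_nat a then pc.+1 else t) R cp o -> reach c1 Q) ->
  reach c Q.
Proof.
move=> [U [hr hU hb hcp ho]] hP hpc h.
have [_ _ _ hi] := hr.
apply: (reach_micro (U' := U) (B' := fun r i => nb (R r) i) hr); rewrite ?(ltnW hpc) //=; first by rewrite hP (bin_val_nb hi).
by move=> c1 hr1 e3 e4; apply: h; exists U; split; rewrite ?e3 ?e4.
Qed.

Lemma run_emit c Q pc R cp o x : srep c pc R cp o -> nth IRej P pc = IEmit x -> pc < size P ->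
  (forall c1, srep c1 pc.+1 R cp (rcons o x) -> reach c1 Q) -> reach c Q.
Proof.
move=> [U [hr hU hb hcp ho]] hP hpc h.
apply: (reach_micro (U' := U) (B' := fun r i => nb (R r) i) hr); rewrite ?(ltnW hpc) //=; first by rewrite hP.
by move=> c1 hr1 e3 e4; apply: h; exists U; split; rewrite ?e3 ?e4 ?ho.
Qed.

Lemma run_choice c Q pc R cp o t : srep c pc R cp o -> nth IRej P pc = IChoice t -> pc < size P ->
  (forall c1, srep c1 (if ch cp then pc.+1 else t) R cp.+1 o -> reach c1 Q) -> reach c Q.
Proof.
move=> [U [hr hU hb hcp ho]] hP hpc h.
apply: (reach_micro (U' := U) (B' := fun r i => nb (R r) i) hr); rewrite ?(ltnW hpc) //=; first by rewrite hP.
move=> c1 hr1 /= e1 e2.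
apply: (reach_micro (U' := U) (B' := fun r i => nb (R r) i) hr1); rewrite ?(ltnW hpc) //=; first by rewrite hP e1 /= hcp.
by move=> c3 hr3 e3 e4; apply: h; exists U; split; rewrite ?e3 ?e4 ?e1 ?e2 ?hcp //; move: hr3; case: (ch cp).
Qed.

Lemma c_inr_eq i j : i < 3 -> j < 3 ->
  ((inr (inord i) : ('I_(size P).+1 * 'I_4) + 'I_3) == inr (inord j)) = (i == j).
Proof.
move=> hi hj; apply/eqP/eqP=> [[]/(congr1 val)/=|->//].
by rewrite !inordK.
Qed.

Lemma run_init Q : 0 < V ->
  (forall c1, srep c1 0 (fun => 0) 0 [::] -> reach c1 Q) -> reach (init (rTM P m)) Q.
Proof.
move=> V0 h; apply: reach_step => //; apply: h.
rewrite /step /= !(inj_eq (@fenc_inj _)) !c_inr_eq //= !fencK /=.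
exists 1; split=> //; split=> //= -[|i] /=.
- rewrite fencK; congr (_, _, _); rewrite fdec0; apply/ffunP=> r; by rewrite !ffunE /= ?nb_zero.
- rewrite nth_nil fdec0 /rblank; congr (_, _).
  by apply/ffunP=> r; rewrite !ffunE nb_zero.
- by rewrite fdec0 ffunE /= ?nb_zero.
- by rewrite nth_nil ?nb_zero.
Qed.

Lemma run_halt c pc R cp o (b : bool) : srep c pc R cp o ->
  nth IRej P pc = (if b then IAcc else IRej) -> pc <= size P ->
  reach c (fun c' => [/\ c_state c' = (if b then tm_acc (rTM P m) else tm_rej (rTM P m)),
     c_cpos c' = cp & c_out c' = o]).
Proof.
move=> [U [hr hU hb hcp ho]] hP hpc.
have hd : rdelta_nat P pc 0 (nth IBlank w (bin_val (c_index c)))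
    (0 == 0, 0 < U, [ffun r : 'I_m.+1 => nb (R (val r)) 0]) (chsym ch (c_cpos c)) =
    (if b then c_yes P else c_no P, (0 == 0, 0 < U, [ffun r : 'I_m.+1 => nb (R (val r)) 0]), MoveS, MoveS, None).
  by rewrite /rdelta_nat hP; case: (b).
have [e1 e4 e5 e2 e3] := micro_halt hr hpc isT hd.
have [_ [w2 w3] _ _] := hr.
apply: reach_step; rewrite ?w2 ?w3 //; apply: reach_refl; rewrite ?e4 ?e5 //.
by split; rewrite ?e2 ?e3 // e1; case: (b).
Qed.

End Run.

Definition halted (M : TM) (c : config M) : bool :=
  (c_state c == tm_acc M) || (c_state c == tm_rej M).

Lemma step_halted M w ch (c : config M) : halted c -> step M w ch c = c.
Proof. by rewrite /step /halted => ->. Qed.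

Lemma iter_halted M w ch (c : config M) n : halted c -> iter n (step M w ch) c = c.
Proof. by move=> h; elim: n => //= n ->; rewrite step_halted. Qed.

Lemma run_halted M w ch t t' : halted (run M w ch t) -> t <= t' -> run M w ch t' = run M w ch t.
Proof. by move=> h le; rewrite /run -(subnK le) iterD iter_halted. Qed.

Lemma run_halted_eq M w ch t t' : halted (run M w ch t) -> halted (run M w ch t') ->
  run M w ch t' = run M w ch t.
Proof.
move=> h h'; case/orP: (leq_total t t') => le; first exact: run_halted.
by rewrite (run_halted h' le).
Qed.

Lemma cpos_step M w ch c : read_once M -> c_cpos c <= c_cpos (step M w ch c) <= (c_cpos c).+1.
Proof.
move=> ro; rewrite /step; case: ifP => _; first by rewrite leqnn leqnSn.
set h := (if c_cpos c is p.+1 then _ else _).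
have := ro (c_state c) (nth IBlank w (bin_val (c_index c))) (nth ord0 (c_work c) (c_wpos c))
  (nth false (c_index c) (c_ipos c)) h.
rewrite /choice_move; case: (tm_delta _ _ _ _ _) => [[[[[[q' g'] mw] b'] mi] mc] o] /=.
by case: mc => //= _; rewrite leqnn leqnSn.
Qed.

Lemma cpos_mono M w ch t t' : read_once M -> t <= t' -> c_cpos (run M w ch t) <= c_cpos (run M w ch t').
Proof.
move=> ro; elim: t' => [|t' IH]; first by rewrite leqn0 => /eqP->.
rewrite leq_eqVlt => /orP[/eqP->//|lt].
by apply: leq_trans (IH lt) _; rewrite /run iterS; case/andP: (cpos_step w ch (run M w ch t') ro).
Qed.

(** * Structured commands and their compilation *)

Inductive cmd :=
  | CSkip | CInc of nat | CSeq of cmd & cmd | CWhile of nat & cmd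
  | CSym of isym & cmd | CEmit of option bool | CChoice of nat.

Definition cstate := ((nat -> nat) * nat * seq (option bool))%type.

(** Big-step, so that a derivation also witnesses termination. The bound [V] is imposed where a
    register may grow, which keeps all registers at most [V] if they start so. *)
Inductive exec (w : seq isym) (ch : nat -> bool) (V : nat) : cmd -> cstate -> cstate -> Prop :=
  | E_Skip s : exec w ch V CSkip s s
  | E_Inc R cp o r : R r < V -> exec w ch V (CInc r) (R, cp, o) (upd R r (R r).+1, cp, o)
  | E_Seq c1 c2 s1 s2 s3 : exec w ch V c1 s1 s2 -> exec w ch V c2 s2 s3 -> exec w ch V (CSeq c1 c2) s1 s3
  | E_While0 r c R cp o : R r = 0 -> exec w ch V (CWhile r c) (R, cp, o) (R, cp, o)
  | E_WhileS r c R cp o v s1 s2 : R r = v.+1 -> exec w ch V c (upd R r v, cp, o) s1 ->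
      exec w ch V (CWhile r c) s1 s2 -> exec w ch V (CWhile r c) (R, cp, o) s2
  | E_SymT a c R cp o s : isym_nat (nth IBlank w (R 0)) = isym_nat a ->
      exec w ch V c (R, cp, o) s -> exec w ch V (CSym a c) (R, cp, o) s
  | E_SymF a c R cp o : isym_nat (nth IBlank w (R 0)) <> isym_nat a ->
      exec w ch V (CSym a c) (R, cp, o) (R, cp, o)
  | E_Emit R cp o x : exec w ch V (CEmit x) (R, cp, o) (R, cp, rcons o x)
  | E_Choice R cp o r : R r < V ->
      exec w ch V (CChoice r) (R, cp, o) (upd R r (R r + ch cp), cp.+1, o).

Fixpoint csize c := match c with
  | CSkip => 0 | CInc _ | CEmit _ => 1 | CSeq c1 c2 => csize c1 + csize c2
  | CWhile _ c => (csize c).+2 | CSym _ c => (csize c).+1 | CChoice _ => 2 end.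

Fixpoint comp o c : seq instr := match c with
  | CSkip => [::]
  | CInc r => [:: IInc r]
  | CSeq c1 c2 => comp o c1 ++ comp (o + csize c1) c2
  | CWhile r c => IDec r (o + (csize c).+2) :: rcons (comp o.+1 c) (IJmp o)
  | CSym a c => ISym a (o + (csize c).+1) :: comp o.+1 c
  | CEmit x => [:: IEmit x]
  | CChoice r => [:: IChoice o.+2; IInc r] end.

Lemma size_comp o c : size (comp o c) = csize c.
Proof. by elim: c o => //= [c1 h1 c2 h2|r c h|a c h] o; rewrite ?size_cat ?size_rcons ?h1 ?h2 ?h. Qed.

Fixpoint cmaxreg c := match c with
  | CSkip | CEmit _ => 0 | CInc r | CChoice r => r | CSeq c1 c2 => maxn (cmaxreg c1) (cmaxreg c2)
  | CWhile r c => maxn r (cmaxreg c) | CSym _ c => cmaxreg c end.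

Fixpoint choice_free c := match c with
  | CSeq c1 c2 => choice_free c1 && choice_free c2
  | CWhile _ c | CSym _ c => choice_free c | CChoice _ => false | _ => true end.

Lemma comp_choice_free o c : choice_free c -> all not_choice (comp o c).
Proof.
elim: c o => //= [c1 h1 c2 h2|r c h|a c h] o.
- by case/andP=> /h1 e1 /h2 e2; rewrite all_cat e1 e2.
- by move=> /h e; rewrite all_rcons /= e.
- exact: h.
Qed.

Section Comp.
Variables (P : seq instr) (m : nat) (w : seq isym) (ch : nat -> bool) (V : nat).

Lemma nth_code P1 x P2 : P = P1 ++ x :: P2 -> nth IRej P (size P1) = x /\ size P1 < size P.
Proof. by move=> ->; rewrite nth_cat ltnn subnn size_cat /=; split=> //; lia. Qed.

(** Continuation form: [Q] is reached from the end of the compiled code, so pieces compose without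
    step counts and inherit the space bound. Induction on the derivation handles loops: after the
    body and the jump back, the hypothesis for the remaining iterations applies at the same code
    address. *)
Lemma exec_reach c s s' : exec w ch V c s s' -> cmaxreg c <= m ->
  forall o P1 P2 c0 Q, P = P1 ++ comp o c ++ P2 -> size P1 = o ->
  srep V c0 o s.1.1 s.1.2 s.2 ->
  (forall c1, srep V c1 (o + csize c) s'.1.1 s'.1.2 s'.2 -> reach w ch V c1 Q) ->
  @reach P m w ch V c0 Q.
Proof.
elim=> {c s s'}.
- by move=> s _ o P1 P2 c0 Q eP e0 h0 h; apply: h; rewrite addn0.
- move=> R cp o r hV /= rm o1 P1 P2 c0 Q eP e0 h0 h.
  have := nth_code eP; rewrite e0 => -[n1 n2].
  apply: (run_inc h0 n1 n2 rm hV) => c1; rewrite -addn1; exact: h.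
- move=> a b s1 s2 s3 _ IH1 _ IH2 /= rm o P1 P2 c0 Q eP e0 h0 h.
  move: rm; rewrite geq_max => /andP[rm1 rm2].
  apply: (IH1 rm1 o P1 (comp (o + csize a) b ++ P2) c0) => //; first by rewrite eP -catA.
  move=> c1 h1; apply: (IH2 rm2 (o + csize a) (P1 ++ comp o a) P2 c1) => //.
  + by rewrite eP -!catA.
  + by rewrite size_cat size_comp e0.
  + by move=> c3; rewrite -addnA; apply: h.
- move=> r c R cp o r0 /= rm o1 P1 P2 c0 Q eP e0 h0 h.
  have := nth_code eP; rewrite e0 => -[n1 n2].
  have rm1 : r <= m by rewrite geq_max in rm; case/andP: rm.
  apply: (run_dec0 h0 n1 n2 rm1 _ r0 h).
  rewrite eP size_cat /= size_cat size_rcons size_comp; lia.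
- move=> r c R cp o v s1 s2 rv _ IH1 _ IH2 /= rm o1 P1 P2 c0 Q eP e0 h0 h.
  have [rm1 rm2] : r <= m /\ cmaxreg c <= m by rewrite geq_max in rm; case/andP: rm.
  have := nth_code eP; rewrite e0 => -[n1 n2].
  apply: (run_dec h0 n1 n2 rm1 rv) => c1 h1.
  set X := IDec _ _ in eP n1.
  have sz1 : size (rcons P1 X) = o1.+1 by rewrite size_rcons e0.
  have eP' : P = (rcons P1 X ++ comp o1.+1 c) ++ IJmp o1 :: P2.
    by rewrite eP cat_rcons /= -cats1 -!catA.
  have sz2 : size (rcons P1 X ++ comp o1.+1 c) = o1.+1 + csize c.
    by rewrite size_cat sz1 size_comp.
  apply: (IH1 rm2 o1.+1 (rcons P1 X) (IJmp o1 :: P2) c1) => //; first by rewrite catA.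
  have := nth_code eP'; rewrite sz2 => -[n3 n4] c3 h3.
  apply: (run_jmp h3 n3 n4) => c4 h4; exact: (IH2 rm o1 P1 P2 c4).
- move=> a c R cp o s ha _ IH /= rm o1 P1 P2 c0 Q eP e0 h0 h.
  have := nth_code eP; rewrite e0 => -[n1 n2].
  apply: (run_sym h0 n1 n2); rewrite ha eqxx => c1 h1.
  apply: (IH rm o1.+1 (rcons P1 (ISym a (o1 + (csize c).+1))) P2 c1) => //.
  + by rewrite eP cat_rcons.
  + by rewrite size_rcons e0.
  + by move=> c3; rewrite addSnnS; apply: h.
- move=> a c R cp o /eqP ha /= rm o1 P1 P2 c0 Q eP e0 h0 h.
  have := nth_code eP; rewrite e0 => -[n1 n2].
  apply: (run_sym h0 n1 n2); rewrite (negPf ha) => c1 h1.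
  exact: h.
- move=> R cp o x /= rm o1 P1 P2 c0 Q eP e0 h0 h.
  have := nth_code eP; rewrite e0 => -[n1 n2].
  apply: (run_emit h0 n1 n2); rewrite -addn1; exact: h.
- move=> R cp o r rV /= rm o1 P1 P2 c0 Q eP e0 h0 h.
  have := nth_code eP; rewrite e0 => -[n1 n2].
  have eP' : P = rcons P1 (IChoice o1.+2) ++ IInc r :: P2 by rewrite eP cat_rcons.
  have := nth_code eP'; rewrite size_rcons e0 => -[n3 n4].
  apply: (run_choice h0 n1 n2) => c1; rewrite addn2 in h; case E: (ch cp) h => h h1.
    by apply: (run_inc h1 n3 n4 rm rV) => c3; move: (h c3); rewrite addn1.
  apply: h; rewrite addn0.
  have -> : upd R r (R r) = R by apply: functional_extensionality => r'; rewrite /upd; case: eqP => // ->.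
  exact: h1.
Qed.
End Comp.

Section Top.
Variables (c : cmd) (r0 : nat).
(** Accepts iff register [r0] ends at 0: [IDec] then jumps over [IRej] to [IAcc]. *)
Definition cprog := comp 0 c ++ [:: IDec r0 (csize c).+2; IRej; IAcc].
Definition cTM := rTM cprog (maxn r0 (cmaxreg c)).

Lemma cTM_read_once : read_once cTM. Proof. exact: rTM_read_once. Qed.
Lemma cTM_det : choice_free c -> deterministic cTM.
Proof. by move=> h; apply: rTM_det; rewrite all_cat comp_choice_free. Qed.

Lemma cTM_run w ch V R cp o : 0 < V -> exec w ch V c (fun=> 0, 0, [::]) (R, cp, o) ->
  exists t, [/\ c_state (run cTM w ch t) = (if R r0 == 0 then tm_acc cTM else tm_rej cTM),
    c_cpos (run cTM w ch t) = cp, c_out (run cTM w ch t) = o,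
    forall t', cspace _ (run cTM w ch t') <= 2 * (lg V).+1 &
    forall t', c_cpos (run cTM w ch t') <= cp].
Proof.
move=> V0 he.
have rm1 : cmaxreg c <= maxn r0 (cmaxreg c) by rewrite leq_maxr.
have rm2 : r0 <= maxn r0 (cmaxreg c) by rewrite leq_maxl.
have sz : size cprog = csize c + 3 by rewrite size_cat size_comp.
have eP : cprog = comp 0 c ++ [:: IDec r0 (csize c).+2; IRej; IAcc] by [].
have := nth_code eP; rewrite size_comp => -[n1 n2].
have n3 : nth IRej cprog (csize c).+1 = IRej.
  by rewrite nth_cat size_comp ltnNge leqnSn /= subSnn.
have n4 : nth IRej cprog (csize c).+2 = IAcc.
  by rewrite nth_cat size_comp ltnNge (leq_trans (leqnSn _) (leqnSn _)) /= -addn2 addKn.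
have [t [[e1 e2 e3] hsp]] : @reach cprog (maxn r0 (cmaxreg c)) w ch V (init cTM) (fun cf =>
    [/\ c_state cf = (if R r0 == 0 then tm_acc cTM else tm_rej cTM), c_cpos cf = cp & c_out cf = o]).
  apply: run_init => // c1 h1.
  apply: (exec_reach he rm1 (P1 := [::]) _ _ h1) => //= c3 h3.
  case E: (R r0) => [|v] /=.
    apply: (run_dec0 h3 n1 n2 rm2) => // [|c4 h4]; first by rewrite sz; lia.
    by apply: (run_halt (b := true) _ _ h4) => //; rewrite sz; lia.
  apply: (run_dec h3 n1 n2 rm2 E) => c4 h4.
  by apply: (run_halt (b := false) _ _ h4) => //; rewrite sz; lia.
have hh : halted (run cTM w ch t) by rewrite /halted /run e1; case: ifP; rewrite eqxx ?orbT.
exists t; split=> // t'; case/orP: (leq_total t' t) => le; rewrite ?(run_halted hh le) //.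
- exact: hsp.
- exact: hsp.
- by rewrite -e2; apply: cpos_mono le; apply: cTM_read_once.
- by rewrite /run e2.
Qed.
End Top.

(** * Arithmetic expressions *)

(* [Let k e1 e2] drops the first [k] variables before binding the value of [e1];
   the step of [Rec] sees the accumulator as variable 0 and the index as variable 1. *)
Inductive exp :=
  | Var of nat | Zero | Succ of exp | Inp of exp | Let of nat & exp & exp | Drop of exp
  | Rec of exp & exp & exp.

Fixpoint eval (e : exp) (w : seq isym) (v : seq nat) : nat :=
  match e with
  | Var i => nth 0 v i
  | Zero => 0
  | Succ e => (eval e w v).+1
  | Inp e => isym_nat (nth IBlank w (eval e w v))
  | Let k e1 e2 => eval e2 w (eval e1 w v :: iter k behead v)
  | Drop e => eval e w (behead v)
  | Rec n a s => nat_rect (fun=> nat) (eval a w v) (fun i x => eval s w (x :: i :: v)) (eval n w v)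
  end.

Definition rec_at (a s : exp) w v i : nat :=
  nat_rect (fun=> nat) (eval a w v) (fun i x => eval s w (x :: i :: v)) i.

(** [V] bounds what the compiled program holds in its registers, including all accumulators of a
    recursion. The 3 in the case of [Inp] is the largest code of an input symbol. *)
Fixpoint fits (e : exp) (w : seq isym) (v : seq nat) (V : nat) : Prop :=
  match e with
  | Var i => nth 0 v i <= V
  | Zero => True
  | Succ e => fits e w v V /\ eval e w v < V
  | Inp e => fits e w v V /\ 3 <= V
  | Let k e1 e2 => fits e1 w v V /\ fits e2 w (eval e1 w v :: iter k behead v) V
  | Drop e => fits e w (behead v) V
  | Rec n a s => [/\ fits n w v V, fits a w v V &
      forall i, i < eval n w v -> fits s w (rec_at a s w v i :: i :: v) V]
  end.

Lemma fits_eval e w v V : fits e w v V -> eval e w v <= V.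
Proof.
elim: e v => //= [e _ v []//|e _ v []|k e1 _ e2 IH v [_ /IH]//|e IH v /IH//|n _ a IHa s IHs v [_ ha hs]].
  by move=> _; case: (nth _ _ _) => //=; lia.
case: (eval n w v) hs => [|k] hs /=; first exact: IHa.
by apply: IHs; apply: hs.
Qed.

Lemma fits_mono e w v V V' : V <= V' -> fits e w v V -> fits e w v V'.
Proof.
move=> le; elim: e v => //= [i v|e IH v|e IH v|k e1 IH1 e2 IH2 v|e IH v|n IHn a IHa s IHs v].
- by move/leq_trans; apply.
- by case=> /IH h1 h2; split=> //; apply: leq_trans le.
- by case=> /IH h1 h2; split=> //; apply: leq_trans le.
- by case=> /IH1 h1 /IH2.
- exact: IH.
- by case=> /IHn h1 /IHa h2 h3; split=> // i /h3 /IHs.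
Qed.

Ltac updval := rewrite /upd; repeat (case: eqP => ? //=); try (exfalso; lia); subst; try lia; try congruence.
Ltac updlia := apply: functional_extensionality => ?; rewrite /upd;
  repeat (case: eqP => ? //=); subst; try lia; try congruence.

Lemma updE (T : Type) (f : nat -> T) r x r' : upd f r x r' = if r' == r then x else f r'.
Proof. by []. Qed.

Lemma upd_id (T : Type) (f : nat -> T) r x : f r = x -> upd f r x = f.
Proof. by move=> h; apply: functional_extensionality => r'; rewrite /upd; case: eqP => // ->. Qed.

Ltac env_side he Rt := first [ lia | exact: Rt | by apply/allP => ? /(allP he); lia
  | by apply/negP => /(allP he); lia | by move=> ? ?; apply: Rt; lia
  | by rewrite updE; case: eqP => //; lia
  | by move=> ? ?; rewrite updE; case: eqP => [|_]; [lia|apply: Rt; lia] ].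

Section Sem.
Variables (w : seq isym) (ch : nat -> bool) (V : nat).
Notation exec := (exec w ch V).

Lemma exec_eq c s R R' cp o : exec c s (R, cp, o) -> R = R' -> exec c s (R', cp, o).
Proof. by move=> h <-. Qed.

Definition CClear r := CWhile r CSkip.
Definition CMove s d := CWhile s (CInc d).

Lemma exec_clear R cp o r : exec (CClear r) (R, cp, o) (upd R r 0, cp, o).
Proof.
case E: (R r) => [|n]; first by rewrite upd_id //; apply: E_While0.
elim: n R E => [|n IH] R E.
  apply: (E_WhileS E); first exact: E_Skip.
  by apply: E_While0; rewrite updE eqxx.
apply: (E_WhileS E); first exact: E_Skip.
have := IH (upd R r n.+1); rewrite updE eqxx => /(_ erefl).
have -> // : upd (upd R r n.+1) r 0 = upd R r 0.
by apply: functional_extensionality => r'; rewrite /upd; case: eqP.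
Qed.

Lemma exec_move R cp o s d : s != d -> R s + R d <= V ->
  exec (CMove s d) (R, cp, o) (upd (upd R s 0) d (R d + R s), cp, o).
Proof.
move=> ne le; move En: (R s) => n; elim: n R En le => [|n IH] {}R E le.
  rewrite addn0 upd_id ?upd_id //; first exact: E_While0.
apply: (E_WhileS E).
  apply: E_Inc; rewrite updE eq_sym (negPf ne); lia.
set R1 := upd _ d _.
have e1 : R1 s = n by rewrite /R1 !updE eqxx (negPf ne).
have e2 : R1 d = (R d).+1 by rewrite /R1 !updE eqxx eq_sym (negPf ne).
have := IH R1 e1; rewrite e1 e2 => /(_ ltac:(lia)).
have -> // : upd (upd R1 s 0) d ((R d).+1 + n) = upd (upd R s 0) d (R d + n.+1).
by apply: functional_extensionality => r'; rewrite /R1 /upd addnS addSn; case: eqP => //; case: eqP.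
Qed.

Definition CCopy s d t :=
  CSeq (CWhile s (CSeq (CInc d) (CInc t))) (CMove t s).

Lemma exec_copy R cp o s d t : s != d -> s != t -> d != t -> R d = 0 -> R t = 0 -> R s <= V ->
  exec (CCopy s d t) (R, cp, o) (upd R d (R s), cp, o).
Proof.
move=> sd st dt d0 t0 le.
have H n R1 : R1 s = n -> R1 d + n <= V -> R1 t + n <= V -> exec (CWhile s (CSeq (CInc d) (CInc t))) (R1, cp, o)
   (upd (upd (upd R1 s 0) d (R1 d + n)) t (R1 t + n), cp, o).
  elim: n R1 => [|n IH] R1 E l1 l2.
    set A := upd _ t _; suff -> : A = R1 by apply: E_While0.
    rewrite /A !addn0; updlia.
  apply: (E_WhileS E).
    apply: E_Seq; first by apply: E_Inc; rewrite updE eq_sym (negPf sd); lia.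
    apply: E_Inc; rewrite !updE eq_sym (negPf dt) eq_sym (negPf st); lia.
  set R2 := upd _ t _.
  have e1 : R2 s = n by rewrite /R2 !updE eqxx (negPf st) (negPf sd).
  have e2 : R2 d = (R1 d).+1 by rewrite /R2 !updE eqxx (negPf dt) eq_sym (negPf sd).
  have e3 : R2 t = (R1 t).+1 by rewrite /R2 !updE eqxx eq_sym (negPf dt) eq_sym (negPf st).
  have := IH R2 e1; rewrite e2 e3 => /(_ ltac:(lia) ltac:(lia)).
  have -> // : upd (upd (upd R2 s 0) d ((R1 d).+1 + n)) t ((R1 t).+1 + n) =
               upd (upd (upd R1 s 0) d (R1 d + n.+1)) t (R1 t + n.+1).
  apply: functional_extensionality => r'; rewrite /R2 /upd !addnS !addSn.
  by do 3 case: eqP => //.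
apply: E_Seq; first by apply: (H _ R erefl); rewrite ?d0 ?t0.
rewrite d0 t0 !add0n; set R2 := upd _ t _.
have e1 : R2 t = R s by rewrite /R2 !updE eqxx.
have e2 : R2 s = 0 by rewrite /R2 !updE eqxx (negPf st) (negPf sd).
have := @exec_move R2 cp o t s; rewrite eq_sym e1 e2 addn0 => /(_ st le).
have -> // : upd (upd R2 t 0) s (0 + R s) = upd R d (R s).
apply: functional_extensionality => r'; rewrite /R2 /upd add0n.
case: eqP => [->|_]; first by rewrite (negPf sd).
by case: eqP => [->|_]; first by rewrite eq_sym (negPf dt) t0.
Qed.

(** The symbol [I0] has code 0, so running this for the other three symbols transfers the code of
    the scanned symbol into a zero register. *)
Definition CAddc d a := CSym a (iter (isym_nat a) (CSeq (CInc d)) CSkip).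

Lemma exec_addc R cp o d a : d != 0 ->
  (isym_nat (nth IBlank w (R 0)) = isym_nat a -> R d + isym_nat a <= V) ->
  exec (CAddc d a) (R, cp, o)
   (if isym_nat (nth IBlank w (R 0)) == isym_nat a then upd R d (R d + isym_nat a) else R, cp, o).
Proof.
move=> d0 le; case: eqP => E; last exact: E_SymF.
apply: E_SymT => //; move: (le E) => {}le.
move: (isym_nat a) le => n {E}; elim: n R => [|n IH] R le /=; first by rewrite addn0 upd_id //; apply: E_Skip.
apply: E_Seq; first by apply: E_Inc; lia.
have := IH (upd R d (R d).+1); rewrite updE eqxx => /(_ ltac:(lia)).
have -> // : upd (upd R d (R d).+1) d ((R d).+1 + n) = upd R d (R d + n.+1).
by apply: functional_extensionality => r'; rewrite /upd addnS addSn; case: eqP.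
Qed.

(* Register 0 is the address register; registers from [t] on are free. *)
Fixpoint cexp (e : exp) (env : seq nat) (d t : nat) : cmd :=
  match e with
  | Var i => if i < size env then CCopy (nth 0 env i) d t else CSkip
  | Zero => CSkip
  | Succ e => CSeq (cexp e env d t) (CInc d)
  | Inp e => CSeq (cexp e env t t.+1) (CSeq (CMove t 0)
       (CSeq (CAddc d I1) (CSeq (CAddc d ISep) (CSeq (CAddc d IBlank) (CClear 0)))))
  | Let k e1 e2 => CSeq (cexp e1 env t t.+1) (CSeq (cexp e2 (t :: iter k behead env) d t.+1) (CClear t))
  | Drop e => cexp e (behead env) d t
  | Rec n a s => CSeq (cexp n env t t.+3) (CSeq (cexp a env d t.+3)
      (CSeq (CWhile t (CSeq (cexp s (d :: t.+1 :: env) t.+2 t.+3)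
                      (CSeq (CClear d) (CSeq (CMove t.+2 d) (CInc t.+1)))))
            (CClear t.+1)))
  end.

Lemma choice_free_cexp e env d t : choice_free (cexp e env d t).
Proof.
elim: e env d t => //= [i|e IH|e IH|k e1 IH1 e2 IH2|n IHn a IHa s IHs] env d t.
- by case: ifP.
- by rewrite IH.
- by rewrite IH.
- by rewrite IH1 IH2.
- by rewrite IHn IHa IHs.
Qed.

Lemma map_upd (R : nat -> nat) r x (env : seq nat) : r \notin env -> map (upd R r x) env = map R env.
Proof. by move=> h; apply/eq_in_map => i hi; rewrite updE; case: eqP => // e; rewrite -e hi in h. Qed.

Lemma exec_cexp e env d t R cp o :
  0 < d < t -> all (fun r => 0 < r < t) env -> d \notin env ->
  R d = 0 -> R 0 = 0 -> (forall r, t <= r -> R r = 0) -> fits e w (map R env) V ->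
  exec (cexp e env d t) (R, cp, o) (upd R d (eval e w (map R env)), cp, o).
Proof.
elim: e env d t R => [i||e IH|e IH|k e1 IH1 e2 IH2|e IH|n IHn a IHa s IHs] env d t R
  /andP[d0 dt] he hd Rd R0 Rt /= hf.
- case: ltnP => hi; last by rewrite nth_default ?size_map // upd_id //; apply: E_Skip.
  have hin := mem_nth 0 hi; have /andP[p1 p2] := allP he _ hin.
  rewrite (nth_map 0) // in hf *; apply: exec_copy => //; try lia.
  + by apply: contra hd => /eqP <-.
  + by apply: contraTneq p2 => ->; rewrite ltnn.
  + by apply: Rt.
- by rewrite upd_id //; apply: E_Skip.
- case: hf => hf lt; apply: E_Seq; first by apply: IH => //; rewrite d0 dt.
  by apply: exec_eq (@E_Inc _ _ _ _ _ _ d _) _; [rewrite updE eqxx|updlia].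
- case: hf => hf lt.
  apply: E_Seq.
    by apply: IH => //; env_side he Rt.
  set x := eval e w _; have xV : x <= V by exact: fits_eval hf.
  have R1t : upd R t x t = x by rewrite updE eqxx.
  have R10 : upd R t x 0 = 0 by rewrite updE; case: eqP => //; lia.
  have t0 : t != 0 by lia.
  apply: E_Seq; first by apply: exec_move => //; rewrite R1t R10; lia.
  set R2 := upd (upd (upd R t x) t 0) 0 _.
  have e0 : R2 0 = x by rewrite /R2 updE eqxx R10 R1t.
  have e1 : R2 d = 0 by rewrite /R2 !updE; do 3 (case: eqP => //); lia.
  have d0' : d != 0 by lia.
  have e3 b : upd R2 d b 0 = x by rewrite updE; case: eqP => //; lia.
  have fin b : exec (CClear 0) (upd R2 d b, cp, o) (upd R d b, cp, o).
    by have Rt0 := Rt t (leqnn _); apply: exec_eq (exec_clear _ _ _ _) _; rewrite /R2; updlia.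
  have R2d : R2 = upd R2 d 0 by rewrite upd_id.
  have e4 b c : upd (upd R2 d b) d c = upd R2 d c by updlia.
  have Hn b a : (isym_nat (nth IBlank w x) = isym_nat a -> b + isym_nat a <= V) -> exec (CAddc d a) (upd R2 d b, cp, o)
      (upd R2 d (if isym_nat (nth IBlank w x) == isym_nat a then b + isym_nat a else b), cp, o).
    move=> hb; have := @exec_addc (upd R2 d b) cp o d a d0'; rewrite e3 updE eqxx => /(_ hb).
    by rewrite e4; case: ifP.
  rewrite {1}R2d.
  apply: E_Seq; first by apply: Hn => /=; lia.
  case E: (nth IBlank w x) => /=; rewrite ?add0n;
    (apply: E_Seq; [by apply: Hn; rewrite E /=; lia|rewrite E /=]);
    (apply: E_Seq; [by apply: Hn; rewrite E /=; lia|rewrite E /=]); exact: fin.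
- case: hf => hf1 hf2.
  apply: E_Seq.
    by apply: IH1 => //; env_side he Rt.
  set x := eval e1 w _ in hf2 *.
  have tenv : t \notin env by apply/negP => /(allP he); lia.
  have sub r : r \in iter k behead env -> r \in env.
    elim: k r {hf1 hf2 IH2} => //= k IH r hr; apply: IH; move: hr.
    by case: (iter k behead env) => //= a l hr; rewrite inE hr orbT.
  have em : map (upd R t x) (t :: iter k behead env) = x :: iter k behead (map R env).
    rewrite /= updE eqxx map_upd ?(contra (@sub t)) //; congr cons.
    by elim: (k) => //= k' <-; rewrite behead_map.
  apply: E_Seq.
    apply: IH2; rewrite ?em //; try by env_side he Rt.
    + by rewrite /=; apply/andP; split; [lia|apply/allP => r /sub /(allP he); lia].
    + by rewrite inE negb_or (contra (@sub d)) // andbT; lia.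
  rewrite em; set y := eval e2 w _.
  by have Rt0 := Rt t (leqnn _); apply: exec_eq (exec_clear _ _ _ _) _; updlia.
- have hb r : r \in behead env -> r \in env by case: (env) => //= x s; rewrite inE orbC => ->.
  rewrite behead_map in hf *.
  apply: IH => //; first by rewrite d0.
  + by apply/allP => r /hb /(allP he).
  + by apply: contra hd => /hb.
- case: hf => hfn hfa hfs.
  have tenv r : t <= r -> r \notin env by move=> hr; apply/negP => /(allP he); lia.
  have he' : all (fun r => 0 < r < t.+3) env by apply/allP => r /(allP he); lia.
  apply: E_Seq.
    by apply: IHn => //; env_side he Rt.
  set N := eval n w _ in hfs *.
  have NV : N <= V by exact: fits_eval hfn.
  have em : map (upd R t N) env = map R env by rewrite map_upd ?tenv.
  apply: E_Seq.
    by apply: IHa; rewrite ?em //; env_side he Rt.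
  rewrite em.
  pose ra i := rec_at a s w (map R env) i.
  (* The state before the round with index [i], with [k] rounds left and [ra i] accumulated. *)
  pose st i k := upd (upd (upd R t k) t.+1 i) d (ra i).
  have -> : upd (upd R t N) d (eval a w (map R env)) = st 0 N.
    have R1 := Rt t.+1 (leqnSn _); rewrite /st /ra /=; updlia.
  have loop i k : i + k = N -> exec (CWhile t (CSeq (cexp s (d :: t.+1 :: env) t.+2 t.+3)
                      (CSeq (CClear d) (CSeq (CMove t.+2 d) (CInc t.+1))))) (st i k, cp, o) (st N 0, cp, o).
    elim: k i => [|k IH] i ik.
      have -> : i = N by lia.
      apply: E_While0; rewrite /st; updval.
    have iN : i < N by lia.
    apply: (@E_WhileS _ _ _ _ _ _ _ _ k); first by rewrite /st; updval.
      have -> : upd (st i k.+1) t k = st i k by rewrite /st; updlia.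
      have em' : map (st i k) (d :: t.+1 :: env) = ra i :: i :: map R env.
        have a1 : st i k t.+1 = i by rewrite /st; updval.
        have a2 : st i k d = ra i by rewrite /st; updval.
        by rewrite /= a1 a2 /st map_upd // map_upd ?tenv // map_upd ?tenv.
      have fs := hfs _ iN.
      apply: E_Seq.
        apply: IHs; rewrite ?em' //=.
        + lia.
        + rewrite !inE !negb_or tenv ?andbT; lia.
        + rewrite /st; have R2 := Rt t.+2 (leqW (leqnSn _)); updval.
        + rewrite /st; updval.
        + move=> r hr; have Rr : R r = 0 by apply: Rt; lia.
          rewrite /st; updval.
      rewrite em' -/(ra i) -[eval s w _]/(ra i.+1).
      have raV : ra i.+1 <= V by exact: fits_eval fs.
      apply: E_Seq; first exact: exec_clear.
      set R3 := upd _ d 0.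
      have r31 : R3 t.+2 = ra i.+1 by rewrite /R3; updval.
      have r32 : R3 d = 0 by rewrite /R3 !updE eqxx.
      apply: E_Seq; first by apply: exec_move; rewrite ?r31 ?r32; lia.
      rewrite r31 r32; set R4 := upd _ d _.
      have r41 : R4 t.+1 = i by rewrite /R4 /R3 /st; updval.
      have := @E_Inc w ch V R4 cp o t.+1; rewrite r41 => /(_ ltac:(lia)); exact.
    have R2 := Rt t.+2 (leqW (leqnSn _)).
    set A := upd _ t.+1 i.+1; suff -> : A = st i.+1 k by apply: IH; lia.
    by rewrite /A /st; updlia.
  apply: E_Seq; first exact: loop.
  have R1 := Rt t.+1 (leqnSn _); have Rt0 := Rt t (leqnn _).
  by apply: exec_eq (exec_clear _ _ _ _) _; rewrite /st; updlia.
Qed.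
End Sem.

(** * Functions with polynomially bounded intermediate values *)

Notation allle N v := (all (fun a => a <= N) v).

Definition nrec (n a : nat) (s : nat -> nat -> nat) : nat := nat_rect (fun=> nat) a s n.

(** The exponent [c] is uniform in the input word and in the variables, so registers have O(log N)
    bits. The base [N + 2] is at least 2, which makes its powers monotone in the exponent and lets
    constants be absorbed there. *)
Definition L (F : seq isym -> seq nat -> nat) : Prop :=
  exists e c, forall w v, eval e w v = F w v /\
    forall N, allle N v -> fits e w v ((N + 2) ^ c).

Lemma L_ext F G : L F -> (forall w v, F w v = G w v) -> L G.
Proof. by move=> [e [c h]] FG; exists e, c => w v; rewrite -FG. Qed.

Lemma pw_mono N c c' : c <= c' -> (N + 2) ^ c <= (N + 2) ^ c'.
Proof. by move=> h; rewrite leq_exp2l // addn2. Qed.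

Lemma pw_gt0 N c : 0 < (N + 2) ^ c.
Proof. by rewrite expn_gt0 addn2. Qed.

Lemma pw_add2 N c : (N + 2) ^ c + 2 <= (N + 2) ^ (c + 2).
Proof. have := pw_gt0 N c; rewrite expnD; set X := _ ^ c; rewrite -mulnn; nia. Qed.

Lemma pw_self N c : N <= (N + 2) ^ c.+1.
Proof. by rewrite expnS; apply: leq_trans (leq_pmulr _ (pw_gt0 N c)); lia. Qed.

Lemma pw_comp N c d : ((N + 2) ^ c + 2) ^ d <= (N + 2) ^ ((c + 2) * d).
Proof. by rewrite expnM; case: d => // d; rewrite leq_exp2r // pw_add2. Qed.

Lemma allle_mono N N' v : N <= N' -> allle N v -> allle N' v.
Proof. by move=> le /allP h; apply/allP => x /h /leq_trans; apply. Qed.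

Lemma L_bound F : L F -> exists c, forall w v N, allle N v -> F w v <= (N + 2) ^ c.
Proof. by move=> [e [c h]]; exists c => w v N hv; have [<- hf] := h w v; apply: fits_eval (hf _ hv). Qed.

Lemma L_var i : L (fun w v => nth 0 v i).
Proof.
exists (Var i), 1 => w v; split=> // N hv /=; rewrite expn1.
have [lt|ge] := ltnP i (size v); last by rewrite nth_default.
by have /= := allP hv _ (mem_nth 0 lt); lia.
Qed.

Lemma L_succ F : L F -> L (fun w v => (F w v).+1).
Proof.
move=> [e [c h]]; exists (Succ e), (c + 2) => w v /=; have [-> hf] := h w v; split=> // N hv.
have := hf N hv => h1; have := fits_eval h1; have := pw_add2 N c; rewrite (h w v).1 => h2 h3.
split; last lia.
by apply: fits_mono h1; lia.
Qed.

Lemma L_const n : L (fun w v => n).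
Proof.
elim: n => [|n IH]; last exact: L_succ IH.
by exists Zero, 0 => w v; split.
Qed.

Definition inp (w : seq isym) a := isym_nat (nth IBlank w a).

Lemma L_inp F : L F -> L (fun w v => inp w (F w v)).
Proof.
move=> [e [c h]]; exists (Inp e), (c + 2) => w v /=; have [-> hf] := h w v; split=> // N hv.
have := pw_add2 N c; have := pw_gt0 N c => h2 h3; split; last lia.
by apply: fits_mono (hf N hv); lia.
Qed.

Lemma L_drop F : L F -> L (fun w v => F w (behead v)).
Proof.
move=> [e [c h]]; exists (Drop e), c => w v; split; first by have [] := h w (behead v).
move=> N hv; apply: (h w (behead v)).2; apply/allP=> x hx; apply: (allP hv).
by case: v hx {hv} => //= a v; rewrite inE orbC => ->.
Qed.

Lemma iter_behead_sub (v : seq nat) k : {subset iter k behead v <= v}.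
Proof.
elim: k => //= k IH x hx; apply: IH; move: hx.
by case: (iter k behead v) => //= a l hx; rewrite inE hx orbT.
Qed.

Lemma L_subst k F G : L F -> L G -> L (fun w v => G w (F w v :: iter k behead v)).
Proof.
move=> [e [c h]] [e' [c' h']]; exists (Let k e e'), (c + (c.+1 + 2) * c') => w v /=.
have [E1 h1] := h w v; have [E2 h2] := h' w (F w v :: iter k behead v); rewrite E1; split=> // N hv.
split; first by apply: fits_mono (h1 N hv); apply: pw_mono; lia.
apply: fits_mono (h2 ((N + 2) ^ c.+1) _).
  by apply: leq_trans (pw_comp _ _ _) _; apply: pw_mono; lia.
have hv' : allle N (iter k behead v) by apply/allP => x /iter_behead_sub /(allP hv).
rewrite /= (allle_mono _ hv') ?andbT ?pw_self //.
by rewrite -E1; apply: leq_trans (fits_eval (h1 N hv)) _; apply: pw_mono.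
Qed.

(** Variables are de Bruijn indices: under [k] binders the outer environment is [iter k behead v],
    and the last argument of [f] is bound as variable 0. *)
Lemma L_at k (f : seq isym -> seq nat -> nat -> nat) J :
  L (fun w v => f w (behead v) (nth 0 v 0)) -> L J -> L (fun w v => f w (iter k behead v) (J w v)).
Proof. by move=> hf hJ; have := L_subst k hJ hf. Qed.

Lemma L_dropn k F : L F -> L (fun w v => F w (iter k behead v)).
Proof.
move=> hF; elim: k => // k IH; apply: (L_ext (L_drop IH)) => w v.
by rewrite iterSr.
Qed.

(** A polynomially bounded step might square its accumulator in every round; hence the separate
    polynomial bound on all partial results. *)
Lemma L_rec n a s : L n -> L a -> L (fun w v => s w (behead (behead v)) (nth 0 v 1) (nth 0 v 0)) ->
  (exists c, forall w v N i, allle N v -> i <= n w v -> nrec i (a w v) (s w v) <= (N + 2) ^ c) ->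
  L (fun w v => nrec (n w v) (a w v) (s w v)).
Proof.
move=> [en [cn hn]] [ea [ca ha]] [es [cs hs]] [c hc].
exists (Rec en ea es), (cn + ca + ((cn + c).+1 + 2) * cs) => w v /=.
have E i : rec_at ea es w v i = nrec i (a w v) (s w v).
  rewrite /rec_at /nrec; elim: i => [|i IH] /=; first by rewrite (ha w v).1.
  by rewrite (hs _ _).1 /= IH.
have [En hn'] := hn w v; have [Ea ha'] := ha w v.
split; first by rewrite En; apply: E.
move=> N hv; split.
- by apply: fits_mono (hn' N hv); apply: pw_mono; lia.
- by apply: fits_mono (ha' N hv); apply: pw_mono; lia.
rewrite En => i hi; have [_ hs'] := hs w (rec_at ea es w v i :: i :: v).
apply: fits_mono (hs' ((N + 2) ^ (cn + c).+1) _).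
  by apply: leq_trans (pw_comp _ _ _) _; apply: pw_mono; lia.
rewrite /= (allle_mono _ hv) ?pw_self // andbT andbC; apply/andP; split.
  have := fits_eval (hn' N hv); rewrite En => h1; apply: leq_trans (ltnW hi) (leq_trans h1 _).
  by apply: pw_mono; lia.
rewrite E; apply: leq_trans (hc _ _ _ _ hv (ltnW hi)) _; apply: pw_mono; lia.
Qed.

Lemma L_pred F : L F -> L (fun w v => (F w v).-1).
Proof.
move=> hF; have [c hc] := L_bound hF.
apply: (@L_ext (fun w v => nrec (F w v) 0 (fun i _ => i))); last by move=> w v; case: (F w v).
apply: L_rec => //; [exact: L_const|exact: (L_var 1)|].
exists c => w v N i hv hi; apply: leq_trans (hc _ _ _ hv); apply: leq_trans hi.
by case: i => //= i.
Qed.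

Lemma L_add F G : L F -> L G -> L (fun w v => F w v + G w v).
Proof.
move=> hF hG; have [c hc] := L_bound hF; have [d hd] := L_bound hG.
have E i a : nrec i a (fun _ x => x.+1) = a + i by rewrite /nrec; elim: i => [|i /= ->] //=; rewrite ?addn0 ?addnS.
apply: (@L_ext (fun w v => nrec (G w v) (F w v) (fun _ x => x.+1))); last by move=> w v; rewrite E.
apply: L_rec => //; first exact: (L_succ (L_var 0)).
exists (c + d + 2) => w v N i hv hi; rewrite E.
have := hc w v N hv; have := hd w v N hv; have := pw_gt0 N c; have := pw_gt0 N d.
rewrite !expnD -mulnn; move: ((_ + _) ^ c) ((_ + _) ^ d) => X Y; nia.
Qed.

Lemma L_sub F G : L F -> L G -> L (fun w v => F w v - G w v).
Proof.
move=> hF hG; have [c hc] := L_bound hF.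
have E i a : nrec i a (fun _ x => x.-1) = a - i by rewrite /nrec; elim: i => [|i /= ->] //=; rewrite ?subn0 ?subnS.
apply: (@L_ext (fun w v => nrec (G w v) (F w v) (fun _ x => x.-1))); last by move=> w v; rewrite E.
apply: L_rec => //; first exact: (L_pred (L_var 0)).
by exists c => w v N i hv hi; rewrite E; apply: leq_trans (hc _ _ _ hv); apply: leq_subr.
Qed.

Definition nsum n (f : nat -> nat) := \sum_(0 <= i < n) f i.
Definition nall n (p : nat -> bool) := all p (iota 0 n).
Definition nex n (p : nat -> bool) := has p (iota 0 n).
Definition nmu n (p : nat -> bool) := find p (iota 0 n).

Lemma nsumS n f : nsum n.+1 f = nsum n f + f n.
Proof. by rewrite /nsum big_nat_recr. Qed.

(** Quotients, integer roots and logarithms are expressed as numbers of indices [j] passing a test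
    that amounts to [j < m]; this evaluates such a count. *)
Lemma nsum_lt z m : m <= z -> nsum z (fun j => j < m) = m.
Proof.
elim: z m => [|z IH] m mz; first by rewrite /nsum big_geq //; lia.
rewrite nsumS; move: mz; rewrite leq_eqVlt => /orP[/eqP ->|lt]; last by rewrite IH //; lia.
rewrite ltnSn addn1 -[in RHS](IH z (leqnn z)); congr S; apply: eq_big_nat => j /andP[_ jz].
by rewrite jz ltnS ltnW.
Qed.

Lemma nsum_le n f M : (forall i, i < n -> f i <= M) -> nsum n f <= n * M.
Proof.
elim: n => [|n IH] h; first by rewrite /nsum big_geq.
by rewrite nsumS mulSn addnC leq_add ?h ?IH // => i hi; apply: h; lia.
Qed.

Lemma L_sum n f : L n -> L (fun w v => f w (behead v) (nth 0 v 0)) -> L (fun w v => nsum (n w v) (f w v)).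
Proof.
move=> hn hf; have [c hc] := L_bound hn; have [d hd] := L_bound hf.
have E i g : nrec i 0 (fun j x => x + g j) = nsum i g.
  by elim: i => [|i IH]; [rewrite /nsum big_geq|rewrite nsumS -IH].
apply: (@L_ext (fun w v => nrec (n w v) 0 (fun j x => x + f w v j))); last by move=> w v; rewrite E.
apply: L_rec => //; first exact: L_const.
  apply: L_add; first exact: L_var.
  by apply: (L_ext (L_drop hf)) => w v; rewrite nth_behead.
exists (c + (c.+1 + 2) * d) => w v N i hv hi; rewrite E.
have := hc w v N hv => h1.
have hM j : j < i -> f w v j <= (N + 2) ^ ((c.+1 + 2) * d).
  move=> hj; apply: leq_trans (pw_comp _ _ _).
  have := hd w (j :: v) ((N + 2) ^ c.+1); apply.
  rewrite /= (allle_mono _ hv) ?pw_self // andbT; have := pw_mono N (leqnSn c); lia.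
apply: leq_trans (nsum_le hM) _.
by rewrite expnD leq_mul2r; apply/orP; right; lia.
Qed.

Lemma L_mul F G : L F -> L G -> L (fun w v => F w v * G w v).
Proof.
move=> hF hG; apply: (@L_ext (fun w v => nsum (G w v) (fun _ => F w v))).
  by apply: L_sum => //; apply: L_drop hF.
by move=> w v; rewrite /nsum sum_nat_const_nat subn0 mulnC.
Qed.

Notation LB p := (L (fun w v => nat_of_bool (p w v))).

Lemma L_eq0 F : L F -> LB (fun w v => F w v == 0).
Proof.
move=> hF; apply: (@L_ext (fun w v => nrec (F w v) 1 (fun _ _ => 0))); last by move=> w v; case: (F w v).
apply: L_rec => //; try exact: L_const.
exists 0 => w v N i _ _; by case: i.
Qed.

Lemma L_leq F G : L F -> L G -> LB (fun w v => F w v <= G w v).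
Proof. by move=> hF hG; apply: L_eq0 (L_sub hF hG). Qed.

Lemma L_and p q : LB p -> LB q -> LB (fun w v => p w v && q w v).
Proof. by move=> hp hq; apply: L_ext (L_mul hp hq) _ => w v; rewrite mulnb. Qed.

Lemma L_neg p : LB p -> LB (fun w v => ~~ p w v).
Proof. by move=> /L_eq0 h; apply: L_ext h _ => w v; case: (p w v). Qed.

Lemma L_or p q : LB p -> LB q -> LB (fun w v => p w v || q w v).
Proof.
move=> hp hq; apply: L_ext (L_neg (L_and (L_neg hp) (L_neg hq))) _ => w v.
by rewrite negb_and !negbK.
Qed.

Lemma L_imp p q : LB p -> LB q -> LB (fun w v => p w v ==> q w v).
Proof. by move=> hp hq; apply: L_ext (L_or (L_neg hp) hq) _ => w v; rewrite implybE. Qed.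

Lemma L_eqn F G : L F -> L G -> LB (fun w v => F w v == G w v).
Proof.
by move=> hF hG; apply: L_ext (L_and (L_leq hF hG) (L_leq hG hF)) _ => w v; rewrite -eqn_leq.
Qed.

Lemma L_if p F G : LB p -> L F -> L G -> L (fun w v => if p w v then F w v else G w v).
Proof.
move=> hp hF hG; apply: L_ext (L_add (L_mul hp hF) (L_mul (L_neg hp) hG)) _ => w v.
by case: (p w v); rewrite /= !(mul1n, mul0n, addn0).
Qed.

Lemma nexE n p : nex n p = (0 < nsum n (fun i => p i)).
Proof.
rewrite /nex; elim: n => [|n IH]; first by rewrite /nsum big_geq.
by rewrite nsumS -addn1 iotaD has_cat IH /= orbF addn_gt0; case: (p n).
Qed.

Lemma nallE n p : nall n p = ~~ nex n (fun i => ~~ p i).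
Proof. by rewrite /nex -all_predC; apply: eq_all => i /=; rewrite negbK. Qed.

Lemma L_ex n p : L n -> LB (fun w v => p w (behead v) (nth 0 v 0)) -> LB (fun w v => nex (n w v) (p w v)).
Proof.
move=> hn hp; apply: L_ext (L_leq (L_const 1) (L_sum hn (f := fun w v i => p w v i) hp)) _ => w v.
by rewrite nexE.
Qed.

Lemma L_all n p : L n -> LB (fun w v => p w (behead v) (nth 0 v 0)) -> LB (fun w v => nall (n w v) (p w v)).
Proof.
move=> hn hp; apply: L_ext (L_neg (L_ex hn (p := fun w v i => ~~ p w v i) (L_neg hp))) _ => w v.
by rewrite nallE.
Qed.

(** The first witness is the number of [i] such that no index up to [i] is a witness; bounded
    minimization thus reduces to bounded sums. *)
Lemma nmuE n p : nmu n p = nsum n (fun i => nall i.+1 (fun j => ~~ p j)).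
Proof.
rewrite /nmu; elim: n => [|n IH]; first by rewrite /nsum big_geq.
have hA : nall n.+1 (fun j => ~~ p j) = ~~ has p (iota 0 n) && ~~ p n.
  by rewrite /nall -addn1 iotaD all_cat /= andbT -all_predC.
rewrite nsumS -IH hA -{1}addn1 iotaD find_cat /= add0n size_iota.
case: ifP => h /=; first by rewrite addn0.
rewrite hasNfind ?h // size_iota; by case: (p n).
Qed.

Lemma L_mu n p : L n -> LB (fun w v => p w (behead v) (nth 0 v 0)) -> L (fun w v => nmu (n w v) (p w v)).
Proof.
move=> hn hp; apply: (@L_ext (fun w v => nsum (n w v) (fun i => nall i.+1 (fun j => ~~ p w v j)))).
  apply: L_sum => //; apply: L_all; first exact: L_succ (L_var 0).
  by apply: L_neg; apply: (L_at 2 (f := fun w v i => p w v i) hp (L_var 0)).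
by move=> w v; rewrite nmuE.
Qed.

Lemma L_rec_le n a s B : L n -> L a ->
  L (fun w v => s w (behead (behead v)) (nth 0 v 1) (nth 0 v 0)) -> L B ->
  (forall w v i, i <= n w v -> nrec i (a w v) (s w v) <= B w v) ->
  L (fun w v => nrec (n w v) (a w v) (s w v)).
Proof.
move=> hn ha hs /L_bound[c hc] hB; apply: L_rec => //; exists c => w v N i hv hi.
exact: leq_trans (hB _ _ _ hi) (hc _ _ _ hv).
Qed.

Definition nif (b : bool) (x y : nat) := if b then x else y.

(* [Lx1], [Lx2], ... are filled in as further functions are shown to be in [L]. *)
Ltac Lx1 := fail. Ltac Lx2 := fail. Ltac Lx3 := fail. Ltac Lx4 := fail. Ltac Lx5 := fail. Ltac Lx6 := fail.
Ltac Lx7 := fail. Ltac Lx8 := fail. Ltac Lx9 := fail. Ltac Lx10 := fail.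
Ltac Lext := first [Lx1 | Lx2 | Lx3 | Lx4 | Lx5 | Lx6 | Lx7 | Lx8 | Lx9 | Lx10].
Ltac Lhyp :=
  match goal with
  | H : L _ |- _ => first [exact H | exact (L_dropn 1 H) | exact (L_dropn 2 H) | exact (L_dropn 3 H) | exact (L_dropn 4 H)]
  end.
Ltac Lstep :=
  lazymatch goal with
  | |- L (fun w v => nth 0 v ?i) => exact (L_var i)
  | |- L (fun w v => nth 0 (behead v) ?i) => exact (L_dropn 1 (L_var i))
  | |- L (fun w v => nth 0 (behead (behead v)) ?i) => exact (L_dropn 2 (L_var i))
  | |- L (fun w v => nth 0 (behead (behead (behead v))) ?i) => exact (L_dropn 3 (L_var i))
  | |- L (fun w v => nth 0 (behead (behead (behead (behead v)))) ?i) => exact (L_dropn 4 (L_var i))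
  | |- L (fun w v => nth 0 (behead (behead (behead (behead (behead v))))) ?i) => exact (L_dropn 5 (L_var i))
  | |- L (fun w v => nth 0 (behead (behead (behead (behead (behead (behead v)))))) ?i) => exact (L_dropn 6 (L_var i))
  | |- L (fun w v => ?F w v) => Lhyp
  | |- L (fun w v => nat_of_bool (?F w v)) => Lhyp
  | |- L (fun w v => nat_of_bool (?F w (behead _))) => Lhyp
  | |- L (fun w v => ?F w (behead _)) => Lhyp
  | |- L (fun w v => inp w (@?A w v)) => apply (L_inp (F := A))
  | |- L (fun w v => (@?A w v).+1) => apply (L_succ (F := A))
  | |- L (fun w v => (@?A w v).-1) => apply (L_pred (F := A))
  | |- L (fun w v => @?A w v + @?B w v) => apply (L_add (F := A) (G := B))
  | |- L (fun w v => @?A w v - @?B w v) => apply (L_sub (F := A) (G := B))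
  | |- L (fun w v => @?A w v * @?B w v) => apply (L_mul (F := A) (G := B))
  | |- L (fun w v => nif (@?A w v) (@?B w v) (@?C w v)) => apply (L_if (p := A) (F := B) (G := C))
  | |- L (fun w v => nat_of_bool (@?A w v && @?B w v)) => apply (L_and (p := A) (q := B))
  | |- L (fun w v => nat_of_bool (@?A w v || @?B w v)) => apply (L_or (p := A) (q := B))
  | |- L (fun w v => nat_of_bool (@?A w v ==> @?B w v)) => apply (L_imp (p := A) (q := B))
  | |- L (fun w v => nat_of_bool (~~ @?A w v)) => apply (L_neg (p := A))
  | |- L (fun w v => nat_of_bool (@?A w v <= @?B w v)) => apply (L_leq (F := A) (G := B))
  | |- L (fun w v => nat_of_bool (@eq_op Datatypes_nat__canonical__eqtype_Equality (@?A w v) (@?B w v))) => apply (L_eqn (F := A) (G := B))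
  | |- L (fun w v => nsum (@?A w v) (@?f w v)) => apply (L_sum (n := A) (f := f))
  | |- L (fun w v => nmu (@?A w v) (@?p w v)) => apply (L_mu (n := A) (p := p))
  | |- L (fun w v => nat_of_bool (nex (@?A w v) (@?p w v))) => apply (L_ex (n := A) (p := p))
  | |- L (fun w v => nat_of_bool (nall (@?A w v) (@?p w v))) => apply (L_all (n := A) (p := p))
  | |- L (fun w v => ?f w v (@?J w v)) => first [Lext | refine (@L_at 0 f J _ _)]
  | |- L (fun w v => ?f w (behead v) (@?J w v)) => refine (@L_at 1 f J _ _)
  | |- L (fun w v => ?f w (behead (behead v)) (@?J w v)) => refine (@L_at 2 f J _ _)
  | |- L (fun w v => nat_of_bool (?f w v (@?J w v))) => first [Lext | refine (@L_at 0 (fun w v i => nat_of_bool (f w v i)) J _ _)]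
  | |- L (fun w v => nat_of_bool (?f w (behead v) (@?J w v))) => refine (@L_at 1 (fun w v i => nat_of_bool (f w v i)) J _ _)
  | |- L (fun w v => nat_of_bool (?f w (behead (behead v)) (@?J w v))) => refine (@L_at 2 (fun w v i => nat_of_bool (f w v i)) J _ _)
  | |- _ => Lext
  end; cbv beta.
Ltac Ls := cbv beta; repeat first [exact (L_const _) | progress Lstep | assumption].

Section Arith.
Variables F G : seq isym -> seq nat -> nat.
Hypotheses (hF : L F) (hG : L G).

Lemma divn_sum a b : a %/ b = if b == 0 then 0 else nsum a (fun j => j.+1 * b <= a).
Proof.
case: eqP => [->|/eqP b0]; first by rewrite divn0.
have {}b0 : 0 < b by rewrite lt0n.
rewrite -[LHS](nsum_lt (leq_div a b)); apply: eq_bigr => j _; by rewrite leq_divRL.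
Qed.

Lemma L_div : L (fun w v => F w v %/ G w v).
Proof.
apply: (@L_ext (fun w v => nif (G w v == 0) 0 (nsum (F w v) (fun j => j.+1 * G w v <= F w v)))).
  by Ls.
by move=> w v; rewrite divn_sum.
Qed.

Lemma L_mod : L (fun w v => F w v %% G w v).
Proof.
apply: (@L_ext (fun w v => F w v - F w v %/ G w v * G w v)); last first.
  by move=> w v; rewrite {1}(divn_eq (F w v) (G w v)) addKn.
have hD := L_div; by Ls.
Qed.

Lemma L_max : L (fun w v => maxn (F w v) (G w v)).
Proof. apply: (@L_ext (fun w v => nif (F w v < G w v) (G w v) (F w v))) => //. by Ls. Qed.

Lemma L_min : L (fun w v => minn (F w v) (G w v)).
Proof. apply: (@L_ext (fun w v => nif (F w v < G w v) (F w v) (G w v))) => //. by Ls. Qed.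

End Arith.

Lemma L_odd F : L F -> LB (fun w v => odd (F w v)).
Proof. by move=> hF; apply: (L_ext (L_mod hF (L_const 2))) => w v; rewrite modn2. Qed.

(* [min (2 ^ a) b] for [b > 0], without ever exceeding [b]. *)
Definition pow2c a b := nrec a (minn 1 b) (fun _ x => minn (x + x) b).

Lemma pow2cE a b : pow2c a b = minn (2 ^ a) b.
Proof. by rewrite /pow2c /nrec; elim: a => //= a ->; rewrite expnS; move: (2 ^ a) => X; lia. Qed.

Ltac Lx1 ::= lazymatch goal with
  | |- L (fun w v => @?A w v %/ @?B w v) => apply (L_div (F := A) (G := B))
  | |- L (fun w v => @?A w v %% @?B w v) => apply (L_mod (F := A) (G := B))
  | |- L (fun w v => maxn (@?A w v) (@?B w v)) => apply (L_max (F := A) (G := B))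
  | |- L (fun w v => minn (@?A w v) (@?B w v)) => apply (L_min (F := A) (G := B))
  | |- L (fun w v => nat_of_bool (odd (@?A w v))) => apply (L_odd (F := A))
  end.

Lemma L_pow2c F G : L F -> L G -> L (fun w v => pow2c (F w v) (G w v)).
Proof.
move=> hF hG; apply: (L_rec_le (s := fun w v _ x => minn (x + x) (G w v)) (B := G)) => //; Ls.
by move=> w v i _; rewrite -/(pow2c _ _) pow2cE geq_minr.
Qed.

Lemma L_exp n F : L F -> L (fun w v => F w v ^ n).
Proof.
move=> hF; elim: n => [|n IH]; first exact: L_const.
apply: (@L_ext (fun w v => F w v * F w v ^ n)); first exact: (L_mul hF IH).
by move=> w v; rewrite expnS.
Qed.

Ltac Lx2 ::= lazymatch goal with
  | |- L (fun w v => pow2c (@?A w v) (@?B w v)) => apply (L_pow2c (F := A) (G := B))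
  | |- L (fun w v => (@?A w v) ^ ?n) => apply (@L_exp n A)
  end.

(** * Machines computing and counting *)

Inductive emi := EOut of option bool | ESeq of emi & emi | EFor of exp & emi.

Fixpoint esem (m : emi) (w : seq isym) (v : seq nat) : seq (option bool) :=
  match m with
  | EOut o => [:: o]
  | ESeq m1 m2 => esem m1 w v ++ esem m2 w v
  | EFor e m => flatten [seq esem m w (j :: v) | j <- iota 0 (eval e w v)]
  end.

Fixpoint efits (m : emi) (w : seq isym) (v : seq nat) (V : nat) : Prop :=
  match m with
  | EOut o => True
  | ESeq m1 m2 => efits m1 w v V /\ efits m2 w v V
  | EFor e m => fits e w v V /\ forall j, j < eval e w v -> efits m w (j :: v) V
  end.

Fixpoint cemi (m : emi) (env : seq nat) (t : nat) : cmd :=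
  match m with
  | EOut o => CEmit o
  | ESeq m1 m2 => CSeq (cemi m1 env t) (cemi m2 env t)
  | EFor e m => CSeq (cexp e env t t.+2)
      (CSeq (CWhile t (CSeq (cemi m (t.+1 :: env) t.+2) (CInc t.+1))) (CClear t.+1))
  end.

(** The only loop with no bound fixed beforehand: [d] counts up to the first zero of [e]. It finds
    the length of the input, the parameter and the simulation bound. *)
Definition csearch (e : exp) (env : seq nat) (d t : nat) : cmd :=
  CSeq (cexp e (d :: env) t t.+1) (CWhile t (CSeq (CInc d) (cexp e (d :: env) t t.+1))).

Lemma choice_free_cemi m env t : choice_free (cemi m env t).
Proof. by elim: m env t => //= [m1 h1 m2 h2|e m h] env t; rewrite ?h1 ?h2 ?choice_free_cexp ?h. Qed.

Section Exec.
Variables (w : seq isym) (ch : nat -> bool) (V : nat).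
Notation exec := (exec w ch V).

Lemma exec_cemi m env t R cp o :
  0 < t -> all (fun r => 0 < r < t) env ->
  R 0 = 0 -> (forall r, t <= r -> R r = 0) -> efits m w (map R env) V ->
  exec (cemi m env t) (R, cp, o) (R, cp, o ++ esem m w (map R env)).
Proof.
elim: m env t R o => [x|m1 IH1 m2 IH2|e m IH] env t R o t0 he R0 Rt /=.
- by move=> _; rewrite cats1; apply: E_Emit.
- by case=> h1 h2; apply: E_Seq; [apply: IH1|rewrite catA; apply: IH2].
case=> hf hm.
have tenv r : t <= r -> r \notin env by move=> hr; apply/negP => /(allP he); lia.
apply: E_Seq.
  by apply: exec_cexp => //; env_side he Rt.
set n := eval e w _ in hm *; have nV : n <= V by exact: fits_eval hf.
pose st i k := upd (upd R t k) t.+1 i.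
pose out i := flatten [seq esem m w (j :: map R env) | j <- iota 0 i].
have -> : upd R t n = st 0 n by have R1 := Rt t.+1 (leqnSn _); rewrite /st; updlia.
have loop i k : i + k = n -> exec (CWhile t (CSeq (cemi m (t.+1 :: env) t.+2) (CInc t.+1)))
    (st i k, cp, o ++ out i) (st n 0, cp, o ++ out n).
  elim: k i => [|k IHk] i ik.
    have -> : i = n by lia.
    by apply: E_While0; rewrite /st; updval.
  apply: (@E_WhileS _ _ _ _ _ _ _ _ k); first by rewrite /st; updval.
    have -> : upd (st i k.+1) t k = st i k by rewrite /st; updlia.
    have a1 : st i k t.+1 = i by rewrite /st; updval.
    have em : map (st i k) (t.+1 :: env) = i :: map R env.
      by rewrite /= a1 /st map_upd ?tenv // map_upd ?tenv.
    apply: E_Seq.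
      apply: IH; rewrite ?em //=.
      + by apply/andP; split; first lia; apply/allP => r /(allP he); lia.
      + by rewrite /st; updval.
      + by move=> r hr; have Rr : R r = 0 by [apply: Rt; lia]; rewrite /st; updval.
      + by apply: hm; lia.
    have := @E_Inc w ch V (st i k) cp ((o ++ out i) ++ esem m w (i :: map R env)) t.+1.
    rewrite em a1; apply; lia.
  have -> : upd (st i k) t.+1 i.+1 = st i.+1 k by rewrite /st; updlia.
  have -> : (o ++ out i) ++ esem m w (i :: map R env) = o ++ out i.+1.
    by rewrite -catA /out -addn1 iotaD map_cat flatten_cat /= cats0.
  by apply: IHk; lia.
apply: E_Seq; first by have := loop 0 n erefl; rewrite /out /= cats0; apply.
have Rt0 := Rt t (leqnn _); have Rt1 := Rt t.+1 (leqnSn _).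
by apply: exec_eq (exec_clear _ _ _ _ _ _ _) _; rewrite /st; updlia.
Qed.

Lemma exec_csearch e env d t R cp o T :
  0 < d < t -> all (fun r => 0 < r < d) env ->
  R 0 = 0 -> (forall r, d <= r -> R r = 0) ->
  (forall j, j < T -> eval e w (j :: map R env) = 1) -> eval e w (T :: map R env) = 0 ->
  (forall j, j <= T -> fits e w (j :: map R env) V) -> T <= V ->
  exec (csearch e env d t) (R, cp, o) (upd R d T, cp, o).
Proof.
move=> /andP[d0 dt] he R0 Rt h1 h2 hf TV.
have tenv r : d <= r -> r \notin env by move=> hr; apply/negP => /(allP he); lia.
pose st j f := upd (upd R d j) t f.
have ev j : j <= T -> exec (cexp e (d :: env) t t.+1) (st j 0, cp, o) (st j (eval e w (j :: map R env)), cp, o).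
  move=> jT.
  have a1 : st j 0 d = j by rewrite /st; updval.
  have em : map (st j 0) (d :: env) = j :: map R env.
    by rewrite /= a1 /st map_upd ?tenv // ?map_upd ?tenv // ltnW.
  have := @exec_cexp w ch V e (d :: env) t t.+1 (st j 0) cp o; rewrite em.
  have -> : upd (st j 0) t (eval e w (j :: map R env)) = st j (eval e w (j :: map R env)) by rewrite /st; updlia.
  apply => //.
  - lia.
  - by rewrite /= d0 (leq_trans dt) //=; apply/allP => r /(allP he); lia.
  - by rewrite inE negb_or tenv ?(ltnW dt) // andbT; lia.
  - by rewrite /st; updval.
  - by rewrite /st; updval.
  - by move=> r hr; have Rr : R r = 0 by [apply: Rt; lia]; rewrite /st; updval.
  - exact: hf.
have loop k j : j + k = T -> exec (CWhile t (CSeq (CInc d) (cexp e (d :: env) t t.+1)))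
   (st j (eval e w (j :: map R env)), cp, o) (st T 0, cp, o).
  elim: k j => [|k IH] j jk.
    have -> : j = T by lia.
    by rewrite h2; apply: E_While0; rewrite /st; updval.
  rewrite h1; last lia.
  apply: (@E_WhileS _ _ _ _ _ _ _ _ 0); first by rewrite /st; updval.
    have -> : upd (st j 1) t 0 = st j 0 by rewrite /st; updlia.
    have a1 : st j 0 d = j by rewrite /st; updval.
    apply: E_Seq; first by apply: E_Inc; rewrite a1; lia.
    rewrite a1; have -> : upd (st j 0) d j.+1 = st j.+1 0 by rewrite /st; updlia.
    by apply: ev; lia.
  by apply: IH; lia.
have R1 := Rt d (leqnn _); have R2 := Rt t (ltnW dt).
have -> : R = st 0 0 by rewrite /st; updlia.
apply: E_Seq; first by apply: ev.
have := loop T 0 erefl.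
have -> : st T 0 = upd (st 0 0) d T by rewrite /st; updlia.
exact.
Qed.

End Exec.

(** Variable [i] sits in register [size v - i]: pushing a new variable fills the next free register
    and moves nothing. *)
Definition Rof (v : seq nat) : nat -> nat :=
  fun r => if 0 < r <= size v then nth 0 v (size v - r) else 0.
Definition regs d := rev (iota 1 d).

Lemma map_Rof v : map (Rof v) (regs (size v)) = v.
Proof.
apply: (@eq_from_nth _ 0); rewrite size_map size_rev size_iota // => i hi.
rewrite (nth_map 0) ?size_rev ?size_iota // nth_rev ?size_iota // nth_iota ?size_iota; last lia.
by rewrite /Rof; case: ifP => [_|]; [congr nth; lia|lia].
Qed.

Lemma Rof_cons T v : upd (Rof v) (size v).+1 T = Rof (T :: v).
Proof.
apply: functional_extensionality => r; rewrite /upd /Rof /=; case: eqP => [->|ne].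
  by rewrite ltnSn subnn.
case: (ltnP r (size v).+1) => h.
  case: r ne h => // r ne h; rewrite ltnS in h.
  have -> : 0 < r.+1 <= (size v) by lia.
  have -> : 0 < r.+1 <= (size v).+1 by lia.
  by rewrite subSS; have -> : size v - r = (size v - r.+1).+1 by lia.
have -> : 0 < r <= size v = false by lia.
by have -> : 0 < r <= (size v).+1 = false by lia.
Qed.

Lemma mem_regs d r : r \in regs d -> 0 < r <= d.
Proof. by rewrite mem_rev mem_iota; lia. Qed.

Fixpoint csearches (es : seq exp) (d t : nat) : cmd :=
  if es is e :: es' then CSeq (csearch e (regs d) d.+1 t) (csearches es' d.+1 t) else CSkip.

Inductive srch_ok (w : seq isym) (V : nat) : seq exp -> seq nat -> seq nat -> Prop :=
  | SNil v : srch_ok w V [::] v v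
  | SCons e es v T v' : (forall j, j < T -> eval e w (j :: v) = 1) -> eval e w (T :: v) = 0 ->
      (forall j, j <= T -> fits e w (j :: v) V) -> T <= V -> srch_ok w V es (T :: v) v' ->
      srch_ok w V (e :: es) v v'.

Lemma srch_cons w N C c p e es v T v' :
  (forall w v, eval e w v = nat_of_bool (~~ p w v) /\ forall N, allle N v -> fits e w v ((N + 2) ^ c)) ->
  c < C -> allle N (T :: v) -> (forall j, j < T -> ~~ p w (j :: v)) -> p w (T :: v) ->
  srch_ok w ((N + 2) ^ C) es (T :: v) v' -> srch_ok w ((N + 2) ^ C) (e :: es) v v'.
Proof.
move=> he cC /= /andP[TN hv] h1 h2; apply: SCons.
- by move=> j /h1; rewrite (he _ _).1 => ->.
- by rewrite (he _ _).1 h2.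
- move=> j jT; apply: fits_mono (pw_mono N (ltnW cC)) _; apply: (he _ _).2.
  by rewrite /= (leq_trans jT).
- exact: leq_trans TN (leq_trans (pw_self N c) (pw_mono N cC)).
Qed.

Lemma srch_size w V es v v' : srch_ok w V es v v' -> size v' = size v + size es.
Proof. by elim=> {es v v'} [v|e es v T v' _ _ _ _ _ ->] /=; rewrite ?addn0 // addnS. Qed.

Lemma exec_csearches w ch V es v v' t cp o : srch_ok w V es v v' -> size v + size es < t ->
  exec w ch V (csearches es (size v) t) (Rof v, cp, o) (Rof v', cp, o).
Proof.
move=> h; elim: h => {es v v'} [v|e es v T v' h1 h2 h3 h4 _ IH] /= ht; first exact: E_Skip.
apply: (E_Seq (s2 := (Rof (T :: v), cp, o))); last by apply: IH => /=; lia.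
rewrite -Rof_cons; apply: exec_csearch; rewrite ?map_Rof //.
- lia.
- by apply/allP => r /mem_regs; lia.
- move=> r hr; rewrite /Rof; case: ifP => //; lia.
Qed.

Definition det_cmd es m := let t := (size es).+1 in
  CSeq (csearches es 0 t) (cemi m (regs (size es)) t).
(** The register tested for acceptance lies above those of the found values and is 0 at the end, so
    the machine accepts as soon as its searches succeed. *)
Definition detM es m := cTM (det_cmd es m) (size es).+1.

Lemma detM_det es m : deterministic (detM es m).
Proof.
apply: cTM_det; rewrite /= choice_free_cemi andbT.
by elim: es 0 _.+1 => //= e es IH d t; rewrite !choice_free_cexp IH.
Qed.

Lemma detM_run es m w ch V v : 0 < V -> srch_ok w V es [::] v -> efits m w v V ->
  exists t, [/\ c_state (run (detM es m) w ch t) = tm_acc (detM es m),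
    c_out (run (detM es m) w ch t) = esem m w v &
    forall t', cspace _ (run (detM es m) w ch t') <= 2 * (lg V).+1].
Proof.
move=> V0 hs hm; have sv := srch_size hs; rewrite add0n in sv.
have he : exec w ch V (det_cmd es m) (fun=> 0, 0, [::]) (Rof v, 0, [::] ++ esem m w v).
  have -> : (fun=> 0) = Rof [::].
    by apply: functional_extensionality => r; rewrite /Rof /=; case: ifP => //; lia.
  apply: (E_Seq (s2 := (Rof v, 0, [::]))); first exact: (exec_csearches ch _ _ hs).
  have := @exec_cemi w ch V m (regs (size es)) (size es).+1 (Rof v) 0 [::].
  rewrite -sv map_Rof; apply => //.
  - by apply/allP => r /mem_regs; lia.
  - by move=> r hr; rewrite /Rof; case: ifP => //; lia.
have [t [h1 _ h2 h3 _]] := cTM_run (size es).+1 V0 he.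
exists t; split=> //; rewrite h1 /Rof.
by have -> : 0 < (size es).+1 <= size v = false by lia.
Qed.

Definition LE (S : seq isym -> seq nat -> seq (option bool)) : Prop :=
  exists m c, forall w v, esem m w v = S w v /\
    forall N, allle N v -> efits m w v ((N + 2) ^ c).

Lemma efits_mono m w v V V' : V <= V' -> efits m w v V -> efits m w v V'.
Proof.
move=> le; elim: m v => //= [m1 h1 m2 h2|e m IH] v [].
  by move=> /h1 a /h2.
by move=> /(fits_mono le) a h; split=> // j /h /IH.
Qed.

Lemma LE_ext S S' : LE S -> (forall w v, S w v = S' w v) -> LE S'.
Proof. by move=> [m [c h]] e; exists m, c => w v; rewrite -e. Qed.

Lemma LE_out o : LE (fun _ _ => [:: o]).
Proof. by exists (EOut o), 0. Qed.

Lemma LE_cat S S' : LE S -> LE S' -> LE (fun w v => S w v ++ S' w v).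
Proof.
move=> [m [c h]] [m' [c' h']]; exists (ESeq m m'), (c + c') => w v /=.
rewrite (h w v).1 (h' w v).1; split=> // N hv.
by split; apply: efits_mono (pw_mono _ _) _; [idtac|exact: (h w v).2|idtac|exact: (h' w v).2]; lia.
Qed.

Lemma LE_for n S : L n -> LE (fun w v => S w (behead v) (nth 0 v 0)) ->
  LE (fun w v => flatten [seq S w v j | j <- iota 0 (n w v)]).
Proof.
move=> [e [c h]] [m [d hm]]; exists (EFor e m), (c + (c.+1 + 2) * d) => w v /=.
have [E hf] := h w v; rewrite E; split.
  by congr flatten; apply: eq_map => j; rewrite (hm _ _).1.
move=> N hv; split; first by apply: fits_mono (hf N hv); apply: pw_mono; lia.
move=> j jn; have hj : j <= (N + 2) ^ c.
  by apply: leq_trans (ltnW jn) _; rewrite -E; apply: fits_eval (hf N hv).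
have := (hm w (j :: v)).2 ((N + 2) ^ c.+1); rewrite /= (allle_mono _ hv) ?pw_self // andbT => hh.
apply: efits_mono (hh _).
  by apply: leq_trans (pw_comp _ _ _) _; apply: pw_mono; lia.
by apply: leq_trans hj _; apply: pw_mono.
Qed.

Lemma LE_unary n b : L n -> LE (fun w v => nseq (n w v) (Some b)).
Proof.
move=> hn; apply: (LE_ext (LE_for (S := fun _ _ _ => [:: Some b]) hn (LE_out _))) => w v.
by move: (n w v) => k; rewrite -[in RHS](size_iota 0 k); elim: (iota 0 k) => //= _ l ->.
Qed.

Definition enc (s : seq nat) : seq bool := flatten [seq rcons (nseq n true) false | n <- s].

Definition LN (S : seq isym -> seq nat -> seq nat) := LE (fun w v => map Some (enc (S w v))).

Lemma enc_cat s s' : enc (s ++ s') = enc s ++ enc s'.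
Proof. by rewrite /enc map_cat flatten_cat. Qed.

Lemma LN_num n : L n -> LN (fun w v => [:: n w v]).
Proof.
move=> hn; apply: (LE_ext (LE_cat (LE_unary true hn) (LE_out (Some false)))) => w v.
by rewrite /enc /= cats0 map_rcons map_nseq cats1.
Qed.

Lemma LN_cat S S' : LN S -> LN S' -> LN (fun w v => S w v ++ S' w v).
Proof. by move=> h h'; apply: (LE_ext (LE_cat h h')) => w v; rewrite enc_cat map_cat. Qed.

Lemma LN_cons n S : L n -> LN S -> LN (fun w v => n w v :: S w v).
Proof. by move=> h h'; apply: (LE_ext (LN_cat (LN_num h) h')) => w v. Qed.

Lemma LN_nil : LN (fun _ _ => [::]).
Proof. apply: (LE_ext (LE_unary true (L_const 0))) => //. Qed.

Lemma LN_for n S : L n -> LN (fun w v => S w (behead v) (nth 0 v 0)) ->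
  LN (fun w v => flatten [seq S w v j | j <- iota 0 (n w v)]).
Proof.
move=> hn hS; apply: (LE_ext (LE_for (S := fun w v j => map Some (enc (S w v j))) hn hS)) => w v.
by elim: (iota _ _) => //= j l ->; rewrite enc_cat map_cat.
Qed.

Lemma inp_x x k j : j < size x -> inp (input_word x k) j = nth false x j.
Proof.
move=> h; rewrite /inp /input_word nth_cat size_map h (nth_map false) //.
by case: (nth _ _ _).
Qed.

Lemma inp_sep x k : inp (input_word x k) (size x) = 2.
Proof. by rewrite /inp /input_word nth_cat size_map ltnn subnn. Qed.

Lemma inp_k x k j : inp (input_word x k) (size x + 1 + j) = if j < k then 1 else 3.
Proof.
rewrite /inp /input_word nth_cat size_map.
have -> : size x + 1 + j < size x = false by lia.
have -> : size x + 1 + j - size x = j.+1 by lia.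
by rewrite /= nth_nseq; case: ifP.
Qed.

(** The length of [x] is the position of the first separator (code 2); the parameter is then the
    distance from there to the first blank (code 3). *)
Lemma srch_len x k N C c e es v' (w := input_word x k) :
  (forall w v, eval e w v = nat_of_bool (~~ (inp w (nth 0 v 0) == 2)) /\
     forall N, allle N v -> fits e w v ((N + 2) ^ c)) ->
  c < C -> size x <= N ->
  srch_ok w ((N + 2) ^ C) es [:: size x] v' -> srch_ok w ((N + 2) ^ C) (e :: es) [::] v'.
Proof.
move=> he cC hN; apply: (srch_cons he) => //= [|j hj|]; rewrite ?hN ?inp_sep ?inp_x //.
by case: (nth _ _ _).
Qed.

Lemma srch_par x k N C c e es v' (w := input_word x k) :
  (forall w v, eval e w v = nat_of_bool (~~ (inp w (nth 0 v 1 + 1 + nth 0 v 0) == 3)) /\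
     forall N, allle N v -> fits e w v ((N + 2) ^ c)) ->
  c < C -> size x + k <= N ->
  srch_ok w ((N + 2) ^ C) es [:: k; size x] v' -> srch_ok w ((N + 2) ^ C) (e :: es) [:: size x] v'.
Proof.
move=> he cC hN; apply: (srch_cons he) => //= [|j hj|]; rewrite ?inp_k ?hj ?ltnn //.
by rewrite andbT; lia.
Qed.

Section Machines.
Variable h : nat -> nat -> nat -> bool.
Hypothesis hL : LB (fun w v => h (nth 0 v 0) (nth 0 v 1) (nth 0 v 2)).
Variable S : seq isym -> seq nat -> seq (option bool).
Hypothesis hS : LE S.

(** The machine determines [|x|] and [k], searches for the least [T] passing [h], then emits [S].
    The search would not end without such a [T], so its existence is assumed input by input, while
    [M] and [C] are uniform. *)
Lemma red_machine : exists M C, deterministic M /\ forall x k ch T,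
  h T k (size x) -> (forall j, j < T -> ~~ h j k (size x)) ->
  exists t, [/\ c_state (run M (input_word x k) ch t) = tm_acc M,
    c_out (run M (input_word x k) ch t) = S (input_word x k) [:: T; k; size x] &
    forall t', cspace _ (run M (input_word x k) ch t') <= 2 * (lg ((size x + k + T + 2) ^ C)).+1].
Proof.
have [e1 [c1 h1]] : LB (fun w v => ~~ (inp w (nth 0 v 0) == 2)) by Ls.
have [e2 [c2 h2]] : LB (fun w v => ~~ (inp w (nth 0 v 1 + 1 + nth 0 v 0) == 3)) by Ls.
have [e3 [c3 h3]] := L_neg hL.
have [m [c4 hm]] := hS.
exists (detM [:: e1; e2; e3] m), (c1 + c2 + c3 + c4 + 1); split; first exact: detM_det.
move=> x k ch T hT hmin; set w := input_word x k.
pose N := size x + k + T; pose V := (N + 2) ^ (c1 + c2 + c3 + c4 + 1).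
have VN : N <= V by rewrite /V addn1 pw_self.
have hs : srch_ok w V [:: e1; e2; e3] [::] [:: T; k; size x].
  apply: (srch_len h1); [lia|by rewrite /N; lia|].
  apply: (srch_par h2); [lia|by rewrite /N; lia|].
  by apply: (srch_cons (T := T) (p := fun w v => h (nth 0 v 0) (nth 0 v 1) (nth 0 v 2)) h3) => //=; [lia|rewrite /N; lia|exact: SNil].
have hm' : efits m w [:: T; k; size x] V.
  apply: efits_mono ((hm _ _).2 N _); first by apply: pw_mono; lia.
  by rewrite /= /N; lia.
have [t [a1 a2 a3]] := detM_run ch (pw_gt0 _ _) hs hm'.
by exists t; split=> //; rewrite a2 (hm _ _).1.
Qed.

End Machines.

Section Computable.
Variable h : nat -> nat -> bool.
Hypothesis hL : LB (fun w v => h (nth 0 v 0) (nth 0 v 1)).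
Hypothesis hex : forall k, exists T, h T k.
Definition Tmin k := ex_minn (hex k).

Lemma TminP k : h (Tmin k) k.
Proof. by rewrite /Tmin; case: ex_minnP. Qed.

Lemma Tmin_min k j : j < Tmin k -> ~~ h j k.
Proof. by rewrite /Tmin; case: ex_minnP => m _ hm jm; apply/negP => /hm; lia. Qed.

(** The search machine is run on [1^k] with parameter 0: the role of [k] passes to the input length,
    which is variable 2. Least witnesses of tests in [L] may thus occur in computable bounds. *)
Lemma computable_L phi : L (fun w v => phi (nth 0 v 0) (nth 0 v 1)) ->
  computable (fun k => phi (Tmin k) k).
Proof.
have sub G : L (fun w v => G (nth 0 v 0) (nth 0 v 1)) -> L (fun w v => G (nth 0 v 0) (nth 0 v 2)).
  by move=> hG; apply: (L_ext (L_subst 2 (L_var 0) hG)) => w v /=; rewrite !nth_behead.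
move=> hp; have [M [C [_ hM]]] := red_machine (h := fun T _ n => h T n) 
  (sub (fun a c => nat_of_bool (h a c)) hL) (LE_unary true (sub phi hp)).
exists M => n; have := hM (nseq n true) 0 (fun=> false) (Tmin n); rewrite size_nseq.
by move=> /(_ (TminP n) (@Tmin_min n)) [t [h1 h2 _]]; exists t.
Qed.

(** By [n + K + 2 < 2 ^ (lg n + (K + 2))], the logarithm of a polynomial in [n + K] splits into a
    multiple of [lg n] and a linear function of [K], the shape required by [paraL]. *)
Lemma lg_space n K C : 2 * (lg ((n + K + 2) ^ C)).+1 <= 2 * C * lg n + (2 * C * (K + 2) + 4).
Proof.
have h1 : n + K + 2 < 2 ^ (lg n + (K + 2)).
  have : n < 2 ^ lg n by apply: trunc_log_ltn.
  have : K + 2 < 2 ^ (K + 2) by apply: ltn_expl.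
  rewrite [2 ^ (lg n + _)]expnD; move: (2 ^ lg n) (2 ^ (K + 2)) => X Y; nia.
have h2 : (n + K + 2) ^ C <= 2 ^ ((lg n + (K + 2)) * C).
  by rewrite expnM; case: C => // C; rewrite leq_exp2r // ltnW.
have h3 : lg ((n + K + 2) ^ C) <= ((lg n + (K + 2)) * C).+1.
  rewrite /lg ltnS -[X in _ <= X](@trunc_expnK 2) //; exact: leq_trunc_log.
nia.
Qed.

Lemma paraL_intro M C : (forall x k ch t, cspace M (run M (input_word x k) ch t) <=
   2 * (lg ((size x + (k + Tmin k) + 2) ^ C)).+1) -> paraL M.
Proof.
move=> hM; exists (fun k => 2 * C * (k + Tmin k + 2) + 4); split.
  by apply: (computable_L (phi := fun T k => 2 * C * (k + T + 2) + 4)); Ls.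
by exists (2 * C) => x k ch t; apply: leq_trans (hM _ _ _ _) _; apply: lg_space.
Qed.

End Computable.

(** * Accepting paths and blocks of choice bits *)

Lemma acc_pathE M x k u : read_once M ->
  acc_path M x k u <-> exists t, c_state (run M (input_word x k) (nth false u) t) = tm_acc M /\
    c_cpos (run M (input_word x k) (nth false u) t) = size u.
Proof.
move=> ro; have mx t : \max_(s < t.+1) c_cpos (run M (input_word x k) (nth false u) s) =
    c_cpos (run M (input_word x k) (nth false u) t).
  apply/eqP; rewrite eqn_leq; apply/andP; split.
    by apply/bigmax_leqP => s _; apply: cpos_mono => //; rewrite -ltnS.
  exact: (leq_bigmax (@Ordinal t.+1 t (ltnSn t))).
by split=> -[t [h1 h2]]; exists t; split=> //; rewrite -?h2 ?mx // -mx.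
Qed.

(* The [i]-th block of [l] bits, most significant bit first. *)
Definition blk (ch : nat -> bool) (i l : nat) : nat :=
  nrec l 0 (fun j y => y + y + ch (i * l + j)).

Definition blkn (c : nat -> bool) j := nrec j 0 (fun m y => y + y + c m).

Lemma blkn_lt c j : blkn c j < 2 ^ j.
Proof.
elim: j => [|j IH] //; rewrite expnS /blkn /nrec /= -/(nrec j _ _) -/(blkn c j).
by move: (2 ^ j) IH => X; case: (c j); lia.
Qed.

Lemma nb_double y (b : bool) i : nb (y + y + b) i.+1 = nb y i.
Proof. by rewrite nbS; congr nb; case: b; lia. Qed.

Lemma nb_blkn c j m : m < j -> nb (blkn c j) (j - 1 - m) = c m.
Proof.
elim: j => // j IH; rewrite ltnS /blkn /nrec /= -/(nrec j _ _) -/(blkn c j) leq_eqVlt => /orP[/eqP->|lt].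
  have -> : j.+1 - 1 - j = 0 by lia.
  by rewrite nb0n oddD addnn odd_double oddb.
have -> : j.+1 - 1 - m = (j - 1 - m).+1 by lia.
by rewrite nb_double IH.
Qed.

Lemma blk_lt ch i l : blk ch i l < 2 ^ l.
Proof. exact: (blkn_lt (fun j => ch (i * l + j))). Qed.

Lemma nb_blk ch i l j : j < l -> nb (blk ch i l) (l - 1 - j) = ch (i * l + j).
Proof. exact: (nb_blkn (fun j => ch (i * l + j))). Qed.

Definition blkf b l (u : (b * l).-tuple bool) : {ffun 'I_b -> 'I_(2 ^ l)} :=
  [ffun i : 'I_b => Ordinal (blk_lt (nth false u) i l)].

Lemma blkf_inj b l : injective (@blkf b l).
Proof.
move=> u u' e; apply: val_inj; apply: (@eq_from_nth _ false); rewrite ?size_tuple // => t ht.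
have l0 : 0 < l by case: l u u' e ht => // u u' _; rewrite muln0.
have hi : t %/ l < b by rewrite ltn_divLR.
have := congr1 (fun f : {ffun 'I_b -> 'I_(2 ^ l)} => val (f (Ordinal hi))) e.
rewrite !ffunE /= => /(congr1 (fun v => nb v (l - 1 - t %% l))).
by rewrite !nb_blk ?ltn_pmod // -divn_eq.
Qed.

(** An injection between sets of size [2 ^ (b * l)] is a bijection. Choice strings can thus be
    counted as functions from block indices to block values, the form in which homomorphisms
    appear. *)
Lemma card_blkf b l (P : pred {ffun 'I_b -> 'I_(2 ^ l)}) :
  #|[pred u | P (@blkf b l u)]| = #|P|.
Proof.
have bij : bijective (@blkf b l).
  apply: inj_card_bij; first exact: blkf_inj.
  by rewrite card_ffun card_tuple card_bool !card_ord -expnM mulnC.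
rewrite -(card_image (bij_inj bij)); apply: eq_card => f.
have [g gK Kg] := bij.
apply/imageP/idP => [[u hu ->]//|hf]; exists (g f); rewrite ?Kg //.
by rewrite inE Kg.
Qed.

(** Common normal form: a counting machine folds over its guessed blocks, and so does a walk through
    the layers of the target graph. *)
Definition gfold b s0 (step : nat -> nat -> nat -> nat) (u : nat -> nat) : nat :=
  nrec b s0 (fun i s => step (u i) i s).

Lemma gfold_ext b s0 step u u' : (forall i, i < b -> u i = u' i) ->
  gfold b s0 step u = gfold b s0 step u'.
Proof.
move=> h; have {h} h i : i <= b -> forall j, j < i -> u j = u' j by move=> hi j hj; apply: h; lia.
rewrite /gfold /nrec; elim: b h => //= b IH h.
rewrite IH ?(h b.+1) // => i hi; apply: h; lia.
Qed.

Lemma ext_map_ord m n (f : {ffun 'I_m -> 'I_n}) i (hi : i < m) : ext_map f i = f (Ordinal hi).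
Proof. by rewrite /ext_map insubT. Qed.

(** Registers 1 to 8 hold [n], [k], the state, the block index, the block value, the blocks left,
    the bits left, and a scratch value. A block is read by doubling register 5 and adding the next
    bit. *)
Definition nd_block :=
  CWhile 7 (CSeq (CMove 5 8) (CSeq (CWhile 8 (CSeq (CInc 5) (CInc 5))) (CChoice 5))).
Definition nd_loop el est := CWhile 6 (CSeq (cexp el [:: 2; 1] 7 9) (CSeq nd_block
  (CSeq (cexp est [:: 5; 4; 3; 2; 1] 8 9) (CSeq (CClear 3) (CSeq (CMove 8 3) (CSeq (CClear 5) (CInc 4))))))).
Definition nd_main es0 eb el est erj := CSeq (cexp es0 [:: 2; 1] 3 9)
  (CSeq (cexp eb [:: 2; 1] 6 9) (CSeq (nd_loop el est) (cexp erj [:: 3; 2; 1] 8 9))).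
Definition nd_cmd en ek es0 eb el est erj :=
  CSeq (csearches [:: en; ek] 0 9) (nd_main es0 eb el est erj).

Definition RR n k s i y b l x : nat -> nat := nth 0 [:: 0; n; k; s; i; y; b; l; x].

Ltac RRext := apply: functional_extensionality; do 9 (case=> [|]; first done); by case.

Section Nd.
Variables (w : seq isym) (ch : nat -> bool) (V n k : nat).
Variables (es0 eb el est erj : exp).
Notation exec := (exec w ch V).

Notation s0_ := (eval es0 w [:: k; n]).
Notation b_ := (eval eb w [:: k; n]).
Notation l_ := (eval el w [:: k; n]).
Notation stp := (fun y i s => eval est w [:: y; i; s; k; n]).
Notation sq i := (gfold i s0_ stp (fun j => blk ch j l_)).

Hypotheses (f0 : fits es0 w [:: k; n] V) (fb : fits eb w [:: k; n] V) (fl : fits el w [:: k; n] V).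
Hypothesis fs : forall y i, y < 2 ^ l_ -> i < b_ -> fits est w [:: y; i; sq i; k; n] V.
Hypothesis fr : fits erj w [:: sq b_; k; n] V.
Hypothesis lV : 2 ^ l_ <= V.

Lemma RR_0 s i y bb ll x r : 9 <= r -> RR n k s i y bb ll x r = 0.
Proof. by move=> h; rewrite /RR nth_default. Qed.

Lemma exec_double y s i bb ll cp o : y + y <= V ->
  exec (CSeq (CMove 5 8) (CWhile 8 (CSeq (CInc 5) (CInc 5)))) (RR n k s i y bb ll 0, cp, o)
    (RR n k s i (y + y) bb ll 0, cp, o).
Proof.
move=> yV.
apply: (E_Seq (s2 := (RR n k s i 0 bb ll y, cp, o))).
  by apply: exec_eq (@exec_move _ _ _ _ _ _ 5 8 isT _) _; [rewrite /RR /=; lia|RRext].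
have loop x z : x + x + z <= V -> exec (CWhile 8 (CSeq (CInc 5) (CInc 5)))
   (RR n k s i z bb ll x, cp, o) (RR n k s i (x + x + z) bb ll 0, cp, o).
  elim: x z => [|x IH] z h; first exact: E_While0.
  apply: (@E_WhileS _ _ _ _ _ _ _ _ x) => //.
    have -> : upd (RR n k s i z bb ll x.+1) 8 x = RR n k s i z bb ll x by RRext.
    apply: E_Seq; first by apply: E_Inc; rewrite /RR /=; lia.
    by apply: E_Inc; rewrite /RR /upd /=; lia.
  set A := upd (upd _ _ _) _ _; have -> : A = RR n k s i z.+2 bb ll x by rewrite /A; RRext.
  have := IH z.+2; have -> : x + x + z.+2 = x.+1 + x.+1 + z by lia.
  by apply.
by have := loop y 0; rewrite addn0; apply.
Qed.

Lemma exec_block s i bb cp o : cp = i * l_ -> 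
  exec nd_block
   (RR n k s i 0 bb l_ 0, cp, o) (RR n k s i (blk ch i l_) bb 0 0, cp + l_, o).
Proof.
move=> ecp; pose Y := blkn (fun j => ch (i * l_ + j)).
have loop m j : j + m = l_ -> exec nd_block
   (RR n k s i (Y j) bb m 0, cp + j, o) (RR n k s i (Y l_) bb 0 0, cp + l_, o).
  elim: m j => [|m IH] j jm.
    by have -> : j = l_ by [lia]; apply: E_While0.
  have jV : 2 ^ j.+1 <= V by apply: leq_trans lV; rewrite leq_exp2l //; lia.
  have YV : Y j + Y j + 1 < V.+1.
    by have := blkn_lt (fun j => ch (i * l_ + j)) j; rewrite -/(Y j); move: jV; rewrite expnS; lia.
  apply: (@E_WhileS _ _ _ _ _ _ _ _ m) => //.
    have -> : upd (RR n k s i (Y j) bb m.+1 0) 7 m = RR n k s i (Y j) bb m 0 by RRext.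
    have hd := @exec_double (Y j) s i bb m (cp + j) o ltac:(lia).
    inversion hd as [| |c1 c2 s1 s2 s3 h1 h2| | | | | |]; subst.
    apply: (E_Seq h1); apply: (E_Seq h2).
    by apply: E_Choice; rewrite /RR /=; lia.
  set A := upd _ _ _; have -> : A = RR n k s i (Y j.+1) bb m 0.
    by rewrite /A /RR /= -ecp; RRext.
  by rewrite -?ecp -addnS; apply: IH; lia.
by have := loop l_ 0 erefl; rewrite addn0.
Qed.

Lemma exec_nd_main : exec (nd_main es0 eb el est erj)
  (RR n k 0 0 0 0 0 0, 0, [::])
  (RR n k (sq b_) b_ 0 0 0 (eval erj w [:: sq b_; k; n]), b_ * l_, [::]).
Proof.
have ce e env d s i y bb ll x cp R : all (fun r => 0 < r < 9) env -> 0 < d < 9 -> d \notin env ->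
    RR n k s i y bb ll x d = 0 -> fits e w (map (RR n k s i y bb ll x) env) V ->
    upd (RR n k s i y bb ll x) d (eval e w (map (RR n k s i y bb ll x) env)) = R ->
    exec (cexp e env d 9) (RR n k s i y bb ll x, cp, [::]) (R, cp, [::]).
  by move=> h1 h2 h3 h4 h5 <-; apply: exec_cexp => // r; apply: RR_0.
have bV : b_ <= V by exact: fits_eval fb.
apply: (E_Seq (s2 := (RR n k s0_ 0 0 0 0 0, 0, [::]))); first by apply: ce => //; RRext.
apply: (E_Seq (s2 := (RR n k s0_ 0 0 b_ 0 0, 0, [::]))); first by apply: ce => //; RRext.
apply: (E_Seq (s2 := (RR n k (sq b_) b_ 0 0 0 0, b_ * l_, [::]))); last by apply: ce => //; RRext.
have loop m i : i + m = b_ -> exec (nd_loop el est)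
   (RR n k (sq i) i 0 m 0 0, i * l_, [::]) (RR n k (sq b_) b_ 0 0 0 0, b_ * l_, [::]).
  elim: m i => [|m IH] i im.
    by have -> : i = b_ by [lia]; apply: E_While0.
  have ib : i < b_ by lia.
  have fsi := fs (blk_lt ch i l_) ib.
  apply: (@E_WhileS _ _ _ _ _ _ _ _ m (RR n k (sq i.+1) i.+1 0 m 0 0, i.+1 * l_, [::])) => //; last by apply: IH; lia.
  have -> : upd (RR n k (sq i) i 0 m.+1 0 0) 6 m = RR n k (sq i) i 0 m 0 0 by RRext.
  apply: (E_Seq (s2 := (RR n k (sq i) i 0 m l_ 0, i * l_, [::]))); first by apply: ce => //; RRext.
  apply: E_Seq; first exact: (@exec_block (sq i) i m).
  have -> : i * l_ + l_ = i.+1 * l_ by lia.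
  pose Y := blk ch i l_.
  apply: (E_Seq (s2 := (RR n k (sq i) i Y m 0 (sq i.+1), i.+1 * l_, [::]))); first by apply: ce => //; RRext.
  have sV : sq i.+1 <= V by exact: (fits_eval fsi).
  apply: (E_Seq (s2 := (RR n k 0 i Y m 0 (sq i.+1), i.+1 * l_, [::]))).
    by apply: exec_eq (exec_clear _ _ _ _ _ _ _) _; RRext.
  apply: (E_Seq (s2 := (RR n k (sq i.+1) i Y m 0 0, i.+1 * l_, [::]))).
    by apply: exec_eq (@exec_move _ _ _ _ _ _ 8 3 isT _) _; [rewrite [X in X <= V]addn0|RRext].
  apply: (E_Seq (s2 := (RR n k (sq i.+1) i 0 m 0 0, i.+1 * l_, [::]))).
    by apply: exec_eq (exec_clear _ _ _ _ _ _ _) _; RRext.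
  by apply: exec_eq (@E_Inc _ _ _ _ _ _ 4 _) _; [exact: leq_trans ib bV|RRext].
by have := loop b_ 0 erefl; apply.
Qed.
End Nd.

Lemma lg_mono a b : a <= b -> lg a <= lg b.
Proof. by move=> h; rewrite /lg ltnS; apply: leq_trunc_log. Qed.

Section NdClass.
Variables (s0 b l B : seq isym -> seq nat -> nat).
Variable st : seq isym -> seq nat -> nat.
Variable acc : seq isym -> seq nat -> bool.
Hypotheses (hs0 : L s0) (hb : L b) (hl : L l) (hB : L B) (hst : L st) (hacc : LB acc).

Notation sq w k n u i := (gfold i (s0 w [:: k; n]) (fun y' i' s' => st w [:: y'; i'; s'; k; n]) u).

Variable F : seq bool -> nat -> nat.
Variable f : nat -> nat.
Hypothesis cf : computable f.
Hypothesis bnd : forall x k (w := input_word x k) (n := size x),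
  [/\ s0 w [:: k; n] <= B w [:: k; n], forall y i s, st w [:: y; i; s; k; n] <= B w [:: k; n],
    2 ^ (l w [:: k; n]) <= B w [:: k; n] & b w [:: k; n] * l w [:: k; n] <= f k * lg n].
Hypothesis hF : forall x k (w := input_word x k) (n := size x),
  F x k = #|[pred g : {ffun 'I_(b w [:: k; n]) -> 'I_(2 ^ l w [:: k; n])} |
              acc w [:: sq w k n (ext_map g) (b w [:: k; n]); k; n]]|.

(** Each run reads exactly [b * l] choice bits and halts, so accepting paths are the accepted bit
    strings of this length, and [card_blkf] turns these into functions [g]. [B] keeps states and
    block values polynomial. *)
Theorem nd_class : sharp_para_beta_L F.
Proof.
have [en [cn hen]] : LB (fun w v => ~~ (inp w (nth 0 v 0) == 2)) by Ls.
have [ek [ck hek]] : LB (fun w v => ~~ (inp w (nth 0 v 1 + 1 + nth 0 v 0) == 3)) by Ls.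
have [es0 [cs0 hes0]] := hs0.
have [eb [cb heb]] := hb.
have [el [cl hel]] := hl.
have [est [cst hest]] := hst.
have [erj [crj herj]] := L_neg hacc.
have [cB hBb] := L_bound hB.
(* [(N + 2) ^ D] bounds every variable passed to the step and to the acceptance test. *)
pose D := (cB + cb).+1.
pose C := cn + ck + cs0 + cb + cl + cB + (D + 2) * (cst + crj) + 1.
pose M := cTM (nd_cmd en ek es0 eb el est erj) 8.
have main x k ch (w := input_word x k) (n := size x) : exists t,
    [/\ c_state (run M w ch t) = (if acc w [:: sq w k n (fun i => blk ch i (l w [:: k; n])) (b w [:: k; n]); k; n]
              then tm_acc M else tm_rej M),
        c_cpos (run M w ch t) = b w [:: k; n] * l w [:: k; n],
        forall t', cspace _ (run M w ch t') <= 2 * (lg ((n + k + 2) ^ C)).+1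
      & forall t', c_cpos (run M w ch t') <= b w [:: k; n] * l w [:: k; n]].
  pose N := n + k; pose V := (N + 2) ^ C.
  have hv : allle N [:: k; n] by rewrite /= /N; lia.
  have VN : N <= V by rewrite /V /C addn1 pw_self.
  have V0 : 0 < V by exact: pw_gt0.
  have fV e c v : (forall N, allle N v -> fits e w v ((N + 2) ^ c)) -> allle N v -> c <= C -> fits e w v V.
    by move=> hh hv' hc; apply: fits_mono (hh N hv'); apply: pw_mono.
  have hs : srch_ok w V [:: en; ek] [::] [:: k; n].
    apply: (srch_len hen); [by rewrite /C; lia|by rewrite /N; lia|].
    by apply: (srch_par hek); [rewrite /C; lia|rewrite /N|exact: SNil].
  have [b1 b2 b3 b4] := bnd x k; rewrite -/w -/n in b1 b2 b3 b4.
  have BD : B w [:: k; n] <= (N + 2) ^ D.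
    by apply: leq_trans (hBb _ _ _ hv) _; apply: pw_mono; rewrite /D; lia.
  have bD : b w [:: k; n] <= (N + 2) ^ D.
    have := fits_eval ((heb w [:: k; n]).2 N hv); rewrite (heb _ _).1 => h.
    by apply: leq_trans h _; apply: pw_mono; rewrite /D; lia.
  have ND : N <= (N + 2) ^ D by exact: pw_self.
  have DV c : c <= cst + crj -> ((N + 2) ^ D + 2) ^ c <= V.
    move=> hc; apply: leq_trans (pw_comp _ _ _) _; apply: pw_mono; rewrite /C; nia.
  have kN : k <= (N + 2) ^ D by rewrite /N in ND *; lia.
  have nN : n <= (N + 2) ^ D by rewrite /N in ND *; lia.
  have sqD u i : sq w k n u i <= (N + 2) ^ D.
    by apply: leq_trans BD; case: i => [|i]; [exact: b1|exact: b2].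
  have gE u i : gfold i (eval es0 w [:: k; n]) (fun y i s => eval est w [:: y; i; s; k; n]) u = sq w k n u i.
    by rewrite /gfold /nrec (hes0 _ _).1; elim: i => //= i ->; rewrite (hest _ _).1.
  have he := @exec_nd_main w ch V n k es0 eb el est erj.
  rewrite (heb _ _).1 (hel _ _).1 gE (herj _ _).1 in he.
  have hm := he _ _ _ _ _ _.
  have {}he : exec w ch V (nd_cmd en ek es0 eb el est erj) (fun=> 0, 0, [::])
     (RR n k (sq w k n (fun i => blk ch i (l w [:: k; n])) (b w [:: k; n])) (b w [:: k; n]) 0 0 0
        (~~ acc w [:: sq w k n (fun i => blk ch i (l w [:: k; n])) (b w [:: k; n]); k; n]),
       b w [:: k; n] * l w [:: k; n], [::]).
    have -> : (fun=> 0) = Rof [::].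
      by apply: functional_extensionality => r; rewrite /Rof /=; case: ifP => //; lia.
    apply: (E_Seq (s2 := (RR n k 0 0 0 0 0 0, 0, [::]))).
      have -> : RR n k 0 0 0 0 0 0 = Rof [:: k; n].
        by rewrite /Rof /=; RRext.
      exact: (exec_csearches ch _ _ hs).
    apply: hm.
    - by apply: fV (hes0 _ _).2 hv _; rewrite /C; lia.
    - by apply: fV (heb _ _).2 hv _; rewrite /C; lia.
    - by apply: fV (hel _ _).2 hv _; rewrite /C; lia.
    - move=> y i; rewrite ?(hel _ _).1 ?(heb _ _).1 ?gE => hy hi.
      apply: fits_mono ((hest _ _).2 ((N + 2) ^ D) _); first by apply: DV; lia.
      by rewrite /= sqD kN nN !andbT; apply/andP; split; [lia|lia].
    - apply: fits_mono ((herj _ _).2 ((N + 2) ^ D) _); first by apply: DV; lia.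
      by rewrite /= sqD kN nN.
    - apply: leq_trans b3 (leq_trans BD _); apply: pw_mono; rewrite /C /D; nia.
  have [t [h1 h2 _ h3 h4]] := cTM_run 8 V0 he.
  exists t; split=> //; rewrite h1 /RR /=; by case: (acc _ _).
have ro : read_once M by exact: cTM_read_once.
exists M; split=> //.
(* This machine searches for no [T]; the constant test has least witness 0 and supplies the form
   expected by [paraL_intro]. *)
- have hT : LB (fun w v => (fun _ _ : nat => true) (nth 0 v 0) (nth 0 v 1)) by exact: (L_const 1).
  have hex (k : nat) : exists T : nat, (fun _ _ : nat => true) T k by exists 0.
  apply: (@paraL_intro (fun _ _ => true) hT hex M C) => x k ch t.
  have [_ [_ _ hsp _]] := main x k ch; apply: leq_trans (hsp t) _.
  rewrite leq_mul2l /= ltnS; apply: lg_mono.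
  by case: (C) => // c; rewrite leq_exp2r //; lia.
- exists f; split=> // x k ch t.
  have [_ [_ _ _ hc]] := main x k ch; apply: leq_trans (hc t) _.
  by have [_ _ _] := bnd x k.
- move=> x k; set w := input_word x k; set n := size x.
  pose P (g : {ffun 'I_(b w [:: k; n]) -> 'I_(2 ^ l w [:: k; n])}) :=
     acc w [:: sq w k n (ext_map g) (b w [:: k; n]); k; n].
  exists [seq val u | u <- enum [pred u : (b w [:: k; n] * l w [:: k; n]).-tuple bool | P (blkf u)]]; split.
  + by rewrite map_inj_uniq ?enum_uniq //; apply: val_inj.
  + have PE (u : (b w [:: k; n] * l w [:: k; n]).-tuple bool) : P (blkf u) =
        acc w [:: sq w k n (fun i => blk (nth false u) i (l w [:: k; n])) (b w [:: k; n]); k; n].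
      rewrite /P; congr (acc w [:: _; k; n]); apply: gfold_ext => i hi.
      by rewrite ext_map_ord ffunE.
    move=> u; rewrite acc_pathE //; have [t [h1 h2 _ _]] := main x k (nth false u); split.
      move=> /mapP[v]; rewrite mem_enum inE PE => hv ->.
      have [t' [h1' h2' _ _]] := main x k (nth false v); exists t'.
      by rewrite h1' h2' size_tuple; split=> //; rewrite hv.
    move=> [t' [a1 a2]].
    have hh : halted (run M w (nth false u) t) by rewrite /halted h1; case: ifP; rewrite eqxx ?orbT.
    have hh' : halted (run M w (nth false u) t') by rewrite /halted a1 eqxx.
    (* Runs on the same bits halt in the same configuration; its head position shows that [u] has
       length [b * l]. *)
    have e := run_halted_eq hh hh'.
    rewrite e in a1 a2; rewrite h2 in a2.
    apply/mapP; exists (tcast (esym a2) (in_tuple u)); last by rewrite /= val_tcast.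
    rewrite mem_enum inE PE /= val_tcast; move: a1; rewrite h1 -/w -/n; case: ifP => // _ /(@fenc_inj _).
    by move/eqP; rewrite /c_no /c_yes c_inr_eq.
  + by rewrite size_map -cardE card_blkf hF.
Qed.
End NdClass.

(** * Arithmetized computations *)

(** As [a <= 2 * (a + b)], the integer square root recovers [a + b]. Unlike Cantor's pairing this
    needs no halving, and the value is quadratically bounded. *)
Definition npair a b := (a + b) * (a + b) + a.
Definition nroot z := nsum z (fun j => j.+1 * j.+1 <= z).
Definition nfst z := z - nroot z * nroot z.
Definition nsnd z := nroot z - nfst z.

Lemma nroot_eq z m : m * m <= z < m.+1 * m.+1 -> nroot z = m.
Proof.
move=> /andP[h1 h2]; rewrite /nroot.
rewrite -[RHS](@nsum_lt z); last nia.
by apply: eq_bigr => j _; congr nat_of_bool; apply/idP/idP => h; nia.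
Qed.

Lemma nroot_pair a b : nroot (npair a b) = a + b.
Proof. apply: nroot_eq; rewrite /npair; apply/andP; split; nia. Qed.

Lemma nfst_pair a b : nfst (npair a b) = a.
Proof. by rewrite /nfst nroot_pair /npair addKn. Qed.

Lemma nsnd_pair a b : nsnd (npair a b) = b.
Proof. by rewrite /nsnd nfst_pair nroot_pair addKn. Qed.

Lemma L_npair F G : L F -> L G -> L (fun w v => npair (F w v) (G w v)).
Proof. by move=> hF hG; rewrite /npair; Ls. Qed.

Lemma L_nroot F : L F -> L (fun w v => nroot (F w v)).
Proof. by move=> hF; rewrite /nroot; Ls. Qed.

Lemma L_nfst F : L F -> L (fun w v => nfst (F w v)).
Proof. by move=> hF; have hr := L_nroot hF; rewrite /nfst; Ls. Qed.

Lemma L_nsnd F : L F -> L (fun w v => nsnd (F w v)).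
Proof. by move=> hF; have hr := L_nroot hF; have hf := L_nfst hF; rewrite /nsnd; Ls. Qed.

(** Table lookup as a sum, so that a function on a finite range enters [L] through constants; used
    for the transition table. *)
Definition tabn n (g : nat -> nat) a := nsum n (fun i => (a == i) * g i).

Lemma tabnE n g a : a < n -> tabn n g a = g a.
Proof.
rewrite /tabn; elim: n => // n IH; rewrite nsumS ltnS leq_eqVlt => /orP[/eqP->|lt].
  rewrite eqxx mul1n (_ : nsum _ _ = 0) // /nsum big_nat_cond big1 // => i /andP[/andP[_ lt] _].
  by rewrite gtn_eqF.
by rewrite IH // (ltn_eqF lt) addn0.
Qed.

Lemma L_tabn n (g : nat -> seq isym -> seq nat -> nat) A : (forall i, L (g i)) -> L A ->
  L (fun w v => tabn n (fun i => g i w v) (A w v)).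
Proof.
move=> hg hA; elim: n => [|n IH].
  by apply: (L_ext (L_const 0)) => w v; rewrite /tabn /nsum big_geq.
have hgn := hg n.
apply: (@L_ext (fun w v => tabn n (fun i => g i w v) (A w v) + (A w v == n) * g n w v)).
  by Ls.
by move=> w v; rewrite /tabn nsumS.
Qed.

Fixpoint tval G (s : seq nat) : nat := if s is d :: s' then d + G * tval G s' else 0.

Lemma tval_digit G s i : 1 < G -> all (fun d => d < G) s -> (tval G s %/ G ^ i) %% G = nth 0 s i.
Proof.
move=> G1; elim: s i => [|d s IH] [|i] /=; rewrite ?div0n ?mod0n // => /andP[dG hs].
  by rewrite expn0 divn1 addnC mulnC modnMDl modn_small.
have e : (d + G * tval G s) %/ G = tval G s.
  by rewrite addnC mulnC divnMDl ?(ltnW G1) // divn_small // addn0.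
by rewrite expnS divnMA e; apply: IH.
Qed.

Lemma tval_set G s i d : tval G (set_nth 0 s i d) + nth 0 s i * G ^ i = tval G s + d * G ^ i.
Proof.
have hn j : tval G (ncons j 0 [:: d]) = d * G ^ j.
  elim: j => [|j IH] /=; first by rewrite expn0; lia.
  by rewrite IH expnS; lia.
elim: s i => [|a s IH] i.
  by rewrite nth_nil mul0n addn0 -hn; case: i.
case: i => [|i] /=; first by rewrite expn0; lia.
rewrite expnS; have := IH i; move: (tval G (set_nth 0 s i d)) (tval G s) (G ^ i) => x y z; nia.
Qed.

Lemma digit_le W P G : (W %/ P) %% G * P <= W.
Proof. by apply: leq_trans (leq_divM W P); rewrite leq_mul2r leq_mod orbT. Qed.

Lemma tval_lt G s : all (fun d => d < G) s -> tval G s < G ^ size s.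
Proof.
elim: s => //= d s IH /andP[dG hs]; have := IH hs; rewrite expnS; move: (tval G s) (G ^ _) => x y; nia.
Qed.

Lemma bin_val_tval s : bin_val s = tval 2 (map nat_of_bool s).
Proof. by elim: s => //= b s ->; rewrite mul2n. Qed.

Lemma map_set_nth (T : Type) (f : T -> nat) x0 s i x : f x0 = 0 ->
  map f (set_nth x0 s i x) = set_nth 0 (map f s) i (f x).
Proof.
move=> f0; elim: s i => [|a s IH] [|i] //=; last by rewrite IH.
by congr cons; elim: i => //= i ->; rewrite f0.
Qed.

Definition mvnum (m : move) := match m with MoveL => 0 | MoveS => 1 | MoveR => 2 end.
(** The maximum with 1 keeps a left move on cell 0 in place, where dividing by the base could give
    0. *)
Definition mvpow G m P := nif (m == 0) (maxn 1 (P %/ G)) (nif (m == 1) P (P * G)).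

Lemma mvpowE G m p : 0 < G -> mvpow G (mvnum m) (G ^ p) = G ^ (mv m p).
Proof.
move=> G0; case: m => //=; rewrite /mvpow /=; last by rewrite expnSr.
case: p => [|p] /=.
  rewrite expn0; have : 1 %/ G <= 1 by apply: leq_div.
  by case: (1 %/ G) => [|[|]].
by rewrite expnS mulKn // /nif; apply/maxn_idPr; rewrite expn_gt0 G0.
Qed.

Definition mvpos m p := nif (m == 0) p.-1 (nif (m == 1) p p.+1).

Lemma mvposE m p : mvpos (mvnum m) p = mv m p.
Proof. by case: m. Qed.

(* The heads are recorded as powers [P] and [J] of the tape bases, so that the scanned
   cells are accessed by division and multiplication. *)
Definition code q W P I J O C := (npair q (npair W (npair P (npair I (npair J (npair O C)))))).+1.
Definition cq z := nfst z.-1.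
Definition cW z := nfst (nsnd z.-1).
Definition cP z := nfst (nsnd (nsnd z.-1)).
Definition cI z := nfst (nsnd (nsnd (nsnd z.-1))).
Definition cJ z := nfst (nsnd (nsnd (nsnd (nsnd z.-1)))).
Definition cO z := nfst (nsnd (nsnd (nsnd (nsnd (nsnd z.-1))))).
Definition cC z := nsnd (nsnd (nsnd (nsnd (nsnd (nsnd z.-1))))).

Definition code_proj := (nfst_pair, nsnd_pair).

Definition isym_of a := match a with 0 => I0 | 1 => I1 | 2 => ISep | _ => IBlank end.
Definition hnum (h : option bool) := match h with None => 0 | Some false => 1 | Some true => 2 end.
Definition hof n := match n with 0 => None | 1 => Some false | _ => Some true end.

Lemma isym_natK a : isym_of (isym_nat a) = a. Proof. by case: a. Qed.
Lemma hnumK h : hof (hnum h) = h. Proof. by case: h => [[]|]. Qed.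

Section Code.
Variable (M : TM) (cnt : bool).
Notation Q := (tm_q M).+1.
Notation G := (tm_g M).+1.

(** With [cnt] the length of the output is recorded, which determines a unary output. Without it the
    output is left out of the code, since a space bound does not limit its length. *)
Definition dnum q a g b h i : nat :=
  let: (q', g', mw, b', mi, mc, o) :=
    @tm_delta M (inord q) (isym_of a) (inord g) (b == 1) (hof h) in
  match i with 0 => val q' | 1 => val g' | 2 => mvnum mw | 3 => b' | 4 => mvnum mi
  | 5 => cnt && isSome o | _ => mvnum mc end.

Definition dtab i q a g b h := tabn Q (fun q => tabn 4 (fun a => tabn G (fun g =>
  tabn 2 (fun b => tabn 3 (fun h => dnum q a g b h i) h) b) g) a) q.

Lemma L_dtab i q a g b h : L q -> L a -> L g -> L b -> L h ->
  L (fun w v => dtab i (q w v) (a w v) (g w v) (b w v) (h w v)).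
Proof.
move=> hq ha hg hb hh; rewrite /dtab.
refine (@L_tabn Q (fun i0 w v => tabn 4 (fun a1 => tabn G (fun g1 =>
  tabn 2 (fun b1 => tabn 3 (fun h1 => dnum i0 a1 g1 b1 h1 i) (h w v)) (b w v)) (g w v)) (a w v)) q _ hq) => i1.
refine (@L_tabn 4 (fun i0 w v => tabn G (fun g1 =>
  tabn 2 (fun b1 => tabn 3 (fun h1 => dnum i1 i0 g1 b1 h1 i) (h w v)) (b w v)) (g w v)) a _ ha) => i2.
refine (@L_tabn G (fun i0 w v => tabn 2 (fun b1 => tabn 3 (fun h1 => dnum i1 i2 i0 b1 h1 i) (h w v)) (b w v)) g _ hg) => i3.
refine (@L_tabn 2 (fun i0 w v => tabn 3 (fun h1 => dnum i1 i2 i3 i0 h1 i) (h w v)) b _ hb) => i4.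
refine (@L_tabn 3 (fun i0 w v => dnum i1 i2 i3 i4 i0 i) h _ hh) => i5; exact: L_const.
Qed.

Definition stepc a h z :=
  let d i := dtab i (cq z) a ((cW z %/ cP z) %% G.+1) ((cI z %/ cJ z) %% 2) h in
  code (d 0) (cW z - (cW z %/ cP z) %% G.+1 * cP z + d 1 * cP z) (mvpow G.+1 (d 2) (cP z))
    (cI z - (cI z %/ cJ z) %% 2 * cJ z + d 3 * cJ z) (mvpow 2 (d 4) (cJ z)) (cO z + d 5)
    (mvpos (d 6) (cC z)).

Lemma L_stepc a h z : L a -> L h -> L z -> L (fun w v => stepc (a w v) (h w v) (z w v)).
Proof.
move=> ha hh hz.
have hp : L (fun w v => (z w v).-1) by Ls.
have h1 := L_nsnd hp; have h2 := L_nsnd h1; have h3 := L_nsnd h2; have h4 := L_nsnd h3; have h5 := L_nsnd h4.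
have hq : L (fun w v => cq (z w v)) by exact: L_nfst hp.
have hW : L (fun w v => cW (z w v)) by exact: L_nfst h1.
have hP : L (fun w v => cP (z w v)) by exact: L_nfst h2.
have hI : L (fun w v => cI (z w v)) by exact: L_nfst h3.
have hJ : L (fun w v => cJ (z w v)) by exact: L_nfst h4.
have hO : L (fun w v => cO (z w v)) by exact: L_nfst h5.
have hC : L (fun w v => cC (z w v)) by exact: L_nsnd h5.
have hg : L (fun w v => (cW (z w v) %/ cP (z w v)) %% G.+1) by Ls.
have hb : L (fun w v => (cI (z w v) %/ cJ (z w v)) %% 2) by Ls.
have hd i := L_dtab i hq ha hg hb hh.
have hd0 := hd 0; have hd1 := hd 1; have hd2 := hd 2; have hd3 := hd 3; have hd4 := hd 4; have hd5 := hd 5; have hd6 := hd 6.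
rewrite /stepc /code /mvpow /mvpos.
apply: L_succ; do 6 (apply: L_npair; [by Ls|]); by Ls.
Qed.

Definition ccode (c : config M) := code (c_state c) (tval G.+1 (map val (c_work c))) (G.+1 ^ c_wpos c)
  (bin_val (c_index c)) (2 ^ c_ipos c)
  (if cnt then size (c_out c) else 0) (c_cpos c).

Lemma cq_code (c : config M) : cq (ccode c) = c_state c.
Proof. by rewrite /cq /ccode /code /= !code_proj. Qed.

Lemma cI_code (c : config M) : cI (ccode c) = bin_val (c_index c).
Proof. by rewrite /cI /ccode /code /= !code_proj. Qed.

Lemma cO_code (c : config M) : cO (ccode c) = (if cnt then size (c_out c) else 0).
Proof. by rewrite /cO /ccode /code /= !code_proj. Qed.

Lemma cC_code (c : config M) : cC (ccode c) = c_cpos c.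
Proof. by rewrite /cC /ccode /code /= !code_proj. Qed.

Lemma ccode_step w ch (c : config M) : ~~ halted c ->
  ccode (step M w ch c) = stepc (inp w (cI (ccode c))) (hnum (chsym ch (c_cpos c))) (ccode c).
Proof.
move=> nh; rewrite cI_code.
set a := nth IBlank w (bin_val (c_index c)).
set g := nth ord0 (c_work c) (c_wpos c).
set b := nth false (c_index c) (c_ipos c).
set h := chsym ch (c_cpos c).
(* The base exceeds the size of the alphabet by one, so it is at least 2 even for a one-letter
   alphabet. *)
have G1 : 1 < G.+1 by [].
have eg : (tval G.+1 (map val (c_work c)) %/ G.+1 ^ c_wpos c) %% G.+1 = val g.
  rewrite tval_digit //; last by apply/allP => _ /mapP[x _ ->]; rewrite ltnW // ltnS ltn_ord.
  have [lt|ge] := ltnP (c_wpos c) (size (c_work c)); first by rewrite (nth_map ord0).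
  by rewrite /g !nth_default ?size_map.
have eb : (bin_val (c_index c) %/ 2 ^ c_ipos c) %% 2 = b.
  rewrite bin_val_tval tval_digit //; last by apply/allP => _ /mapP[[] _ ->].
  have [lt|ge] := ltnP (c_ipos c) (size (c_index c)); first by rewrite (nth_map false).
  by rewrite /b !nth_default ?size_map.
have ed i : dtab i (c_state c) (isym_nat a) g b (hnum h) =
   dnum (c_state c) (isym_nat a) g b (hnum h) i.
  rewrite /dtab tabnE ?ltn_ord // tabnE; last by case: (a).
  by rewrite tabnE ?ltn_ord // tabnE ?ltnS ?leq_b1 // tabnE //; case: (h) => [[]|].
rewrite [RHS]/stepc /= /cq /cW /cP /cI /cJ /cO /cC /ccode {2 3 4 5 6 7 8 9 10 11 12 13 14 15 16 17 18 19 20 21 22 23 24 25 26 27 28 29 30}/code /= !code_proj.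
rewrite eg eb /inp -/a !ed /dnum !inord_val isym_natK hnumK.
have -> : (b == 1 :> nat) = b by case: (b).
rewrite /step; move: (nh); rewrite /halted => /negPf ->; rewrite -/a -/g -/b -/h.
case: (tm_delta _ _ _ _ _) => [[[[[[q' g'] mw] b'] mi] mc] o] /=.
congr code.
- rewrite map_set_nth //; have := tval_set G.+1 (map val (c_work c)) (c_wpos c) (val g').
  have -> : nth 0 (map val (c_work c)) (c_wpos c) = val g.
    have [lt|ge] := ltnP (c_wpos c) (size (c_work c)); first by rewrite (nth_map ord0).
    by rewrite /g !nth_default ?size_map.
  have : val g * G.+1 ^ c_wpos c <= tval G.+1 (map val (c_work c)).
    by rewrite -eg; apply: digit_le.
  by move=> /= h1 h2; lia.
- by rewrite mvpowE.
- rewrite !bin_val_tval map_set_nth //; have := tval_set 2 (map nat_of_bool (c_index c)) (c_ipos c) b'.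
  have -> : nth 0 (map nat_of_bool (c_index c)) (c_ipos c) = b.
    have [lt|ge] := ltnP (c_ipos c) (size (c_index c)); first by rewrite (nth_map false).
    by rewrite /b !nth_default ?size_map.
  have : b * 2 ^ c_ipos c <= tval 2 (map nat_of_bool (c_index c)).
    by rewrite -bin_val_tval -eb; apply: digit_le.
  by move=> /= h1 h2; lia.
- by rewrite mvpowE.
- by case: (cnt) => //; case: o => [x|]; rewrite /= ?size_rcons ?addn1 ?addn0.
- by rewrite mvposE.
Qed.
End Code.

Lemma L_cq F : L F -> L (fun w v => cq (F w v)).
Proof. by move=> h; apply: L_nfst; apply: L_pred. Qed.

Lemma L_cI F : L F -> L (fun w v => cI (F w v)).
Proof. by move=> h; apply: L_nfst; do 3 apply: L_nsnd; apply: L_pred. Qed.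

Lemma L_cO F : L F -> L (fun w v => cO (F w v)).
Proof. by move=> h; apply: L_nfst; do 5 apply: L_nsnd; apply: L_pred. Qed.

Lemma L_cC F : L F -> L (fun w v => cC (F w v)).
Proof. by move=> h; do 6 apply: L_nsnd; apply: L_pred. Qed.

Ltac Lx3 ::= lazymatch goal with
  | |- L (fun w v => cq (@?A w v)) => apply (@L_cq A)
  | |- L (fun w v => cI (@?A w v)) => apply (@L_cI A)
  | |- L (fun w v => cO (@?A w v)) => apply (@L_cO A)
  | |- L (fun w v => cC (@?A w v)) => apply (@L_cC A)
  | |- L (fun w v => stepc ?M ?c (@?A w v) (@?B w v) (@?C w v)) => apply (@L_stepc M c A B C)
  end.

(** A code is a successor, so 0 is no configuration. A simulation that outgrows [cap] falls to 0 and
    stays there, hence its values never exceed [cap], whatever the machine does. *)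
Definition clampc cap z := nif (z <= cap) z 0.

Definition haltc (M : TM) z := (cq z == tm_acc M) || (cq z == tm_rej M).

Lemma haltc_code M cnt (c : config M) : haltc M (ccode cnt c) = halted c.
Proof. by rewrite /haltc cq_code. Qed.

(** * Bounded simulation of a computable function *)

Section SimF.
Variables (M : TM) (f : nat -> nat).
Hypothesis hM : forall n, exists t,
    c_state (run M (input_word (nseq n true) 0) (fun _ => false) t) = tm_acc M /\
    c_out (run M (input_word (nseq n true) 0) (fun _ => false) t) = nseq (f n) (Some true).

Notation rn k t := (run M (input_word (nseq k true) 0) (fun _ => false) t).

Definition inpk k a := nif (a < k) 1 (nif (a == k) 2 3).

Lemma inpkE k a : inp (input_word (nseq k true) 0) a = inpk k a.
Proof.
rewrite /inpk /nif; case: (ltngtP a k) => h.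
- by rewrite inp_x ?size_nseq // nth_nseq h.
- have := inp_k (nseq k true) 0 (a - k.+1); rewrite size_nseq ltn0 => <-; congr inp; lia.
- by rewrite h; have := inp_sep (nseq k true) 0; rewrite size_nseq.
Qed.

Definition fstep cap k z := nif ((z == 0) || haltc M z) z
  (clampc cap (stepc M true (inpk k (cI z)) (nif (cC z == 0) 0 1) z)).
Definition fsim cap k T := nrec T (clampc cap (ccode true (init M))) (fun _ z => fstep cap k z).

Lemma L_fstep F G H : L F -> L G -> L H -> L (fun w v => fstep (F w v) (G w v) (H w v)).
Proof. by move=> hF hG hH; rewrite /fstep /clampc /haltc /inpk; Ls. Qed.

Lemma fsim_cap cap k T : fsim cap k T <= cap.
Proof.
rewrite /fsim /nrec; elim: T => [|T IH] /=; first by rewrite /clampc /nif; case: ifP.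
rewrite {1}/fstep; move: IH; set z := nat_rect _ _ _ T => IH.
by rewrite /nif /clampc; case: ifP => // _; rewrite /nif; case: ifP.
Qed.

Lemma L_fsim F G H : L F -> L G -> L H -> L (fun w v => fsim (F w v) (G w v) (H w v)).
Proof.
move=> hF hG hH; apply: (L_rec_le (B := F) (s := fun w v _ z => fstep (F w v) (G w v) z)) => //.
- by rewrite /clampc; Ls.
- by apply: L_fstep; Ls.
- by move=> w v i _; apply: fsim_cap.
Qed.

Lemma fsim_or cap k T : fsim cap k T = 0 \/ fsim cap k T = ccode true (rn k T).
Proof.
rewrite /fsim /nrec; elim: T => [|T IH] /=; first by rewrite /clampc /nif; case: ifP; [right|left].
case: IH => ->; first by left; rewrite /fstep eqxx.
rewrite /fstep haltc_code; set c := rn k T.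
have -> : (ccode true c == 0) = false by [].
case hc: (halted c); first by rewrite /= step_halted //; right.
rewrite /= cC_code -inpkE ccode_step ?hc // /clampc /nif.
have -> : hnum (chsym (fun=> false) (c_cpos c)) = (if c_cpos c == 0 then 0 else 1) by case: (c_cpos c).
by case: ifP; [right|left].
Qed.

Lemma fsim_big cap k T : (forall t, t <= T -> ccode true (rn k t) <= cap) ->
  fsim cap k T = ccode true (rn k T).
Proof.
rewrite /fsim /nrec; elim: T => [|T IH] h /=; first by rewrite /clampc (h 0 isT : ccode true (init M) <= cap).
rewrite IH; last by move=> t ht; apply: h; lia.
rewrite /fstep haltc_code; have := h T.+1 (leqnn _); set c := rn k T.
have -> : (ccode true c == 0) = false by [].
case hc: (halted c); first by rewrite /= step_halted.
rewrite /= cC_code -inpkE ccode_step ?hc // /clampc /nif.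
have -> : hnum (chsym (fun=> false) (c_cpos c)) = (if c_cpos c == 0 then 0 else 1) by case: (c_cpos c).
by move=> ->.
Qed.

Definition fok T k := (fsim T k T != 0) && (cq (fsim T k T) == tm_acc M).
Definition fval T k := cO (fsim T k T).

Lemma fokE T k : fok T k -> fval T k = f k.
Proof.
rewrite /fok /fval; case: (fsim_or T k T) => ->; rewrite ?eqxx // cq_code cO_code.
case/andP=> _ /eqP/val_inj h; have [t [h1 h2]] := hM k.
have hh : halted (rn k T) by rewrite /halted h eqxx.
have hh' : halted (rn k t) by rewrite /halted h1 eqxx.
by rewrite -(run_halted_eq hh hh') h2 size_nseq.
Qed.

(** A halting run passes through finitely many configurations, and any [T] beyond its length and all
    their codes works. As all larger [T] work too, several requirements can share one [T]. *)
Lemma fok_ex k : exists T0, forall T, T0 <= T -> fok T k.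
Proof.
have [t [h1 h2]] := hM k; have hh : halted (rn k t) by rewrite /halted h1 eqxx.
exists (t + \sum_(i < t.+1) ccode true (rn k i)) => T hT.
have e : rn k T = rn k t by apply: run_halted => //; lia.
have le s : s <= t -> ccode true (rn k s) <= T.
  move=> st; apply: leq_trans (leq_trans (leq_addl t _) hT).
  by rewrite (bigD1 (@Ordinal t.+1 s st)) //= leq_addr.
rewrite /fok fsim_big; last first.
  move=> s _; have [st|ts] := leqP s t; first exact: le.
  by rewrite (run_halted hh (ltnW ts)); apply: le.
by rewrite e cq_code h1 eqxx andbT.
Qed.
End SimF.

(* [ok T k]: the computation of [f k] halts within [T] steps and all its codes are at most [T]. *)
Lemma computable_sim f : computable f -> exists ok val,
  [/\ LB (fun w v => ok (nth 0 v 0) (nth 0 v 1)), L (fun w v => val (nth 0 v 0) (nth 0 v 1)),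
      forall T k, ok T k -> val T k = f k & forall k, exists T0, forall T, T0 <= T -> ok T k].
Proof.
case=> M hM; exists (fok M), (fval M); split; last first.
- exact: fok_ex hM.
- exact: fokE hM.
- have hs := @L_fsim M _ _ _ (L_var 0) (L_var 1) (L_var 0); rewrite /fval; exact: L_cO hs.
- have hs := @L_fsim M _ _ _ (L_var 0) (L_var 1) (L_var 0); rewrite /fok.
  by apply: L_and; Ls.
Qed.

(* Pigeonhole on the first [cap + 2] points of the orbit. *)
Lemma orbit_stop (F : nat -> nat) (P : pred nat) cap z :
  (forall i, iter i F z <= cap) -> (forall y, P y -> F y = y) ->
  forall i, P (iter i F z) -> P (iter cap.+1 F z).
Proof.
move=> hcap habs.
have stay i j : i <= j -> P (iter i F z) -> P (iter j F z).
  move=> ij hi; have -> // : iter j F z = iter i F z.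
  rewrite -(subnK ij) iterD; move: hi; set y := iter i F z => hy.
  by elim: (j - i) => //= m ->; apply: habs.
move=> i; elim/ltn_ind: i => i IH hi.
have [le|lt] := leqP i cap.+1; first exact: stay le hi.
have [a [c [ac cc e]]] : exists a c, [/\ a < c, c <= cap.+1 & iter a F z = iter c F z].
  pose f (j : 'I_cap.+2) : 'I_cap.+1 := inord (iter j F z).
  have /injectivePn[a [c ne e]] : ~~ injectiveb f.
    apply/negP => /injectiveP inj; have := leq_card f inj; rewrite !card_ord ltnn //.
  have {}e : iter a F z = iter c F z.
    by move/(congr1 val): e; rewrite /f /= !inordK ?ltnS.
  have hac : (a : nat) != c by [].
  case: (ltngtP a c) hac => // h _; [exists a, c|exists c, a]; split=> //; rewrite -ltnS ltn_ord //.
apply: (IH (i - (c - a))); first lia.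
have -> // : iter (i - (c - a)) F z = iter i F z.
have -> : i - (c - a) = (i - c) + a by lia.
by rewrite iterD e -iterD subnK //; lia.
Qed.

Lemma nrec_iter n a F : nrec n a (fun _ z => F z) = iter n F a.
Proof. by rewrite /nrec; elim: n => //= n ->. Qed.

(** * Simulation between two choice bits *)

Section Phase.
Variables (M : TM) (w : seq isym) (cap : nat).

(* [phase m] runs the machine on choice symbol [h] until it halts or enters choice cell
   [m + 1]; the value 0 stands for looping.  Once the machine has halted, [nstep] also
   returns 0 on a nonzero bit in a cell that was not visited. *)
Definition inner m h z := nif [|| z == 0, haltc M z | cC z == m.+1] z
  (clampc cap (stepc M false (inp w (cI z)) h z)).
Definition phase m h z0 :=
  nif [&& nrec cap.+1 z0 (fun _ z => inner m h z) != 0 &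
        haltc M (nrec cap.+1 z0 (fun _ z => inner m h z)) || (cC (nrec cap.+1 z0 (fun _ z => inner m h z)) == m.+1)]
      (nrec cap.+1 z0 (fun _ z => inner m h z)) 0.
Definition nstep t bit s := nif (s == 0) 0
  (nif (haltc M s) (nif ((bit == 0) || (cC s == t.+1)) s 0) (phase t.+1 bit.+1 s)).
Definition sinit := phase 0 0 (clampc cap (ccode false (init M))).
Definition nacc s := (s != 0) && (cq s == tm_acc M).
Definition srun (u : nat -> bool) m := nrec m sinit (fun t s => nstep t (u t) s).

Lemma inner_le m h z : inner m h z <= maxn z cap.
Proof.
by rewrite /inner /nif /clampc; case: ifP => _; rewrite ?leq_maxl // /nif; case: ifP => // h'; rewrite leq_max h' orbT.
Qed.

Lemma phase_le m h z : phase m h z <= maxn z cap.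
Proof.
rewrite /phase nrec_iter /nif; case: ifP => // _.
elim: cap.+1 => [|n IH]; first exact: leq_maxl.
by rewrite iterS; apply: leq_trans (inner_le _ _ _) _; rewrite geq_max IH leq_maxr.
Qed.

Lemma nstep_le t bit s : nstep t bit s <= maxn s cap.
Proof.
rewrite /nstep /nif; case: ifP => // _; case: ifP => _; last exact: phase_le.
by case: ifP => //; rewrite leq_maxl.
Qed.

Lemma sinit_le : sinit <= cap.
Proof.
by apply: leq_trans (phase_le _ _ _) _; rewrite /clampc /nif; case: ifP => h; rewrite geq_max leqnn ?h.
Qed.

Variable u : nat -> bool.
Notation rn t := (run M w u t).
Notation cd := (ccode false).
Hypothesis ro : read_once M.
Hypothesis hcap : forall t, cd (rn t) <= cap.

(** As the choice head never moves left, the machine sees one and the same choice symbol until it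
    enters cell [m + 1]. If neither this nor a halt occurs within [cap + 1] steps, [orbit_stop]
    shows that it never does. *)
Lemma phaseP t m : c_cpos (rn t) = m -> ~~ halted (rn t) ->
  let z := phase m (hnum (chsym u m)) (cd (rn t)) in
  (exists t', [/\ t <= t', z = cd (rn t') & (halted (rn t') && (c_cpos (rn t') <= m.+1)) ||
       (~~ halted (rn t') && (c_cpos (rn t') == m.+1))]) \/
  (z = 0 /\ forall t', t <= t' -> ~~ halted (rn t') && (c_cpos (rn t') == m)).
Proof.
move=> ct nh; set F := inner m (hnum (chsym u m)).
pose stop (c : config M) := halted c || (c_cpos c == m.+1).
pose P z := haltc M z || (cC z == m.+1).
have PE c : P (cd c) = stop c by rewrite /P /stop haltc_code cC_code.
have Fst c : stop c -> F (cd c) = cd c.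
  by rewrite /F /inner -PE /P => ->; rewrite orbT.
have Fgo c : ~~ stop c -> c_cpos c = m -> cd (step M w u c) <= cap -> F (cd c) = cd (step M w u c).
  move=> ns cm hc; have := ns; rewrite -PE /P /F /inner => /negPf ->.
  have nhc : ~~ halted c by move: ns; rewrite negb_or => /andP[].
  have -> : hnum (chsym u m) = hnum (chsym u (c_cpos c)) by rewrite cm.
  by rewrite -ccode_step // /clampc /nif hc.
have inv i : (exists t', [/\ t <= t', iter i F (cd (rn t)) = cd (rn t'), stop (rn t') & c_cpos (rn t') <= m.+1]) \/
    [/\ iter i F (cd (rn t)) = cd (rn (t + i)), c_cpos (rn (t + i)) = m & ~~ halted (rn (t + i))].
  elim: i => [|i [[t' [h1 h2 h3 h4]]|[h1 h2 h3]]]; first by right; rewrite addn0.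
    by left; exists t'; rewrite iterS h2 Fst.
  have ns : ~~ stop (rn (t + i)) by rewrite negb_or h3 h2 neq_ltn ltnSn.
  rewrite iterS h1 Fgo // -?[step _ _ _ _]/(rn (t + i).+1) //.
  have := cpos_step w u (rn (t + i)) ro; rewrite h2 -[step _ _ _ _]/(rn (t + i).+1) => /andP[l1 l2].
  case hs: (stop (rn (t + i).+1)).
    by left; exists (t + i).+1; split=> //; apply: leqW; apply: leq_addr.
  move/negbT: hs; rewrite negb_or => /andP[s1 s2].
  right; rewrite addnS; split=> //; apply/eqP; rewrite eqn_leq; apply/andP; split; last exact: l1.
  by rewrite -ltnS ltn_neqAle s2; apply: l2.
have le i : iter i F (cd (rn t)) <= cap.
  by case: (inv i) => [[t' [_ -> _ _]]|[-> _ _]]; apply: hcap.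
have Pabs y : P y -> F y = y by rewrite /P /F /inner => ->; rewrite orbT.
rewrite /= /phase !nrec_iter -/F -[haltc M _ || _]/(P _).
case hP: (P (iter cap.+1 F (cd (rn t)))).
  left; case: (inv cap.+1) => [[t' [h1 h2 h3 h4]]|[h1 h2 h3]].
    exists t'; split=> //; first by rewrite h2 /nif.
    by rewrite h4 andbT; move: h3; rewrite /stop; case: halted => //= ->.
  move: hP; rewrite h1 PE /stop (negPf h3) h2 /= => /eqP; lia.
right; rewrite andbF; split=> // t' tt'.
have nP i : ~~ P (iter i F (cd (rn t))).
  by apply/negP => /(orbit_stop le Pabs); rewrite hP.
case: (inv (t' - t)) => [[t'' [_ h2 h3 _]]|[_ h2 h3]].
  by have := nP (t' - t); rewrite h2 PE h3.
by rewrite subnKC in h2 h3 => //; rewrite h2 h3 eqxx.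
Qed.

(** After [m] bits the run has halted with all unvisited bits zero, or waits on cell [m + 1], whose
    bit is [u m], or is dead. The last case joins divergence, where no time accepts, with a one
    among the unvisited bits. *)
Definition srun_inv m s :=
  [\/ exists t, [/\ s = cd (rn t), halted (rn t), c_cpos (rn t) <= m.+1 &
                  forall i, c_cpos (rn t) <= i < m -> u i = false],
      exists t, [/\ s = cd (rn t), ~~ halted (rn t) & c_cpos (rn t) = m.+1] |
      s = 0 /\ forall t, c_state (rn t) = tm_acc M -> exists i, c_cpos (rn t) <= i < m /\ u i].

Lemma phase_inv t m : c_cpos (rn t) = m -> ~~ halted (rn t) ->
  srun_inv m (phase m (hnum (chsym u m)) (cd (rn t))).
Proof.
move=> ct nh; case: (phaseP ct nh) => [[t' [h1 h2 /orP[/andP[h3 h4]|/andP[h3 /eqP h4]]]]|[h1 h2]].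
- apply: Or31; exists t'; split=> // i /andP[i1 i2].
  have : m <= c_cpos (rn t') by rewrite -ct; apply: cpos_mono.
  lia.
- by apply: Or32; exists t'.
- apply: Or33; split=> // t' ha; have hh : halted (rn t') by rewrite /halted ha eqxx.
  have [le|lt] := leqP t t'; first by have := h2 _ le; rewrite hh.
  by move: nh; rewrite (run_halted hh (ltnW lt)) hh.
Qed.

Lemma srunP m : srun_inv m (srun u m).
Proof.
elim: m => [|m IH].
  rewrite /srun /nrec /= /sinit /clampc.
  have h0 : cd (init M) <= cap by exact: (hcap 0).
  rewrite h0 /=; case hh: (halted (init M)); last first.
    by have := @phase_inv 0 0; apply=> //; rewrite /= hh.
  apply: Or31; exists 0; split=> //=.
  rewrite /phase nrec_iter.
  have e n : iter n (fun z => inner 0 0 z) (cd (init M)) = cd (init M).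
    by elim: n => //= n ->; rewrite /inner haltc_code hh orbT.
  by rewrite !e haltc_code hh.
rewrite /srun /nrec /= -/(nrec m _ _) -/(srun u m); case: IH.
- move=> [t [-> h2 h3 h4]]; rewrite /nstep -[cd (rn t) == 0]/false /= haltc_code h2 cC_code /=.
  (* Bit [m] sits in cell [m + 1]: it is unconstrained iff the halted head stands on that cell,
     which counts as visited even if the machine halted on entering it. *)
  case ht: (_ || _) => /=.
    apply: Or31; exists t; split=> //; first lia.
    move=> i /andP[i1 i2]; have [lt|ge] := ltnP i m; first by apply: h4; rewrite i1.
    have -> : i = m by lia.
    case/orP: ht; first by case: (u m).
    by move=> /eqP e; lia.
  apply: Or33; split=> // t' ha; exists m; have hh : halted (rn t') by rewrite /halted ha eqxx.
  rewrite (run_halted_eq h2 hh).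
  move/negbT: ht; rewrite negb_or => /andP[h5 h6]; split; first lia.
  by move: h5; case: (u m).
- move=> [t [-> h2 h3]]; rewrite /nstep -[cd (rn t) == 0]/false /= haltc_code (negPf h2) /=.
  have -> : (u m).+1 = hnum (chsym u m.+1) by rewrite /=; case: (u m).
  exact: phase_inv.
- move=> [-> h]; rewrite /nstep /=; apply: Or33; split=> // t /h[i [h1 h2]]; exists i; split=> //; lia.
Qed.

Lemma nacc_srun m : (forall t, c_cpos (rn t) <= m) ->
  nacc (srun u m) <-> exists t, c_state (rn t) = tm_acc M /\ forall i, c_cpos (rn t) <= i < m -> u i = false.
Proof.
move=> hm; case: (srunP m).
- move=> [t [-> h2 h3 h4]]; rewrite /nacc cq_code -[cd (rn t) == 0]/false /=; split.
    by move/eqP/val_inj => h; exists t.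
  move=> [t' [ha _]]; have hh : halted (rn t') by rewrite /halted ha eqxx.
  by rewrite -(run_halted_eq h2 hh) ha eqxx.
- by move=> [t [_ _ h]]; have := hm t; rewrite h; lia.
- move=> [-> h]; split=> // -[t [/h[i [h1 h2]] h3]]; by rewrite (h3 _ h1) in h2.
Qed.
End Phase.

Lemma L_phase M F G H K : L F -> L G -> L H -> L K -> L (fun w v => phase M w (F w v) (G w v) (H w v) (K w v)).
Proof.
move=> hF hG hH hK.
have hr : L (fun w v => nrec (F w v).+1 (K w v) (fun _ z => inner M w (F w v) (G w v) (H w v) z)).
  apply: (L_rec_le (n := fun w v => (F w v).+1) (s := fun w v _ z => inner M w (F w v) (G w v) (H w v) z)
     (B := fun w v => K w v + F w v)); try by Ls.
    by rewrite /inner /clampc /haltc; Ls.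
  move=> w v i _; rewrite nrec_iter; elim: i => [|i IH]; first by rewrite leq_addr.
  rewrite iterS {1}/inner /nif; case: ifP => // _; rewrite /clampc /nif; case: ifP => // h; lia.
by rewrite /phase /haltc; Ls.
Qed.

Lemma L_nstep M F G H K : L F -> L G -> L H -> L K -> L (fun w v => nstep M w (F w v) (G w v) (H w v) (K w v)).
Proof.
move=> hF hG hH hK; rewrite /nstep /haltc.
have hp := L_phase M hF (L_succ hG) (L_succ hH) hK.
by Ls.
Qed.

Lemma L_sinit M F : L F -> L (fun w v => sinit M w (F w v)).
Proof. by move=> hF; rewrite /sinit /clampc; apply: L_phase; Ls. Qed.

Lemma L_nacc M F : L F -> LB (fun w v => nacc M (F w v)).
Proof. by move=> hF; rewrite /nacc; Ls. Qed.

Lemma srun0 M w cap u : srun M w cap u 0 = sinit M w cap.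
Proof. reflexivity. Qed.

Lemma srunS M w cap u m : srun M w cap u m.+1 = nstep M w cap m (u m) (srun M w cap u m).
Proof. reflexivity. Qed.

(* Otherwise conversion tests try to evaluate the simulated machine. *)
#[global] Opaque sinit nstep srun.

Definition bits l (g : nat -> nat) (t : nat) : bool := nb (g (t %/ l)) (l - 1 - t %% l).

Lemma srun_ext M w cap u u' m : (forall t, t < m -> u t = u' t) ->
  srun M w cap u m = srun M w cap u' m.
Proof.
elim: m => [|m IH] h; first by rewrite !srun0.
rewrite !srunS IH; first by rewrite h.
by move=> t ht; apply: h; lia.
Qed.

(** Padding by zeros maps accepting paths bijectively to accepted strings of length [b * l]. It is
    injective because the length of a path is the head position of the halted run, and the run
    depends on the padded string only; the inverse cuts off the unvisited bits. *)
Lemma count_srun M F x k b l cap (w := input_word x k) : read_once M -> counts_acc M F ->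
  (forall u t, ccode false (run M w u t) <= cap) ->
  (forall u t, c_cpos (run M w u t) <= b * l) ->
  F x k = #|[pred g : {ffun 'I_b -> 'I_(2 ^ l)} | nacc M (srun M w cap (bits l (ext_map g)) (b * l))]|.
Proof.
move=> ro hF hcap hpos.
have [s [us hs <-]] := hF x k.
rewrite -card_blkf.
have bE (u : (b * l).-tuple bool) : srun M w cap (bits l (ext_map (blkf u))) (b * l) =
    srun M w cap (nth false u) (b * l).
  apply: srun_ext => t ht; rewrite /bits.
  have l0 : 0 < l by case: (l) ht => //; rewrite muln0.
  have hi : t %/ l < b by rewrite ltn_divLR.
  by rewrite ext_map_ord ffunE /= nb_blk ?ltn_pmod // -divn_eq.
rewrite (eq_card (B := [pred u : (b * l).-tuple bool | nacc M (srun M w cap (nth false u) (b * l))])); last first.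
  move=> u; change (nacc M (srun M w cap (bits l (ext_map (blkf u))) (b * l)) =
    nacc M (srun M w cap (nth false u) (b * l))).
  by rewrite bE.
pose pad u : (b * l).-tuple bool := [tuple of mkseq (nth false u) (b * l)].
have sz u : u \in s -> size u <= b * l.
  by move/hs/(acc_pathE x k u ro) => [t [_ <-]]; apply: hpos.
have padE u : u \in s -> nth false (pad u) =1 nth false u.
  move=> /sz hu i; have [lt|ge] := ltnP i (b * l); first by rewrite nth_mkseq.
  by rewrite !nth_default ?size_mkseq // (leq_trans hu).
have fpadE u : u \in s -> nth false (pad u) = nth false u.
  by move=> hu; apply: functional_extensionality => i; apply: padE.
have nin u : nacc M (srun M w cap (nth false u) (b * l)) <-> exists t,
    c_state (run M w (nth false u) t) = tm_acc M /\
    forall i, c_cpos (run M w (nth false u) t) <= i < b * l -> nth false u i = false.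
  by apply: nacc_srun.
rewrite -(size_map pad) cardE; apply/perm_size/uniq_perm; rewrite ?enum_uniq //.
  rewrite map_inj_in_uniq // => u u' hu hu' e.
  have e1 : nth false u = nth false u' by rewrite -(fpadE _ hu) -(fpadE _ hu') e.
  have /(acc_pathE x k u ro)[t [h1 h2]] := (hs u).1 hu.
  have /(acc_pathE x k u' ro)[t' [h1' h2']] := (hs u').1 hu'.
  have hh : halted (run M w (nth false u) t) by rewrite /halted h1 eqxx.
  have hh' : halted (run M w (nth false u) t') by rewrite /halted e1 h1' eqxx.
  apply: (@eq_from_nth _ false); last by move=> i _; rewrite e1.
  by rewrite -h2 -h2' -/w -e1 (run_halted_eq hh hh').
move=> v; rewrite mem_enum inE; apply/mapP/idP => [[u hu ->]|].
  rewrite fpadE //; apply/nin; have /(acc_pathE x k u ro)[t [h1 h2]] := (hs u).1 hu.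
  exists t; split=> // i /andP[]; rewrite h2 => hi _; exact: nth_default.
move/nin => [t [h1 h2]]; pose u := take (c_cpos (run M w (nth false v) t)) v.
have e : nth false u = nth false v.
  apply: functional_extensionality => i; rewrite /u.
  have [lt|ge] := ltnP i (c_cpos (run M w (nth false v) t)); first by rewrite nth_take.
  rewrite nth_default ?size_take_min ?geq_min ?ge //.
  by have [lt|ge'] := ltnP i (b * l); [rewrite h2 // ge lt|rewrite nth_default // size_tuple].
have hu : u \in s.
  apply/hs/(acc_pathE x k u ro); exists t; rewrite e h1; split=> //.
  rewrite size_take_min size_tuple; apply/esym/minn_idPl; exact: hpos.
exists u => //; apply: val_inj; apply: (@eq_from_nth _ false); rewrite ?size_tuple // => i hi.
by rewrite padE // e.
Qed.

Definition macron M w cap l i y s m :=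
  nrec m s (fun j s => nstep M w cap (i * l + j) (nb y (l - 1 - j)) s).
Definition macro M w cap l i s y := macron M w cap l i y s l.

Lemma macron0 M w cap l i y s : macron M w cap l i y s 0 = s.
Proof. reflexivity. Qed.

Lemma macronS M w cap l i y s m : macron M w cap l i y s m.+1 =
  nstep M w cap (i * l + m) (nb y (l - 1 - m)) (macron M w cap l i y s m).
Proof. reflexivity. Qed.

Lemma gfold0 s0 st u : gfold 0 s0 st u = s0.
Proof. reflexivity. Qed.

Lemma gfoldS b s0 st u : gfold b.+1 s0 st u = st (u b) b (gfold b s0 st u).
Proof. reflexivity. Qed.

#[global] Opaque macron.

Lemma srun_macro M w cap b l g :
  srun M w cap (bits l g) (b * l) = gfold b (sinit M w cap) (fun y i s => macro M w cap l i s y) g.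
Proof.
elim: b => [|b IH]; first by rewrite mul0n gfold0 srun0.
rewrite gfoldS -IH mulSn addnC /macro; set a := srun _ _ _ _ (b * l).
have H m : m <= l -> srun M w cap (bits l g) (b * l + m) = macron M w cap l b (g b) a m.
  elim: m => [|m IHm] ml; first by rewrite addn0 macron0.
  have e : bits l g (b * l + m) = nb (g b) (l - 1 - m).
    by rewrite /bits divnMDl ?divn_small ?addn0 ?modnMDl ?modn_small //; lia.
  by rewrite addnS srunS macronS e IHm // ltnW.
exact: H.
Qed.

(** * The graph of a blockwise computation *)

Section Graph.
Variables (b S Lp s0 : nat) (mac : nat -> nat -> nat -> nat) (acc : nat -> bool).
Hypotheses (S0 : s0 < S) (macS : forall i s y, s < S -> mac i s y < S) (Lp0 : 0 < Lp).

(* A vertex codes a triple (layer, state, block), with [mac i s y] the state reached from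
   [s] on block [y]. *)
Definition gN := b.+1 * S * Lp.
Definition vert i s y := (i * S + s) * Lp + y.
Definition vi v := v %/ Lp %/ S.
Definition vs v := (v %/ Lp) %% S.
Definition vy v := v %% Lp.
Definition garc v v' := [&& v < gN, v' < gN, vi v' == (vi v).+1 & vs v' == mac (vi v) (vs v) (vy v)].
Definition gedge v v' := garc v v' || garc v' v.
(** Layer [b] has no block left to read. Fixing the block of its vertices to 0 prevents each walk
    from being counted [Lp] times. *)
Definition gcol i v := [&& v < gN, vi v == i, (i == 0) ==> (vs v == s0) &
   (i == b) ==> (vy v == 0) && acc (vs v)].

Definition gtau : seq nat := 2 :: nseq b.+1 1.
Definition pathA : structure := Struct b.+1
  (path_edges b.+1 id :: [seq [:: [:: i]] | i <- iota 0 b.+1]).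
(* The vertices [gN] (colored, without edges) and [gN + 1] (a colorless loop) only
   serve to pad the relations to a fixed size; no homomorphism uses them. *)
Definition graphB : structure := Struct gN.+2
  (flatten [seq [seq (if gedge v v' then [:: v; v'] else [:: gN.+1; gN.+1]) | v' <- iota 0 gN] | v <- iota 0 gN]
   :: [seq [seq (if gcol i v then [:: v] else [:: gN]) | v <- iota 0 gN] | i <- iota 0 b.+1]).

Let SP : 0 < S := leq_ltn_trans (leq0n _) S0.

Lemma vert_vi i s y : s < S -> y < Lp -> vi (vert i s y) = i.
Proof. by move=> hs hy; rewrite /vi /vert divnMDl // (divn_small hy) addn0 divnMDl // divn_small // addn0. Qed.
Lemma vert_vs i s y : s < S -> y < Lp -> vs (vert i s y) = s.
Proof. by move=> hs hy; rewrite /vs /vert divnMDl // (divn_small hy) addn0 modnMDl modn_small. Qed.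
Lemma vert_vy i s y : y < Lp -> vy (vert i s y) = y.
Proof. by move=> hy; rewrite /vy /vert modnMDl modn_small. Qed.
Lemma vertE v : v = vert (vi v) (vs v) (vy v).
Proof. by rewrite /vert /vi /vs /vy -!divn_eq. Qed.
Lemma vert_lt i s y : i <= b -> s < S -> y < Lp -> vert i s y < gN.
Proof.
move=> hi hs hy; rewrite /vert /gN.
have h1 : i * S + s < b.+1 * S by nia.
by move: (b.+1 * S) (i * S + s) h1 => X Y h1; nia.
Qed.

Definition walk (H : nat -> nat) :=
  (forall i, i <= b -> gcol i (H i)) /\ (forall i, i < b -> garc (H i) (H i.+1)).

Lemma mem_edgesB v v' : v < gN ->
  ([:: v; v'] \in rel_of graphB 0) = (v' < gN) && gedge v v'.
Proof.
move=> hv; apply/flattenP/andP => [[l /mapP[a ha ->]] /mapP[c hc]|[hv' e]].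
  rewrite !mem_iota /= !add0n in ha hc *; case: ifP => h [e1 e2]; last by lia.
  by rewrite e1 e2.
exists [seq (if gedge v c then [:: v; c] else [:: gN.+1; gN.+1]) | c <- iota 0 gN].
  by apply/mapP; exists v; rewrite ?mem_iota.
by apply/mapP; exists v'; rewrite ?mem_iota // e.
Qed.

Lemma mem_edgesB_lt v v' : [:: v; v'] \in rel_of graphB 0 -> v != gN.
Proof.
move=> /flattenP[l /mapP[a]]; rewrite mem_iota add0n /= => ha -> /mapP[c hc].
by case: ifP => _ [-> _]; lia.
Qed.

Lemma rel_colB i : i <= b -> rel_of graphB i.+1 = [seq (if gcol i v then [:: v] else [:: gN]) | v <- iota 0 gN].
Proof.
move=> hi; change (nth [::] [seq [seq (if gcol i v then [:: v] else [:: gN]) | v <- iota 0 gN] | i <- iota 0 b.+1] i = [seq (if gcol i v then [:: v] else [:: gN]) | v <- iota 0 gN]).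
by rewrite (nth_map 0) ?size_iota // nth_iota.
Qed.

Lemma rel_colA i : i <= b -> rel_of pathA i.+1 = [:: [:: i]].
Proof.
move=> hi; change (nth [::] [seq [:: [:: i]] | i <- iota 0 b.+1] i = [:: [:: i]]).
by rewrite (nth_map 0) ?size_iota // nth_iota.
Qed.

Lemma mem_colB i v : i <= b -> ([:: v] \in rel_of graphB i.+1) =
  (v < gN) && gcol i v || (v == gN) && ~~ nall gN (gcol i).
Proof.
move=> hi; rewrite rel_colB //.
apply/mapP/orP => [[a]|[/andP[h1 h2]|/andP[/eqP -> /allPn[a ha hc]]]].
- rewrite mem_iota add0n /= => ha; case: ifP => hc [->]; [left|right]; first by rewrite ha hc.
  by rewrite eqxx; apply/allPn; exists a; rewrite ?mem_iota ?hc.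
- by exists v; rewrite ?mem_iota // h2.
- by exists a => //; rewrite (negPf hc).
Qed.

Hypothesis b0 : 0 < b.

(** The colors fix the layer of each image, so only the forward reading of a symmetric edge remains.
    The padding vertex [gN] may carry colors but has no edges, whereas each path vertex has a
    neighbor because [0 < b]. *)
Lemma is_hom_walk (h : {ffun 'I_(sdom pathA) -> 'I_(sdom graphB)}) :
  is_hom gtau pathA graphB h <-> walk (ext_map h).
Proof.
have szt : size gtau = b.+2 by rewrite /= size_nseq.
have homE : is_hom gtau pathA graphB h <->
    (forall i, i <= b -> [:: ext_map h i] \in rel_of graphB i.+1) /\
    (forall i, i < b -> [:: ext_map h i; ext_map h i.+1] \in rel_of graphB 0 /\
                        [:: ext_map h i.+1; ext_map h i] \in rel_of graphB 0).
  rewrite /is_hom szt; split.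
    move=> /allP hh; split=> i hi.
      have /hh/allP/(_ [:: i]) : i.+1 \in iota 0 b.+2 by rewrite mem_iota /= add0n.
      apply; rewrite rel_colA //; exact: mem_head.
    have /hh/allP hE : 0 \in iota 0 b.+2 by rewrite mem_iota.
    have mE t : t \in [:: [:: i; i.+1]; [:: i.+1; i]] -> t \in rel_of pathA 0.
      move=> ht; apply/flattenP; exists [:: [:: i; i.+1]; [:: i.+1; i]] => //.
      by apply/mapP; exists i; rewrite ?mem_iota.
    by split; [apply: (hE [:: i; i.+1])|apply: (hE [:: i.+1; i])]; apply: mE; rewrite !inE eqxx ?orbT.
  move=> [h1 h2]; apply/allP => i; rewrite mem_iota add0n /= => hi; apply/allP => t.
  case: i hi => [|i] hi.
    move=> /flattenP[l /mapP[a]]; rewrite mem_iota add0n /= => ha ->.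
    have [e1 e2] := h2 _ ha.
    by rewrite !inE => /orP[/eqP->|/eqP->].
  rewrite rel_colA // inE => /eqP -> /=.
  by apply: h1.
rewrite homE; split.
  move=> [h1 h2].
  have lt i : i <= b -> ext_map h i < gN.
    move=> hi; have := h1 i hi; rewrite mem_colB // => /orP[/andP[]//|/andP[/eqP e _]]; exfalso.
    case: (ltnP i b) => ib; first by have [/mem_edgesB_lt] := h2 _ ib; rewrite e eqxx.
    have ib' : i.-1 < b by lia.
    have [_ /mem_edgesB_lt] := h2 _ ib'; have -> : i.-1.+1 = i by lia.
    by rewrite e eqxx.
  have col i : i <= b -> gcol i (ext_map h i).
    by move=> hi; have := h1 i hi; rewrite mem_colB // => /orP[/andP[]//|/andP[/eqP e _]]; have := lt i hi; lia.
  split=> // i hi; have [] := h2 i hi; rewrite mem_edgesB ?lt ?(ltnW hi) // => /andP[_ /orP[//|]] .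
  rewrite /garc; have /and4P[_ /eqP -> _ _] := col i (ltnW hi); have /and4P[_ /eqP -> _ _] := col i.+1 hi.
  by case/and4P=> _ _ /eqP; lia.
move=> [h1 h2]; split=> i hi.
  by rewrite mem_colB //; have /and4P[h' _ _ _] := h1 i hi; rewrite h' h1.
have a := h2 i hi; have /and4P[a1 a2 _ _] := a.
by rewrite !mem_edgesB // a1 a2 /gedge a orbT.
Qed.

Definition gs (g : {ffun 'I_b -> 'I_Lp}) i := gfold i s0 (fun y i s => mac i s y) (ext_map g).
Definition gh (g : {ffun 'I_b -> 'I_Lp}) : {ffun 'I_(sdom pathA) -> 'I_(sdom graphB)} :=
  [ffun i : 'I_b.+1 => inord (vert i (gs g i) (ext_map g i))].

Lemma gs_lt g i : gs g i < S.
Proof. by rewrite /gs; elim: i => [|i IH]; rewrite ?gfold0 ?gfoldS //; apply: macS. Qed.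

Lemma ext_lt (g : {ffun 'I_b -> 'I_Lp}) i : ext_map g i < Lp.
Proof. by rewrite /ext_map; case: insub => [j|] //; apply: ltn_ord. Qed.

Lemma gh_val g i : i <= b -> ext_map (gh g) i = vert i (gs g i) (ext_map g i).
Proof.
move=> hi; have hi' : i < b.+1 by [].
rewrite (ext_map_ord _ (hi' : i < sdom pathA)) ffunE /= inordK //.
by have := vert_lt hi (gs_lt g i) (ext_lt g i); lia.
Qed.

Lemma gh_inj : injective gh.
Proof.
move=> g g' e; apply/ffunP => i; apply: val_inj.
have := gh_val g (ltnW (ltn_ord i)); rewrite e gh_val ?(ltnW (ltn_ord i)) // => /(congr1 vy).
have ei : Ordinal (ltn_ord i) = i by apply: val_inj.
by rewrite !vert_vy ?ext_lt // !(ext_map_ord _ (ltn_ord i)) ei.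
Qed.

(** A walk is determined by its blocks, since the start color and the arcs fix all states; [gh]
    rebuilds the walk from them. *)
Lemma nhom_graph : nhom gtau pathA graphB =
  #|[pred g : {ffun 'I_b -> 'I_Lp} | acc (gfold b s0 (fun y i s => mac i s y) (ext_map g))]|.
Proof.
rewrite /nhom -(card_image gh_inj); apply: eq_card => h; rewrite inE.
apply/idP/imageP.
  move=> /is_hom_walk[h1 h2]; pose H := ext_map h.
  pose g : {ffun 'I_b -> 'I_Lp} := [ffun i : 'I_b => Ordinal (ltn_pmod (H i) Lp0)].
  have gE i : i < b -> ext_map g i = vy (H i) by move=> hi; rewrite (ext_map_ord _ hi) ffunE.
  (* Outside its domain [ext_map] is 0, which is the block prescribed for layer [b]. *)
  have gb : ext_map g b = 0 by rewrite /ext_map insubF // ltnn.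
  have gsE i : i <= b -> gs g i = vs (H i).
    elim: i => [|i IH] hi.
      by rewrite /gs gfold0; have /and4P[_ _ /eqP -> _] := h1 0 hi.
    rewrite /gs gfoldS -/(gs g i) IH ?(ltnW hi) // gE //.
    have /and4P[_ _ _ /eqP ->] := h2 i hi.
    by have /and4P[_ /eqP -> _ _] := h1 i (ltnW hi).
  have HE i : i <= b -> H i = vert i (gs g i) (ext_map g i).
    move=> hi; rewrite gsE // [LHS]vertE; have /and4P[_ /eqP -> _ /implyP hb] := h1 i hi.
    move: hi; rewrite leq_eqVlt => /orP[/eqP e|hi]; last by rewrite gE.
    by rewrite e gb -[H b]/(ext_map h b) -e; have /andP[/eqP -> _] := hb (introT eqP e).
  exists g.
    rewrite inE -/(gs g b) gsE //; have /and4P[_ _ _] := h1 b (leqnn b).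
    by rewrite eqxx => /andP[].
  apply/ffunP => i; apply: val_inj; have hi : i <= b by rewrite -ltnS; case: (i).
  have ei : Ordinal (ltn_ord i) = i by apply: val_inj.
  by have := gh_val g hi; rewrite -HE // /H !(ext_map_ord _ (ltn_ord i)) ei.
move=> [g]; rewrite inE => hg ->; apply/is_hom_walk; split=> i hi.
  rewrite gh_val //; apply/and4P; split.
  - by apply: vert_lt => //; [apply: gs_lt|apply: ext_lt].
  - by rewrite vert_vi ?gs_lt ?ext_lt.
  - by apply/implyP => /eqP ->; rewrite vert_vs ?gs_lt ?ext_lt // /gs gfold0.
  - apply/implyP => /eqP ->; rewrite vert_vs ?gs_lt ?ext_lt // vert_vy ?ext_lt // hg andbT.
    by rewrite /ext_map insubF // ltnn.
rewrite !gh_val ?(ltnW hi) //; apply/and4P; split.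
- by apply: vert_lt => //; [apply: ltnW|apply: gs_lt|apply: ext_lt].
- by apply: vert_lt => //; [apply: gs_lt|apply: ext_lt].
- by rewrite !vert_vi ?gs_lt ?ext_lt.
- by rewrite vert_vi ?vert_vs ?vert_vy ?gs_lt ?ext_lt // /gs gfoldS.
Qed.
End Graph.

(** * Encoding of the target instance *)

Definition enc_rel (r : seq (seq nat)) : seq nat := size r :: flatten r.
Definition enc_struct (A : structure) : seq nat := sdom A :: flatten (map enc_rel (srels A)).
Definition enc_inst tau A B : seq nat := (size tau :: tau) ++ enc_struct A ++ enc_struct B.

Lemma dec_enc s : dec_nats 0 (enc s) = Some s.
Proof.
elim: s => //= n s IH; rewrite /enc /= -/(enc s).
have H m acc : dec_nats acc (rcons (nseq m true) false ++ enc s) = Some ((acc + m) :: s).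
  elim: m acc => [|m IHm] acc /=; first by rewrite IH addn0.
  by rewrite IHm addSnnS.
exact: H.
Qed.

Local Arguments parse_rel : simpl never.

Lemma parse_enc_rel ar r rest : all (fun t => size t == ar) r ->
  parse_rel ar (enc_rel r ++ rest) = Some (r, rest).
Proof.
move=> h; have sh : shape r = nseq (size r) ar.
  by elim: r h => //= t r IH /andP[/eqP -> /IH ->].
have sz : size (flatten r) = size r * ar by rewrite size_flatten sh sumn_nseq mulnC.
rewrite /parse_rel /= /split_at size_cat sz leq_addr take_size_cat // drop_size_cat //.
by rewrite -sh flattenK.
Qed.

Lemma parse_enc_rels tau rels rest : size rels = size tau ->
  all (fun p => all (fun t => size t == p.1) p.2) (zip tau rels) ->
  parse_rels tau (flatten (map enc_rel rels) ++ rest) = Some (rels, rest).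
Proof.
elim: tau rels => [|a tau IH] [|r rels] //= [sz] /andP[h1 h2].
rewrite [X in parse_rel a X](_ : _ = enc_rel r ++ (flatten (map enc_rel rels) ++ rest)); last by rewrite /= -catA.
by rewrite parse_enc_rel // IH.
Qed.

Lemma parse_enc_struct tau A rest : wf_struct tau A ->
  parse_struct tau (enc_struct A ++ rest) = Some (A, rest).
Proof.
case/andP=> /eqP sz h; rewrite /= parse_enc_rels //; first by case: A {sz h}.
apply: sub_all h => p; apply: sub_all => t; by case/andP.
Qed.

Lemma parse_enc_inst tau A B : wf_struct tau A -> wf_struct tau B ->
  parse_instance (enc_inst tau A B) = Some (tau, A, B).
Proof.
move=> hA hB; rewrite /enc_inst cat_cons /parse_instance /split_at size_cat leq_addr.
rewrite take_size_cat // drop_size_cat // parse_enc_struct //.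
by rewrite -[enc_struct B]cats0 parse_enc_struct.
Qed.

Lemma p_hom_enc tau A B k : wf_struct tau A -> wf_struct tau B -> in_Pstar tau A -> sdom A <= k ->
  p_hom_Pstar (enc (enc_inst tau A B)) k = nhom tau A B.
Proof. by move=> h1 h2 h3 h4; rewrite /p_hom_Pstar dec_enc -[obind _ _]/(parse_instance _) parse_enc_inst // h1 h2 h3 h4. Qed.

Section GraphEnc.
Variables (b S Lp s0 : nat) (mac : nat -> nat -> nat -> nat) (acc : nat -> bool).
Hypotheses (b0 : 0 < b).
Notation gN := (gN b S Lp).
Notation pathA := (pathA b).
Notation graphB := (graphB b S Lp s0 mac acc).
Notation gedge := (gedge b S Lp mac).
Notation gcol := (gcol b S Lp s0 acc).

Lemma wf_gtau (A : structure) (r0 : seq (seq nat)) (r : nat -> seq (seq nat)) :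
  srels A = r0 :: [seq r i | i <- iota 0 b.+1] ->
  (forall t, t \in r0 -> size t = 2 /\ all (fun a => a < sdom A) t) ->
  (forall i t, i <= b -> t \in r i -> size t = 1 /\ all (fun a => a < sdom A) t) ->
  wf_struct (gtau b) A.
Proof.
move=> eA h0 h; rewrite /wf_struct eA /gtau; apply/andP; split.
  by rewrite [X in X == _]/= [X in _ == X]/= size_map size_iota size_nseq.
have hh n : n <= b.+1 -> all (fun p => all (fun t => (size t == p.1) && all (fun a => a < sdom A) t) p.2)
    (zip (nseq n 1) [seq r i | i <- iota 0 n]).
  move=> hn; apply/(all_nthP (0, [::])) => i.
  rewrite size_zip size_nseq size_map size_iota minnn => hi.
  rewrite nth_zip ?size_nseq ?size_map ?size_iota //= nth_nseq hi (nth_map 0) ?size_iota // nth_iota // add0n.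
  have ib : i <= b by rewrite -ltnS; apply: leq_trans hn.
  by apply/allP => t /(h _ _ ib)[-> ->].
apply/andP; split; last exact: (hh b.+1).
by apply/allP => t /h0 [-> ->].
Qed.

Lemma wf_pathA : wf_struct (gtau b) pathA.
Proof.
apply: (@wf_gtau _ (path_edges b.+1 id) (fun i => [:: [:: i]])) => //.
  move=> t /flattenP[l /mapP[i]]; rewrite mem_iota add0n /= => hi ->.
  by rewrite !inE => /orP[/eqP->|/eqP->] /=; split=> //; lia.
by move=> i t hi; rewrite inE => /eqP -> /=; split=> //; lia.
Qed.

Lemma wf_graphB : wf_struct (gtau b) graphB.
Proof.
apply: (@wf_gtau _ _ (fun i => [seq (if gcol i v then [:: v] else [:: gN]) | v <- iota 0 gN])) => //.
  move=> t /flattenP[l /mapP[i]]; rewrite mem_iota add0n /= => hi -> /mapP[j].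
  rewrite mem_iota add0n /= => hj ->; case: ifP => _ /=; split=> //; lia.
move=> i t hi /mapP[j]; rewrite mem_iota add0n /= => hj ->; case: ifP => _ /=; split=> //; lia.
Qed.

Lemma same_set_refl s : same_set s s.
Proof. by rewrite /same_set; apply/andP; split; apply/allP. Qed.

Lemma pathA_Pstar : in_Pstar (gtau b) pathA.
Proof.
have szt : size (gtau b) = b.+2 by rewrite /= size_nseq.
have h0 : 0 < size (gtau b) by rewrite szt.
rewrite /in_Pstar [sdom _]/= szt eqxx /=; apply/andP; split; first lia.
rewrite -szt; apply/existsP; exists (Ordinal h0).
rewrite [nth _ _ _]/= eqxx /=; apply/andP; split.
  apply/existsP; exists [ffun i => i]; apply/andP; split.
    by apply/injectiveP => i j; rewrite !ffunE.
  have -> : path_edges b.+1 (ext_map [ffun i : 'I_b.+1 => i]) = path_edges b.+1 id; last exact: same_set_refl.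
  congr flatten; apply/eq_in_map => i; rewrite mem_iota add0n /= => hi.
  have hi1 : i < b.+1 by lia. have hi2 : i.+1 < b.+1 by lia.
  by rewrite (ext_map_ord _ hi1) (ext_map_ord _ hi2) !ffunE.
have lt (a : 'I_b.+1) : a.+1 < size (gtau b) by rewrite szt ltnS.
apply/existsP; exists [ffun a => Ordinal (lt a)]; apply/andP; split.
  by apply/injectiveP => i j; rewrite !ffunE => /(congr1 val) /= [] /val_inj.
apply/forallP => a; rewrite ffunE; apply/and3P; split=> //.
  by rewrite -[nth _ _ _]/(nth 0 (nseq b.+1 1) a) nth_nseq ltn_ord.
by rewrite rel_colA ?same_set_refl // -ltnS.
Qed.

(** The encoding announces the size of a relation before its tuples. Padding makes these sizes plain
    expressions in [b] and [gN], so the word is emitted by nested loops without counting edges. *)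
Definition graph_nums : seq nat :=
  (b.+2 :: 2 :: flatten [seq [:: 1] | i <- iota 0 b.+1]) ++
  (b.+1 :: b + b :: flatten [seq [:: i; i.+1; i.+1; i] | i <- iota 0 b] ++
     flatten [seq [:: 1; i] | i <- iota 0 b.+1]) ++
  (gN.+2 :: gN * gN :: flatten [seq flatten [seq [:: nif (gedge v v') v gN.+1; nif (gedge v v') v' gN.+1] | v' <- iota 0 gN] | v <- iota 0 gN] ++
     flatten [seq gN :: flatten [seq [:: nif (gcol i v) v gN] | v <- iota 0 gN] | i <- iota 0 b.+1]).

Lemma flatten_flatten (T : Type) (s : seq (seq (seq T))) : flatten (flatten s) = flatten (map flatten s).
Proof. by elim: s => //= a s <-; rewrite flatten_cat. Qed.

Lemma sumn_map_const (T : Type) (s : seq T) c : sumn [seq c | _ <- s] = size s * c.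
Proof. by elim: s => //= _ s ->; rewrite mulSn. Qed.

Lemma flatten_cons (T : Type) (a : seq T) s : flatten (a :: s) = a ++ flatten s.
Proof. by []. Qed.

Lemma graph_numsE : graph_nums = enc_inst (gtau b) pathA graphB.
Proof.
rewrite /graph_nums /enc_inst; congr (_ ++ (_ ++ _)).
- rewrite [size _]/= size_nseq /gtau; congr [:: _, _ & _].
  by rewrite -[in RHS](size_iota 0 b.+1); elim: (iota _ _) => //= a l ->.
- rewrite /enc_struct; congr cons.
  rewrite (_ : srels pathA = path_edges b.+1 id :: [seq [:: [:: i]] | i <- iota 0 b.+1]) //.
  rewrite map_cons flatten_cons -map_comp /enc_rel cat_cons; congr (_ :: (_ ++ _)).
    rewrite size_flatten /shape -map_comp (eq_map (g := fun=> 2)) // sumn_map_const size_iota.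
    by rewrite -[b.+1.-1]/b; lia.
  by rewrite flatten_flatten -map_comp.
- rewrite /enc_struct; congr cons.
  rewrite (_ : srels graphB = flatten [seq [seq (if gedge v v' then [:: v; v'] else [:: gN.+1; gN.+1]) | v' <- iota 0 gN] | v <- iota 0 gN]
     :: [seq [seq (if gcol i v then [:: v] else [:: gN]) | v <- iota 0 gN] | i <- iota 0 b.+1]) //.
  rewrite map_cons flatten_cons -map_comp {1}/enc_rel cat_cons; congr (_ :: (_ ++ _)).
  + rewrite size_flatten /shape -map_comp (eq_map (g := fun=> gN)); last by move=> v /=; rewrite size_map size_iota.
    by rewrite sumn_map_const size_iota.
  + rewrite flatten_flatten -map_comp; congr flatten; apply: eq_map => v /=; congr flatten.
    by apply: eq_map => v'; rewrite /nif /=; case: ifP.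
  congr flatten; apply: eq_map => i /=; rewrite /enc_rel size_map size_iota; congr (_ :: flatten _).
  by apply: eq_map => v; rewrite /nif; case: ifP.
Qed.

End GraphEnc.

(** * Computing the target graph in [L] *)

Lemma L_nb F G : L F -> L G -> LB (fun w v => nb (F w v) (G w v)).
Proof.
move=> hF hG; apply: (@L_ext (fun w v => odd (F w v %/ pow2c (G w v) (F w v).+1))); first by Ls.
move=> w v; rewrite pow2cE /nb; case: (leqP (2 ^ G w v) (F w v)) => h.
  by rewrite (minn_idPl (leqW h)).
by rewrite (minn_idPr h) !divn_small.
Qed.

(** Counts the powers of two up to [n]; the maximum with 1 is for [n = 0], where [lg] is 1. *)
Lemma lgE n : lg n = maxn 1 (nsum n.+1 (fun i => pow2c i n.+1 <= n)).
Proof.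
case: n => [|n]; first by rewrite /lg /nsum big_nat1 pow2cE.
rewrite (_ : nsum _ _ = nsum n.+2 (fun i => i < lg n.+1)).
  rewrite nsum_lt; first by rewrite /lg; case: trunc_log.
  have := trunc_logP (isT : 1 < 2) (ltn0Sn n); have := ltn_expl (trunc_log 2 n.+1) (isT : 1 < 2).
  by rewrite /lg; lia.
apply: eq_bigr => i _; congr nat_of_bool; rewrite pow2cE /lg ltnS geq_min ltnn orbF.
apply/idP/idP => [|h]; first exact: trunc_log_max.
by apply: leq_trans (trunc_logP (isT : 1 < 2) (ltn0Sn n)); rewrite leq_exp2l.
Qed.

Lemma L_lg F : L F -> L (fun w v => lg (F w v)).
Proof.
move=> hF; apply: (@L_ext (fun w v => maxn 1 (nsum (F w v).+1 (fun i => pow2c i (F w v).+1 <= F w v)))).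
  by Ls.
by move=> w v; rewrite lgE.
Qed.

Lemma exp_lg n : 2 ^ lg n <= 2 * n + 2.
Proof.
rewrite /lg expnS; case: n => [|n]; first by rewrite /trunc_log.
by have := trunc_logP (isT : 1 < 2) (ltn0Sn n); lia.
Qed.

Lemma L_exp_lg F : L F -> L (fun w v => 2 ^ lg (F w v)).
Proof.
move=> hF; have hl := L_lg hF.
apply: (@L_ext (fun w v => pow2c (lg (F w v)) (2 * F w v + 2))); first by Ls.
by move=> w v; rewrite pow2cE; apply/minn_idPl/exp_lg.
Qed.

Lemma macron_le M w cap l i y s m : macron M w cap l i y s m <= maxn s cap.
Proof.
elim: m => [|m IH]; first by rewrite macron0 leq_maxl.
by rewrite macronS; apply: leq_trans (nstep_le _ _ _ _ _ _) _; rewrite geq_max IH leq_maxr.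
Qed.

Lemma L_macro M cap l i s y : L cap -> L l -> L i -> L s -> L y ->
  L (fun w v => macro M w (cap w v) (l w v) (i w v) (s w v) (y w v)).
Proof.
move=> hcap hl hi hs hy.
apply: (@L_ext (fun w v => nrec (l w v) (s w v) (fun j z =>
   nstep M w (cap w v) (i w v * l w v + j) (nb (y w v) (l w v - 1 - j)) z))); last by [].
apply: (L_rec_le (s := fun w v j z => nstep M w (cap w v) (i w v * l w v + j) (nb (y w v) (l w v - 1 - j)) z)
  (B := fun w v => maxn (s w v) (cap w v))) => //.
- apply: L_nstep; try by Ls.
  by apply: L_nb; Ls.
- by Ls.
- by move=> w v m _; apply: macron_le.
Qed.

Lemma npair_mono a b a' b' : a <= a' -> b <= b' -> npair a b <= npair a' b'.
Proof. by move=> h1 h2; rewrite /npair leq_add // leq_mul // leq_add. Qed.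

Lemma code_mono q W P I J O C q' W' P' I' J' O' C' : q <= q' -> W <= W' -> P <= P' -> I <= I' ->
  J <= J' -> O <= O' -> C <= C' -> code q W P I J O C <= code q' W' P' I' J' O' C'.
Proof. by move=> *; rewrite /code ltnS; do 6 (apply: npair_mono => //). Qed.

(** Tapes grow only to the head positions, so in space [sp] their values in base [tm_g M + 2] or 2
    stay below the larger base to the power [sp]. The choice head is not part of the space and is
    bounded by [cb]. *)
Lemma ccode_bound M w u sp cb : (forall t, cspace M (run M w u t) <= sp) ->
  (forall t, c_cpos (run M w u t) <= cb) ->
  let Y := (tm_q M).+1 + (tm_g M).+2 ^ sp + cb in
  forall t, ccode false (run M w u t) <= code Y Y Y Y Y Y Y.
Proof.
move=> hsp hcb Y t.
have [sw si] : size (c_work (run M w u t)) <= sp /\ size (c_index (run M w u t)) <= sp.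
  elim: t => [|t [IH1 IH2]] //.
  rewrite -[run M w u t.+1]/(step M w u (run M w u t)) /step; case: ifP => // _.
  case: (tm_delta _ _ _ _ _) => [[[[[[q' g'] mw] b'] mi] mc] o] /=.
  have := hsp t; rewrite /cspace !size_set_nth !geq_max => h.
  by split; apply/andP; split=> //; lia.
have := hsp t; have := hcb t; move: (run M w u t) sw si => c sw si hc hs.
have e1 : 2 ^ sp <= (tm_g M).+2 ^ sp by case: (sp) => // s; rewrite leq_exp2r.
rewrite /cspace in hs.
apply: code_mono; rewrite /Y.
- have := ltn_ord (c_state c); lia.
- have h := @tval_lt (tm_g M).+2 (map val (c_work c)).
  have {}h := h ltac:(by apply/allP => _ /mapP[x _ ->]; rewrite ltnW // ltnS ltn_ord).
  have : (tm_g M).+2 ^ size (map val (c_work c)) <= (tm_g M).+2 ^ sp by rewrite leq_exp2l // size_map.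
  lia.
- have : (tm_g M).+2 ^ c_wpos c <= (tm_g M).+2 ^ sp by rewrite leq_exp2l //; lia.
  lia.
- rewrite bin_val_tval; have h := @tval_lt 2 (map nat_of_bool (c_index c)).
  have {}h := h ltac:(by apply/allP => _ /mapP[[] _ ->]).
  have : 2 ^ size (map nat_of_bool (c_index c)) <= 2 ^ sp by rewrite leq_exp2l // size_map.
  lia.
- have : 2 ^ c_ipos c <= 2 ^ sp by rewrite leq_exp2l //; lia.
  lia.
- by [].
- lia.
Qed.

Ltac Lx4 ::= lazymatch goal with
  | |- L (fun w v => nat_of_bool (nb (@?A w v) (@?B w v))) => apply (@L_nb A B)
  | |- L (fun w v => lg (@?A w v)) => apply (@L_lg A)
  | |- L (fun w v => 2 ^ lg (@?A w v)) => apply (@L_exp_lg A)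
  | |- L (fun w v => npair (@?A w v) (@?B w v)) => apply (@L_npair A B)
  | |- L (fun w v => macro ?M w (@?A w v) (@?B w v) (@?C w v) (@?D w v) (@?E w v)) => apply (@L_macro M A B C D E)
  | |- L (fun w v => sinit ?M w (@?A w v)) => apply (@L_sinit M A)
  | |- L (fun w v => nat_of_bool (nacc ?M (@?A w v))) => apply (@L_nacc M A)
  end.

Section LNGraph.
Variable M : TM.

Definition mac w cap l := fun i s y => macro M w cap l i s y.

Lemma L_gedge b S Lp cap l A C : L b -> L S -> L Lp -> L cap -> L l -> L A -> L C ->
  LB (fun w v => gedge (b w v) (S w v) (Lp w v) (mac w (cap w v) (l w v)) (A w v) (C w v)).
Proof. by move=> hb hS hLp hc hl hA hC; rewrite /gedge /garc /mac /vi /vs /vy /gN; Ls. Qed.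

Lemma L_gcol b S Lp s0 I A : L b -> L S -> L Lp -> L s0 -> L I -> L A ->
  LB (fun w v => gcol (b w v) (S w v) (Lp w v) (s0 w v) (nacc M) (I w v) (A w v)).
Proof. by move=> hb hS hLp hs hI hA; rewrite /gcol /vi /vs /vy /gN; Ls. Qed.

Variables (b S Lp s0 cap l : seq isym -> seq nat -> nat).
Hypotheses (hb : L b) (hS : L S) (hLp : L Lp) (hs0 : L s0) (hcap : L cap) (hl : L l).

Notation ge w u A C := (gedge (b w u) (S w u) (Lp w u) (mac w (cap w u) (l w u)) A C).
Notation gc w u I A := (gcol (b w u) (S w u) (Lp w u) (s0 w u) (nacc M) I A).
Notation gn w u := (gN (b w u) (S w u) (Lp w u)).

Lemma LN_graph : LN (fun w v => graph_nums (b w v) (S w v) (Lp w v) (s0 w v)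
  (mac w (cap w v) (l w v)) (nacc M)).
Proof.
have hN : L (fun w v => gn w v) by rewrite /gN; Ls.
have hN1 := L_dropn 1 hN; have hN2 := L_dropn 2 hN.
have he : LB (fun w v => ge w (behead (behead v)) (nth 0 v 1) (nth 0 v 0)).
  by apply: (L_gedge (b := fun w v => b w (behead (behead v))) (S := fun w v => S w (behead (behead v)))
    (Lp := fun w v => Lp w (behead (behead v))) (cap := fun w v => cap w (behead (behead v)))
    (l := fun w v => l w (behead (behead v)))); Ls.
have hc : LB (fun w v => gc w (behead (behead v)) (nth 0 v 1) (nth 0 v 0)).
  by apply: (L_gcol (b := fun w v => b w (behead (behead v))) (S := fun w v => S w (behead (behead v)))
    (Lp := fun w v => Lp w (behead (behead v))) (s0 := fun w v => s0 w (behead (behead v)))); Ls.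
rewrite /graph_nums.
apply: LN_cat.
  apply: LN_cons; first by Ls. apply: LN_cons; first by Ls.
  apply: (@LN_for _ (fun w v i => [:: 1])); first by Ls.
  by apply: LN_num; Ls.
apply: LN_cat.
  apply: LN_cons; first by Ls. apply: LN_cons; first by Ls.
  apply: LN_cat.
    apply: (@LN_for _ (fun w v i => [:: i; i.+1; i.+1; i])) => //.
    by do 4 (apply: LN_cons; first by Ls); apply: LN_nil.
  apply: (@LN_for _ (fun w v i => [:: 1; i])); first by Ls.
  by do 2 (apply: LN_cons; first by Ls); apply: LN_nil.
apply: LN_cons; first by apply: L_succ; apply: L_succ.
apply: LN_cons; first exact: L_mul.
apply: LN_cat.
  apply: (@LN_for _ (fun w v a => flatten [seq [:: nif (ge w v a c) a (gn w v).+1;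
     nif (ge w v a c) c (gn w v).+1] | c <- iota 0 (gn w v)])) => //.
  apply: (@LN_for _ (fun w v c => [:: nif (ge w (behead v) (nth 0 v 0) c) (nth 0 v 0) (gn w (behead v)).+1;
     nif (ge w (behead v) (nth 0 v 0) c) c (gn w (behead v)).+1])) => //.
  apply: LN_cons; last apply: LN_num.
    apply: (@L_ext (fun w v => nif (ge w (behead (behead v)) (nth 0 v 1) (nth 0 v 0)) (nth 0 v 1) (gn w (behead (behead v))).+1)).
      by apply: (L_if he); [exact: L_var|exact: L_succ hN2].
    by move=> w v; rewrite nth_behead.
  apply: (@L_ext (fun w v => nif (ge w (behead (behead v)) (nth 0 v 1) (nth 0 v 0)) (nth 0 v 0) (gn w (behead (behead v))).+1)).
    by apply: (L_if he); [exact: L_var|exact: L_succ hN2].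
  by move=> w v; rewrite nth_behead.
apply: (@LN_for _ (fun w v i => gn w v :: flatten [seq [:: nif (gc w v i a) a (gn w v)] | a <- iota 0 (gn w v)])).
  exact: L_succ.
apply: LN_cons => //.
apply: (@LN_for _ (fun w v a => [:: nif (gc w (behead v) (nth 0 v 0) a) a (gn w (behead v))])) => //.
apply: LN_num.
apply: (@L_ext (fun w v => nif (gc w (behead (behead v)) (nth 0 v 1) (nth 0 v 0)) (nth 0 v 0) (gn w (behead (behead v))))).
  by apply: (L_if hc); [exact: L_var|exact: hN2].
by move=> w v; rewrite nth_behead.
Qed.

End LNGraph.

(** * Hardness *)

Section Hard.
Variables (F : seq bool -> nat -> nat) (M : TM).
Variables (f1 f2 : nat -> nat) (c0 : nat).
Hypotheses (cf1 : computable f1) (cf2 : computable f2).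
Hypothesis hsp : forall x k ch t, cspace M (run M (input_word x k) ch t) <= c0 * lg (size x) + f1 k.
Hypothesis hcp : forall x k ch t, c_cpos (run M (input_word x k) ch t) <= f2 k * lg (size x).
Hypotheses (ro : read_once M) (hF : counts_acc M F).

Theorem hardness : plog_pars_red F p_hom_Pstar.
Proof.
have [ok1 [v1 [hok1 hv1 ok1E ok1ex]]] := computable_sim cf1.
have [ok2 [v2 [hok2 hv2 ok2E ok2ex]]] := computable_sim cf2.
(* The tape base is at most [2 ^ a], so in space [c0 * lg |x| + f1 k] tape values are at most
   [(2 |x| + 2) ^ (a * c0) * 2 ^ (a * f1 k)]. *)
pose a := tm_g M + 2.
have aP : (tm_g M).+2 <= 2 ^ a by rewrite /a; apply: ltnW; rewrite -addn2 ltn_expl.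
(* [T] must certify both simulations, dominate [2 ^ (a * f1 k)] and bound the query parameter
   [f2 k + 2]. Clamping the power at [T + 1] leaves its comparison with [T] unchanged. *)
pose h T k := [&& ok1 T k, ok2 T k, pow2c (a * v1 T k) T.+1 <= T & v2 T k + 2 <= T].
have hL : LB (fun w v => h (nth 0 v 0) (nth 0 v 1)).
  by rewrite /h; repeat (apply: L_and => //); Ls.
have hex k : exists T, h T k.
  have [T1 h1] := ok1ex k; have [T2 h2] := ok2ex k.
  exists (T1 + T2 + 2 ^ (a * f1 k) + f2 k + 2); rewrite /h; set T := _ + 2.
  have o1 : ok1 T k by apply: h1; rewrite /T; lia.
  have o2 : ok2 T k by apply: h2; rewrite /T; lia.
  rewrite o1 o2 (ok1E _ _ o1) (ok2E _ _ o2) pow2cE /=; apply/andP; split; last by rewrite /T; lia.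
  by rewrite geq_min; apply/orP; left; rewrite /T; lia.
have hTP T k : h T k -> 2 ^ (a * f1 k) <= T /\ v2 T k = f2 k /\ f2 k + 2 <= T.
  case/and4P=> o1 o2; rewrite (ok1E _ _ o1) (ok2E _ _ o2) pow2cE geq_min ltnn orbF => h1 h2.
  by [].
(* The successor keeps the path at two or more vertices when [f2 k = 0]. *)
pose b (w : seq isym) (v : seq nat) := (v2 (nth 0 v 0) (nth 0 v 1)).+1.
pose n (w : seq isym) (v : seq nat) := nth 0 v 2.
(* The summands dominate those of [ccode_bound]: the states, the tape values, and the choice head
   position [f2 k * lg |x|], the latter by [f2 k <= T]. *)
pose Y (w : seq isym) (v : seq nat) := (tm_q M).+1 + (2 * n w v + 2) ^ (a * c0) * nth 0 v 0 + nth 0 v 0 * (2 * n w v + 2).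
pose cap (w : seq isym) (v : seq nat) := code (Y w v) (Y w v) (Y w v) (Y w v) (Y w v) (Y w v) (Y w v).
pose l (w : seq isym) (v : seq nat) := lg (n w v).
pose Lp (w : seq isym) (v : seq nat) := 2 ^ lg (n w v).
pose S (w : seq isym) (v : seq nat) := (cap w v).+1.
pose s0 (w : seq isym) (v : seq nat) := sinit M w (cap w v).
have hb : L b by apply: L_succ.
have hn : L n by exact: L_var.
have hY : L Y by rewrite /Y; Ls.
have hcap : L cap by rewrite /cap /code; apply: L_succ; do 6 (apply: L_npair => //).
have hl : L l by exact: L_lg.
have hLp : L Lp by exact: L_exp_lg.
have hS : L S by exact: L_succ.
have hs0 : L s0 by exact: L_sinit.
have hQ := LE_cat (LN_graph M hb hS hLp hs0 hcap hl) (LE_cat (LE_out None) (LE_unary true (L_succ hb))).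
have [R [C [Rdet hR]]] := red_machine (h := fun T k _ => h T k) hL hQ.
exists R; split=> //.
  apply: (@paraL_intro h hL hex R C) => x k ch t.
  have [_ [_ _ hs]] := hR x k ch _ (TminP hex k) (@Tmin_min _ hex k).
  by have := hs t; rewrite addnA.
exists (Tmin hex); split; first by apply: (computable_L hL hex (phi := fun T k => T)); exact: L_var.
move=> x k; set T := Tmin hex k; set w := input_word x k.
have hT : h T k by exact: TminP.
have [t [h1 h2 _]] := hR x k (fun=> false) T hT (@Tmin_min _ hex k).
have [T1 [T2 T3]] := hTP _ _ hT.
pose v := [:: T; k; size x].
exists t, (enc (graph_nums (b w v) (S w v) (Lp w v) (s0 w v) (mac M w (cap w v) (l w v)) (nacc M))), (b w v).+1.
split=> //.
  by rewrite /b /= T2; lia.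
have eb : b w v = (f2 k).+1 by rewrite /b /= T2.
have b_gt0 : 0 < b w v by [].
rewrite graph_numsE // p_hom_enc //; first last.
- exact: pathA_Pstar.
- exact: wf_graphB.
- exact: wf_pathA.
have hcapb u t' : ccode false (run M w u t') <= cap w v.
  have hb0 := @ccode_bound M w u (c0 * lg (size x) + f1 k) (f2 k * lg (size x)) (hsp x k u) (hcp x k u) t'.
  apply: leq_trans hb0 _; set Y0 := _ + _ + _; have YY : Y0 <= Y w v.
    rewrite /Y0 /Y /n /= -/(lg _); apply: leq_add; first apply: leq_add => //.
      have e1 : (tm_g M).+2 ^ (c0 * lg (size x) + f1 k) <= 2 ^ (a * (c0 * lg (size x) + f1 k)).
        by rewrite expnM; case: (_ + f1 k) => // m; rewrite leq_exp2r.
      apply: leq_trans e1 _; rewrite mulnDr expnD; apply: leq_mul => //.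
      rewrite mulnA mulnC expnM; have := exp_lg (size x).
      by case: (a * c0) => // m hm; rewrite leq_exp2r.
    have : lg (size x) <= 2 ^ lg (size x) by apply: ltnW; apply: ltn_expl.
    have := exp_lg (size x); move: T3; nia.
  by apply: code_mono.
rewrite nhom_graph //; first last.
- by rewrite /Lp expn_gt0.
- move=> i s y; rewrite /S !ltnS => hs; apply: leq_trans (macron_le _ _ _ _ _ _ _ _) _.
  by rewrite geq_max hs leqnn.
- by rewrite /S /s0 ltnS; apply: sinit_le.
rewrite (count_srun (b := b w v) (l := l w v) (cap := cap w v) ro hF) //; last first.
  move=> u t'; apply: leq_trans (hcp x k u t') _; rewrite eb /l /n /=; apply: leq_mul => //.
by apply: eq_card => g; rewrite !inE srun_macro.
Qed.
End Hard.

(** * Parsing by index arithmetic *)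

Lemma dec_natsP acc x s : dec_nats acc x = Some s -> nseq acc true ++ x = enc s.
Proof.
elim: x acc s => [|[] x IH] acc s /=.
- by case: acc => //= -[<-].
- by move/IH => <-; elim: acc {IH} => //= acc ->.
- case E: (dec_nats 0 x) => [s'|] //= [<-].
  by rewrite /enc /= -/(enc s') -(IH _ _ E) -cats1 -catA.
Qed.

Lemma dec_nats_isSome acc x : isSome (dec_nats acc x) = ~~ last (acc != 0) x.
Proof.
elim: x acc => [|[] x IH] acc /=; first by case: acc.
- by rewrite IH.
- by rewrite -[last false x]/(last (0 != 0) x) -IH; case: dec_nats.
Qed.

Definition zeros (c : nat -> bool) p := nsum p (fun q => ~~ c q).
(** In [1^n1 0 1^n2 0 ...] the entry with index [j] is the number of ones preceded by exactly [j]
    zeros; this gives random access to the encoded list. *)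
Definition numf (c : nat -> bool) n j := nsum n (fun p => c p && (zeros c p == j)).

Lemma nsumSl n f : nsum n.+1 f = f 0 + nsum n (fun i => f i.+1).
Proof. by rewrite /nsum big_nat_recl. Qed.

Lemma eq_nsum n f g : (forall i, i < n -> f i = g i) -> nsum n f = nsum n g.
Proof. by move=> h; apply: eq_big_nat => i /andP[_ /h]. Qed.

Lemma zerosS c p : zeros c p.+1 = ~~ c 0 + zeros (fun q => c q.+1) p.
Proof. by rewrite /zeros nsumSl. Qed.

Lemma numf_true y n j : numf (nth false (true :: y)) n.+1 j = (j == 0) + numf (nth false y) n j.
Proof.
rewrite /numf nsumSl /= eq_sym; congr (_ + _); first by rewrite /zeros /nsum big_geq.
by apply: eq_nsum => i _ /=; rewrite zerosS /= add0n.
Qed.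

Lemma numf_false y n j : numf (nth false (false :: y)) n.+1 j =
  if j is j'.+1 then numf (nth false y) n j' else 0.
Proof.
rewrite /numf nsumSl /= add0n; case: j => [|j].
  by rewrite (eq_nsum (g := fun=> 0)) ?/nsum ?big1 // => i _; rewrite zerosS andbF.
by apply: eq_nsum => i _; rewrite zerosS /= add1n eqSS.
Qed.

Lemma numf_enc s j : numf (nth false (enc s)) (size (enc s)) j = nth 0 s j.
Proof.
elim: s j => [|m s IH] j; first by rewrite nth_nil /numf /nsum big_geq.
have -> : enc (m :: s) = nseq m true ++ false :: enc s by rewrite /enc /= -cats1 -catA.
elim: m => [|m IHm] /=; first by rewrite numf_false; case: j.
by rewrite numf_true IHm {IHm}; case: j.
Qed.

Lemma zeros_enc s : zeros (nth false (enc s)) (size (enc s)) = size s.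
Proof.
elim: s => [|m s IH]; first by rewrite /zeros /nsum big_geq.
have -> : enc (m :: s) = nseq m true ++ false :: enc s by rewrite /enc /= -cats1 -catA.
by elim: m => [|m IHm] /=; rewrite zerosS ?IH ?IHm.
Qed.

Definition zc w p := nsum p (fun q => inp w q == 0).
Definition elt w n j := nsum n (fun p => (inp w p == 1) && (zc w p == j)).
(** Decoding fails only on a last run of ones that no zero closes. *)
Definition okdec w n := (n == 0) || (inp w n.-1 == 0).

Lemma zcE x k p : p <= size x -> zc (input_word x k) p = zeros (nth false x) p.
Proof.
move=> hp; apply: eq_nsum => i hi; rewrite inp_x ?(leq_trans hi) //; by case: (nth _ _ _).
Qed.

Lemma eltE x k j : elt (input_word x k) (size x) j = numf (nth false x) (size x) j.
Proof.
apply: eq_nsum => i hi; rewrite zcE ?(ltnW hi) // inp_x //; by case: (nth _ _ _).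
Qed.

Lemma okdecE x k : okdec (input_word x k) (size x) = isSome (dec_nats 0 x).
Proof.
rewrite dec_nats_isSome /okdec; case: (posnP (size x)) => n0; first by case: x n0.
by rewrite inp_x ?nth_last //; [case: (last _ _)|lia].
Qed.

Lemma dec_spec x k s : dec_nats 0 x = Some s ->
  (forall j, elt (input_word x k) (size x) j = nth 0 s j) /\ zc (input_word x k) (size x) = size s.
Proof.
move=> /dec_natsP /= xs; split=> [j|]; first by rewrite eltE xs numf_enc.
by rewrite zcE // xs zeros_enc.
Qed.

Section Parse.
Variables (e : nat -> nat) (len : nat).

Definition pr := e 0.
Definition ptau i := e i.+1.
(* Offset of the [i]-th relation; [len + 1] is the absorbing value for overflow. *)
Definition poff (tau : nat -> nat) o i :=
  nrec i o (fun i o => nif (o + 1 + e o * tau i <= len) (o + 1 + e o * tau i) len.+1).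
Definition prel o ar : seq (seq nat) := mkseq (fun j => mkseq (fun c => e (o + 1 + j * ar + c)) ar) (e o).

Definition pA := pr.+1.
Definition pnA := e pA.
Definition offA i := poff ptau pA.+1 i.
Definition pB := offA pr.
Definition pnB := e pB.
Definition offB i := poff ptau pB.+1 i.
Definition parse_ok := [&& 0 < len, pr < len, pA < len, pB < len & offB pr == len].

Definition ptaul := mkseq ptau pr.
Definition pstA := Struct pnA (mkseq (fun i => prel (offA i) (ptau i)) pr).
Definition pstB := Struct pnB (mkseq (fun i => prel (offB i) (ptau i)) pr).

Variable s : seq nat.
Hypotheses (es : forall j, e j = nth 0 s j) (ls : len = size s).

Lemma nrecSl n a f : nrec n.+1 a f = nrec n (f 0 a) (fun i => f i.+1).
Proof. by rewrite /nrec; elim: n => //= n ->. Qed.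

Lemma poffSl tau o i : poff tau o i.+1 =
  poff (fun i => tau i.+1) (nif (o + 1 + e o * tau 0 <= len) (o + 1 + e o * tau 0) len.+1) i.
Proof. exact: nrecSl. Qed.

Lemma poff_stuck tau o i : len < o -> len < poff tau o i.
Proof.
move=> h; elim: i => [|i IH] //; rewrite /poff /nrec /= -/(nrec i _ _) -/(poff tau o i) /nif.
by have -> : poff tau o i + 1 + e (poff tau o i) * tau i <= len = false by lia.
Qed.

Lemma split_drop o m : o <= size s -> split_at m (drop o s) =
  if o + m <= size s then Some (take m (drop o s), drop (o + m) s) else None.
Proof.
move=> ho; rewrite /split_at size_drop drop_drop (addnC m o).
by have -> : (m <= size s - o) = (o + m <= size s) by lia.
Qed.

Lemma reshape_drop o m ar : o + m * ar <= size s ->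
  reshape (nseq m ar) (take (m * ar) (drop o s)) = mkseq (fun j => mkseq (fun c => e (o + j * ar + c)) ar) m.
Proof.
elim: m o => [|m IH] o h; first by [].
have hh : o + ar <= size s by rewrite mulSn in h; lia.
rewrite /= mulSn take_takel ?leq_addr // [ar + m * ar]addnC -take_drop drop_drop addnC IH; last first.
  by rewrite mulSn in h; lia.
rewrite /mkseq /= -[in RHS](addn0 1) iotaDl -map_comp; congr (_ :: _).
  have st : size (take ar (drop o s)) = ar by rewrite size_takel // size_drop; lia.
  apply: (@eq_from_nth _ 0); rewrite st ?size_map ?size_iota //.
  move=> c hc; rewrite nth_take // nth_drop (nth_map 0) ?size_iota // nth_iota // es.
  by rewrite mul0n addn0 add0n.
apply: eq_map => j /=; apply: eq_map => c; congr e; lia.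
Qed.

Lemma parse_rel_drop o ar : o <= size s -> parse_rel ar (drop o s) =
  if o + 1 + e o * ar <= size s then Some (prel o ar, drop (o + 1 + e o * ar) s) else None.
Proof.
rewrite leq_eqVlt => /orP[/eqP ->|ho].
  by rewrite drop_size /=; have -> : size s + 1 + e (size s) * ar <= size s = false by lia.
rewrite (drop_nth 0 ho) /parse_rel -es split_drop // addn1.
case: ifP => // h; congr (Some (_, _)).
by rewrite reshape_drop // /prel addn1.
Qed.

Lemma parse_rels_drop tau o : o <= size s -> parse_rels tau (drop o s) =
  if poff (nth 0 tau) o (size tau) <= size s then
    Some (mkseq (fun i => prel (poff (nth 0 tau) o i) (nth 0 tau i)) (size tau),
          drop (poff (nth 0 tau) o (size tau)) s) else None.
Proof.
elim: tau o => [|a tau IH] o ho; first by rewrite /= /poff /nrec /= ho.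
rewrite [parse_rels _ _]/= parse_rel_drop // [size _]/= poffSl [nth 0 _ 0]/= ls /nif.
case: ifP => h; last first.
  by have := @poff_stuck (fun i => nth 0 (a :: tau) i.+1) (size s).+1 (size tau); rewrite ls => /(_ (ltnSn _)); case: leqP.
rewrite IH // -[(fun i => nth 0 (a :: tau) i.+1)]/(nth 0 tau); case: ifP => // h'.
congr (Some (_, _)); rewrite /mkseq /= -[in RHS](addn0 1) iotaDl -map_comp; congr (_ :: _).
apply: eq_map => i; rewrite -[RHS]/(prel (poff (nth 0 (a :: tau)) o i.+1) (nth 0 tau i)).
by rewrite poffSl [nth 0 _ 0]/= ls /nif h.
Qed.

Lemma poff_ext tau tau' o i : (forall j, j < i -> tau j = tau' j) -> poff tau o i = poff tau' o i.
Proof.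
rewrite /poff /nrec; elim: i => [|i IH] h; first by [].
by rewrite /= IH ?h // => j hj; apply: h; lia.
Qed.

Lemma parse_rels_tau o : o <= size s -> parse_rels ptaul (drop o s) =
  if poff ptau o pr <= size s then
    Some (mkseq (fun i => prel (poff ptau o i) (ptau i)) pr, drop (poff ptau o pr) s) else None.
Proof.
move=> ho; rewrite parse_rels_drop // size_mkseq.
have E i : i <= pr -> poff (nth 0 ptaul) o i = poff ptau o i.
  by move=> hi; apply: poff_ext => j hj; rewrite nth_mkseq // (leq_trans hj).
rewrite E //; case: ifP => // _; congr (Some (_, _)).
apply/eq_in_map => i; rewrite mem_iota add0n /= => hi.
by rewrite E ?(ltnW hi) // nth_mkseq.
Qed.

Lemma parse_struct_drop o : o <= size s -> parse_struct ptaul (drop o s) =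
  if (o < size s) && (poff ptau o.+1 pr <= size s) then
    Some (Struct (e o) (mkseq (fun i => prel (poff ptau o.+1 i) (ptau i)) pr), drop (poff ptau o.+1 pr) s) else None.
Proof.
rewrite leq_eqVlt => /orP[/eqP ->|ho]; first by rewrite drop_size ltnn.
by rewrite (drop_nth 0 ho) /parse_struct -es parse_rels_tau // ho; case: ifP.
Qed.

Local Arguments parse_struct : simpl never.

(** The parser consumes a list; here everything is addressed by offsets, so that the parts of the
    instance become functions in [L]. As overflow is absorbing, comparing the final offset of a
    structure with the length catches every failure inside it. *)
Lemma parse_instance_spec : parse_instance s =
  if parse_ok then Some (ptaul, pstA, pstB) else None.
Proof.
rewrite /parse_ok ls; case: (posnP (size s)) => s0.
  by move: s0; case: (s).
rewrite -{1}[s]drop0 (drop_nth 0 s0) /parse_instance split_drop // add1n -es -/pr.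
have [prs|] := ltnP pr (size s); last by [].
rewrite (_ : take pr (drop 1 s) = ptaul); last first.
  apply: (@eq_from_nth _ 0); first by rewrite size_takel ?size_mkseq // size_drop; lia.
  move=> i; rewrite size_takel ?size_drop; last lia.
  by move=> hi; rewrite nth_take // nth_drop nth_mkseq // /ptau es add1n.
rewrite parse_struct_drop // -/pA -/(offA pr) -/pB.
case: (ltnP pA (size s)) => hA; last by [].
have [hB|hB] := leqP pB (size s); last by rewrite ltnNge (ltnW hB).
rewrite /= parse_struct_drop // -/(offB pr).
case: (ltnP pB (size s)) => hB'; last by [].
case: (ltngtP (offB pr) (size s)) => h //.
  by rewrite (drop_nth 0 h).
by rewrite h drop_size.
Qed.

Lemma rel_pstA i : i < pr -> rel_of pstA i = prel (offA i) (ptau i).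
Proof. by move=> hi; rewrite /rel_of nth_mkseq. Qed.

Lemma rel_pstB i : i < pr -> rel_of pstB i = prel (offB i) (ptau i).
Proof. by move=> hi; rewrite /rel_of nth_mkseq. Qed.

End Parse.

Lemma nexP n (p : nat -> bool) : reflect (exists2 i, i < n & p i) (nex n p).
Proof.
apply: (iffP hasP) => [[i]|[i hi pi]]; last by exists i; rewrite ?mem_iota.
by rewrite mem_iota add0n /= => hi pi; exists i.
Qed.

Lemma nallP n (p : nat -> bool) : reflect (forall i, i < n -> p i) (nall n p).
Proof.
apply: (iffP allP) => h i; last by rewrite mem_iota add0n /=; apply: h.
by move=> hi; apply: h; rewrite mem_iota.
Qed.

Lemma nallS n (p : nat -> bool) : nall n.+1 p = nall n p && p n.
Proof. by rewrite /nall -addn1 iotaD all_cat /= andbT. Qed.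

Lemma nmu_lt n (p : nat -> bool) : nex n p -> nmu n p < n /\ p (nmu n p).
Proof.
rewrite /nex => h; have lt : nmu n p < n by rewrite -{2}(size_iota 0 n) -has_find.
by split=> //; have := nth_find 0 h; rewrite nth_iota.
Qed.

Lemma nmu_le n (p : nat -> bool) : nmu n p <= n.
Proof. by rewrite -{2}(size_iota 0 n) find_size. Qed.

Lemma nmu_uniq n (p : nat -> bool) b : b < n -> p b -> (forall c, c < n -> p c -> c = b) -> nmu n p = b.
Proof.
move=> hb pb hu; have [h1 h2] : nmu n p < n /\ p (nmu n p) by apply: nmu_lt; apply/nexP; exists b.
exact: hu.
Qed.

(** * Starred paths *)

Section PathRec.
Variables (n : nat) (E : nat -> nat -> bool).

(* The pair (previous vertex, current vertex) after [i] steps; [n] means no previous vertex. *)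
Definition wks a0 i :=
  nrec i (npair n a0) (fun _ z => npair (nsnd z) (nmu n (fun c => E (nsnd z) c && (c != nfst z)))).
Definition wk a0 i := nsnd (wks a0 i).
Definition wk_inj a0 := nall n (fun i => (wk a0 i < n) && nall i (fun j => wk a0 i != wk a0 j)).

Lemma wk_injP a0 : wk_inj a0 -> (forall i, i < n -> wk a0 i < n) /\
  (forall i j, i < n -> j < n -> wk a0 i = wk a0 j -> i = j).
Proof.
move/nallP => h; split=> [i /h /andP[]//|i j hi hj e].
have := h _ hi => /andP[_ /nallP h1]; have := h _ hj => /andP[_ /nallP h2].
by case: (ltngtP i j) => // [/h2|/h1]; rewrite e eqxx.
Qed.

Lemma mem_path_edges sg x y : reflect (exists2 i, i < n.-1 & (x = sg i /\ y = sg i.+1) \/ (x = sg i.+1 /\ y = sg i))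
  ([:: x; y] \in path_edges n sg).
Proof.
apply: (iffP flattenP) => [[l /mapP[i]]|[i hi h]].
  by rewrite mem_iota add0n /= => hi ->; rewrite !inE => /orP[/eqP[-> ->]|/eqP[-> ->]]; exists i; auto.
exists [:: [:: sg i; sg i.+1]; [:: sg i.+1; sg i]]; first by apply/mapP; exists i; rewrite ?mem_iota.
by case: h => -[-> ->]; rewrite !inE eqxx ?orbT.
Qed.

Lemma wksS a0 i : wks a0 i.+1 =
  npair (wk a0 i) (nmu n (fun c => E (wk a0 i) c && (c != nfst (wks a0 i)))).
Proof. by []. Qed.

Lemma walk_sg (S : nat -> nat) : (forall i, i < n -> S i < n) ->
  (forall i j, i < n -> j < n -> S i = S j -> i = j) ->
  (forall x y, E x y = ([:: x; y] \in path_edges n S)) ->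
  forall i, i < n -> wks (S 0) i = npair (if i is j.+1 then S j else n) (S i).
Proof.
move=> hlt hinj hE; elim=> [|i IH] hi //.
have hi' : i < n by lia.
have ew : wk (S 0) i = S i by rewrite /wk IH // nsnd_pair.
rewrite wksS ew IH // nfst_pair; congr npair; apply: nmu_uniq; first exact: hlt.
  apply/andP; split.
    by rewrite hE; apply/mem_path_edges; exists i; [lia|left].
  case: i hi hi' {IH ew} => [|i] hi hi'; first by have := hlt _ hi; lia.
  by apply/negP => /eqP /hinj; lia.
move=> c hc /andP[]; rewrite hE => /mem_path_edges[j hj [[e ->]|[e ->]]] hne.
  by rewrite (hinj i j) //; lia.
have ij : i = j.+1 by apply: hinj => //; lia.
by move: hne; rewrite ij eqxx.
Qed.
End PathRec.

Definition is_path n (RE : seq (seq nat)) a0 :=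
  let E a b := [:: a; b] \in RE in
  wk_inj n E a0 && same_set RE (path_edges n (wk n E a0)).

Lemma path_edges_ext n sg sg' : (forall i, i < n -> sg i = sg' i) -> path_edges n sg = path_edges n sg'.
Proof.
move=> h; congr flatten; apply/eq_in_map => i; rewrite mem_iota add0n /= => hi.
by rewrite !h //; lia.
Qed.

(** A permutation does not fit into logarithmic space, but an isomorphism from a path is determined
    by the image of its first vertex; [is_path] checks a candidate by walking. *)
Lemma path_rec n RE : 1 < n ->
  [exists sg : {ffun 'I_n -> 'I_n}, injectiveb sg && same_set RE (path_edges n (ext_map sg))] =
  nex n (is_path n RE).
Proof.
move=> n1; apply/existsP/nexP => [[sg /andP[/injectiveP inj /andP[/allP h1 /allP h2]]]|[a0 ha /andP[hi hs]]].
  pose S := ext_map sg; pose E a b := [:: a; b] \in RE.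
  have hlt i : i < n -> S i < n by move=> hi; rewrite /S (ext_map_ord _ hi).
  have hinj i j : i < n -> j < n -> S i = S j -> i = j.
    move=> hi hj; rewrite /S (ext_map_ord _ hi) (ext_map_ord _ hj) => /val_inj/inj e.
    by have := congr1 val e.
  have hE x y : E x y = ([:: x; y] \in path_edges n S) by apply/idP/idP => [/h1|/h2].
  have hw := walk_sg hlt hinj hE.
  have ew i : i < n -> wk n E (S 0) i = S i by move=> hi; rewrite /wk hw // nsnd_pair.
  exists (S 0); first by apply: hlt; lia.
  apply/andP; split.
    apply/nallP => i hi; rewrite ew // hlt //=; apply/nallP => j hj.
    by rewrite ew ?(ltn_trans hj) //; apply/eqP => /hinj; lia.
  by rewrite (path_edges_ext ew); apply/andP; split; apply/allP.
have [hlt hinj] := wk_injP hi.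
exists [ffun i : 'I_n => Ordinal (hlt i (ltn_ord i))]; apply/andP; split.
  by apply/injectiveP => i j; rewrite !ffunE => /(congr1 val) /= /hinj h; apply: val_inj; apply: h.
by rewrite (path_edges_ext (sg' := wk n (fun a b => [:: a; b] \in RE) a0)) // => i hi'; rewrite (ext_map_ord _ hi') ffunE.
Qed.

Section Pstar.
Variables (tau : seq nat) (A : structure).
Notation r := (size tau).
Notation n := (sdom A).

Definition colP ei a i := [&& i != ei, nth 0 tau i == 1 & same_set (rel_of A i) [:: [:: a]]].
Definition eP ei := [&& nth 0 tau ei == 2, nex n (is_path n (rel_of A ei)) & nall n (fun a => nex r (colP ei a))].

(** Relations that are different singletons have different symbols, so picking the first color of
    each element is injective. *)
Lemma in_PstarE : in_Pstar tau A = [&& 1 < n, r == n.+1 & nex r eP].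
Proof.
rewrite /in_Pstar; have [n1|] := leqP 2 n => //=; case: eqP => //= er.
apply/existsP/nexP => [[e /and3P[h1 h2 h3]]|[e he /and3P[h1 h2 h3]]].
  exists e => //; rewrite /eP h1 -path_rec // h2 /=; apply/nallP => a ha.
  case/existsP: h3 => g /andP[_ /forallP /(_ (Ordinal ha)) /and3P[g1 g2 g3]].
  by apply/nexP; exists (g (Ordinal ha)) => //; rewrite /colP g1 g2 g3.
exists (Ordinal he); rewrite /= h1 path_rec // h2 /=.
have hc (a : 'I_n) : nmu r (colP e a) < r /\ colP e a (nmu r (colP e a)).
  by apply: nmu_lt; move/nallP: h3; apply.
apply/existsP; exists [ffun a : 'I_n => Ordinal (proj1 (hc a))]; apply/andP; split.
  apply/injectiveP => a a'; rewrite !ffunE => /(congr1 val) /= e'.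
  have /and3P[_ _ /andP[/allP b1 /allP b2]] := (hc a).2; have /and3P[_ _ /andP[/allP b1' /allP b2']] := (hc a').2.
  have := b2 [:: val a]; rewrite inE eqxx => /(_ isT); rewrite e' => /b1'; rewrite inE => /eqP[h].
  exact: val_inj.
by apply/forallP => a; rewrite ffunE /=; have /and3P[c1 c2 c3] := (hc a).2; rewrite c1 c2 c3.
Qed.

Variables (B : structure) (l : nat).
Hypothesis hA : in_Pstar tau A.
Hypothesis hB : sdom B <= l.

Definition ei := nmu r eP.
Definition pth0 := nmu n (is_path n (rel_of A ei)).
Definition cix a := nmu r (colP ei a).
Definition sgm := wk n (fun a b => [:: a; b] \in rel_of A ei) pth0.
Definition okst i prev y := [&& y < sdom B, [:: y] \in rel_of B (cix (sgm i)) &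
  (i == 0) || ([:: prev; y] \in rel_of B ei) && ([:: y; prev] \in rel_of B ei)].
(** State 0 means failure, and [y + 1] that the last guessed element was [y]. The start state 1 only
    has to be nonzero, as the first vertex has no predecessor to be compared with. *)
Definition stt y i s := nif (s == 0) 0 (nif (okst i s.-1 y) y.+1 0).

Let n1 : 1 < n. Proof. by move: hA; rewrite in_PstarE => /and3P[]. Qed.
Let er : r = n.+1. Proof. by move: hA; rewrite in_PstarE => /and3P[_ /eqP]. Qed.
Let eiP : ei < r /\ eP ei. Proof. by apply: nmu_lt; move: hA; rewrite in_PstarE => /and3P[]. Qed.
Let pthP : is_path n (rel_of A ei) pth0.
Proof. by have [_ /and3P[_ h _]] := eiP; have [] := nmu_lt h. Qed.
Let cixP a : a < n -> cix a < r /\ colP ei a (cix a).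
Proof. by move=> ha; have [_ /and3P[_ _ /nallP h]] := eiP; apply: nmu_lt; apply: h. Qed.
Let sg_lt i : i < n -> sgm i < n.
Proof. by case/andP: pthP => /wk_injP[h _] _; apply: h. Qed.
Let sg_inj i j : i < n -> j < n -> sgm i = sgm j -> i = j.
Proof. by case/andP: pthP => /wk_injP[_ h] _; apply: h. Qed.
Let sg_edges : same_set (rel_of A ei) (path_edges n sgm).
Proof. by case/andP: pthP. Qed.

Let cix_mem a t : a < n -> (t \in rel_of A (cix a)) = (t == [:: a]).
Proof.
move=> ha; have [_ /and3P[_ _ /andP[/allP h1 /allP h2]]] := cixP ha.
by apply/idP/eqP => [/h1|->]; [rewrite inE => /eqP|apply: h2; rewrite inE].
Qed.

(** The [n] elements have distinct colors among the [r - 1 = n] symbols other than [ei], so every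
    symbol is accounted for: a homomorphism has to respect edges and these colors, nothing else. *)
Let cix_onto i : i < r -> i != ei -> exists2 a, a < n & i = cix a.
Proof.
move=> hi ne; pose c (a : 'I_n) : 'I_r := Ordinal (proj1 (cixP (ltn_ord a))).
have cinj : injective c.
  move=> a a' /(congr1 val) /= e; apply: val_inj.
  have := cix_mem [:: val a] (ltn_ord a); rewrite eqxx e cix_mem // => /eqP[].
  by [].
pose D := [set~ Ordinal eiP.1].
have sub : [set c a | a : 'I_n] \subset D.
  apply/subsetP => _ /imsetP[a _ ->]; rewrite !inE.
  have [_ /and3P[h _ _]] := cixP (ltn_ord a); by rewrite -val_eqE.
have cd : #|D| <= #|[set c a | a : 'I_n]|.
  by rewrite card_imset // card_ord cardsC1 card_ord er.
have /eqP eD : [set c a | a : 'I_n] == D by rewrite eqEcard sub cd.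
have : Ordinal hi \in D by rewrite !inE -val_eqE.
by rewrite -eD => /imsetP[a _ /(congr1 val) /= ->]; exists a.
Qed.

Lemma cix_sgm_lt i : i < n -> cix (sgm i) < r.
Proof. by move=> /sg_lt /cixP[]. Qed.

Lemma is_hom_path (h : {ffun 'I_n -> 'I_(sdom B)}) : is_hom tau A B h <->
  (forall i, i < n -> [:: ext_map h (sgm i)] \in rel_of B (cix (sgm i))) /\
  (forall i, i < n.-1 -> [:: ext_map h (sgm i); ext_map h (sgm i.+1)] \in rel_of B ei /\
     [:: ext_map h (sgm i.+1); ext_map h (sgm i)] \in rel_of B ei).
Proof.
have [eir _] := eiP; case/andP: sg_edges => /allP e1 /allP e2; split.
  move=> /allP hh; split=> i hi.
    have [cr _] := cixP (sg_lt hi).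
    have /hh/allP/(_ [:: sgm i]) : cix (sgm i) \in iota 0 r by rewrite mem_iota.
    by apply; rewrite cix_mem ?sg_lt.
  have /hh/allP hE : ei \in iota 0 r by rewrite mem_iota.
  have hin x y : (x = sgm i /\ y = sgm i.+1) \/ (x = sgm i.+1 /\ y = sgm i) -> [:: x; y] \in rel_of A ei.
    move=> hxy; apply: e2; apply/mem_path_edges; by exists i.
  by split; [apply: (hE [:: sgm i; sgm i.+1])|apply: (hE [:: sgm i.+1; sgm i])]; apply: hin; auto.
move=> [h1 h2]; apply/allP => i; rewrite mem_iota add0n /= => hi; apply/allP => t.
have [->|ne] := eqVneq i ei.
  move/e1 => ht; have [j hj] : exists2 j, j < n.-1 & t = [:: sgm j; sgm j.+1] \/ t = [:: sgm j.+1; sgm j].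
    move/flattenP: ht => [q /mapP[j]]; rewrite mem_iota add0n /= => hj ->.
    by rewrite !inE => /orP[/eqP->|/eqP->]; exists j; auto.
  by have [a1 a2] := h2 j hj; case=> ->.
have [a ha ->] := cix_onto hi ne; rewrite cix_mem // => /eqP -> /=.
pose so (j : 'I_n) : 'I_n := Ordinal (sg_lt (ltn_ord j)).
have so_inj : injective so by move=> j j' /(congr1 val) /= /sg_inj e; apply: val_inj; apply: e.
have [so' K1 K2] := injF_bij so_inj.
have := h1 (so' (Ordinal ha)) (ltn_ord _).
by have /(congr1 val) /= -> := K2 (Ordinal ha).
Qed.

Lemma gfold_stt u m : gfold m 1 stt u =
  if nall m (fun i => okst i (u i.-1) (u i)) then (if m is m'.+1 then (u m').+1 else 1) else 0.
Proof.
elim: m => [|m IH] //; rewrite gfoldS IH nallS.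
case: ifP => _ //=; case: m {IH} => [|m] /=; last by rewrite /stt /= /nif.
(* For [i = 0] the predecessor is 0 on one side and [u 0] on the other; the disjunct [i == 0] hides
   the difference. *)
by rewrite /stt /= /nif /okst /=; case: ifP.
Qed.

(** A homomorphism is listed in the order of the walk and its values are taken as numbers below [l];
    the test [y < sdom B] in [okst] cuts the range back to [B]. *)
Lemma nhom_gfold : nhom tau A B = #|[pred f : {ffun 'I_n -> 'I_l} | gfold n 1 stt (ext_map f) != 0]|.
Proof.
pose so (j : 'I_n) : 'I_n := Ordinal (sg_lt (ltn_ord j)).
have so_inj : injective so by move=> j j' /(congr1 val) /= /sg_inj e; apply: val_inj; apply: e.
have [so' K1 K2] := injF_bij so_inj.
pose T (h : {ffun 'I_n -> 'I_(sdom B)}) : {ffun 'I_n -> 'I_l} := [ffun j => widen_ord hB (h (so j))].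
have Tinj : injective T.
  move=> h h' /ffunP e; apply/ffunP => a; apply: val_inj.
  by have := congr1 val (e (so' a)); rewrite !ffunE /= K2.
have TE h i : i < n -> ext_map (T h) i = ext_map h (sgm i).
  move=> hi; rewrite (ext_map_ord _ hi) (ext_map_ord _ (sg_lt hi)) ffunE /=; congr (nat_of_ord (h _)).
  exact: val_inj.
have hlt (h : {ffun 'I_n -> 'I_(sdom B)}) i : i < n -> ext_map h i < sdom B.
  by move=> hi; rewrite (ext_map_ord _ hi) ltn_ord.
rewrite /nhom -(card_image Tinj); apply: eq_card => f.
have nz u : (gfold n 1 stt u != 0) = nall n (fun i => okst i (u i.-1) (u i)).
  by rewrite gfold_stt; case: ifP => // _; case: (n) n1.
rewrite [RHS]nz; apply/imageP/nallP => [[h hh ->] i hi|hf].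
  have [h1 h2] := (is_hom_path h).1 hh.
  have hi' : i.-1 < n by lia.
  rewrite /okst !TE // hlt ?sg_lt // h1 //=; case: i hi hi' => //= i hi _.
  by have [] := h2 i ltac:(lia) => -> ->.
have flt (j : 'I_n) : f j < sdom B.
  by have := hf j (ltn_ord j); rewrite (ext_map_ord _ (ltn_ord j)) => /and3P[h _ _]; move: h; congr (nat_of_ord (f _) < _); apply: val_inj.
pose h : {ffun 'I_n -> 'I_(sdom B)} := [ffun a => Ordinal (flt (so' a))].
have hT : f = T h.
  by apply/ffunP => j; apply: val_inj; rewrite !ffunE /= K1.
exists h => //; apply/is_hom_path.
rewrite hT in hf; split=> i hi.
  by have /and3P[_ h2 _] := hf i hi; rewrite -TE.
have hi1 : i.+1 < n by lia. have hi0 : i < n by lia.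
have /and3P[_ _ /=] := hf i.+1 hi1; rewrite !TE //; by case/andP.
Qed.
End Pstar.

Lemma eq_nmu n (p q : nat -> bool) : (forall i, i < n -> p i = q i) -> nmu n p = nmu n q.
Proof.
move=> h; rewrite !nmuE; apply: eq_nsum => i hi; congr nat_of_bool; apply/nallP/nallP => hh j hj.
  by rewrite -h ?hh //; lia.
by rewrite h ?hh //; lia.
Qed.

Lemma eq_nex n (p q : nat -> bool) : (forall i, i < n -> p i = q i) -> nex n p = nex n q.
Proof. by move=> h; apply/nexP/nexP => -[i hi]; [rewrite h|rewrite -h] => //; exists i. Qed.

Lemma eq_nall n (p q : nat -> bool) : (forall i, i < n -> p i = q i) -> nall n p = nall n q.
Proof. by move=> h; apply/nallP/nallP => hh i hi; [rewrite -h|rewrite h] => //; apply: hh. Qed.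

(** * Starred paths read off the encoded instance *)

Section Index.
Variables (e : nat -> nat) (len : nat).
Notation pr := (pr e).
Notation ptau := (ptau e).
Notation pnA := (pnA e).
Notation pnB := (pnB e len).
Notation offA := (offA e len).
Notation offB := (offB e len).
Notation pstA := (pstA e len).
Notation pstB := (pstB e len).

Definition row1 o ar a := (ar == 1) && nex (e o) (fun j => e (o + 1 + j * 1 + 0) == a).
Definition row2 o ar a c := (ar == 2) &&
  nex (e o) (fun j => (e (o + 1 + j * 2 + 0) == a) && (e (o + 1 + j * 2 + 1) == c)).
Definition m1A i a := row1 (offA i) (ptau i) a.
Definition m2A i a c := row2 (offA i) (ptau i) a c.
Definition m1B i a := row1 (offB i) (ptau i) a.
Definition m2B i a c := row2 (offB i) (ptau i) a c.

Lemma row1E o ar a : ([:: a] \in prel e o ar) = row1 o ar a.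
Proof.
apply/mapP/andP => [[j]|[/eqP -> /nexP[j hj /eqP <-]]]; last by exists j; rewrite ?mem_iota.
rewrite mem_iota add0n /= => hj h; have := congr1 size h; rewrite size_map size_iota /= => ar1.
by move: h; rewrite -ar1 /mkseq /= => -[->]; split=> //; apply/nexP; exists j.
Qed.

Lemma row2E o ar a c : ([:: a; c] \in prel e o ar) = row2 o ar a c.
Proof.
apply/mapP/andP => [[j]|[/eqP -> /nexP[j hj /andP[/eqP <- /eqP <-]]]]; last by exists j; rewrite ?mem_iota.
rewrite mem_iota add0n /= => hj h; have := congr1 size h; rewrite size_map size_iota /= => ar1.
by move: h; rewrite -ar1 /mkseq /= => -[-> ->]; split=> //; apply/nexP; exists j; rewrite ?eqxx.
Qed.

Lemma all_prel o ar (P : pred (seq nat)) : all P (prel e o ar) =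
  nall (e o) (fun j => P (mkseq (fun c => e (o + 1 + j * ar + c)) ar)).
Proof. by rewrite /prel /mkseq all_map. Qed.

Lemma mem2A i a c : i < pr -> ([:: a; c] \in rel_of pstA i) = m2A i a c.
Proof. by move=> hi; rewrite rel_pstA // row2E. Qed.
Lemma mem1A i a : i < pr -> ([:: a] \in rel_of pstA i) = m1A i a.
Proof. by move=> hi; rewrite rel_pstA // row1E. Qed.
Lemma mem2B i a c : i < pr -> ([:: a; c] \in rel_of pstB i) = m2B i a c.
Proof. by move=> hi; rewrite rel_pstB // row2E. Qed.
Lemma mem1B i a : i < pr -> ([:: a] \in rel_of pstB i) = m1B i a.
Proof. by move=> hi; rewrite rel_pstB // row1E. Qed.

Definition wfA := nall pr (fun i => nall (e (offA i)) (fun j =>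
  nall (ptau i) (fun c => e (offA i + 1 + j * ptau i + c) < pnA))).
Definition wfB := nall pr (fun i => nall (e (offB i)) (fun j =>
  nall (ptau i) (fun c => e (offB i + 1 + j * ptau i + c) < pnB))).

Lemma wf_index (off : nat -> nat) nn : wf_struct (ptaul e) (Struct nn (mkseq (fun i => prel e (off i) (ptau i)) pr)) =
  nall pr (fun i => nall (e (off i)) (fun j => nall (ptau i) (fun c => e (off i + 1 + j * ptau i + c) < nn))).
Proof.
rewrite /wf_struct !size_mkseq eqxx /=.
have -> : zip (ptaul e) (mkseq (fun i => prel e (off i) (ptau i)) pr) =
    [seq (ptau i, prel e (off i) (ptau i)) | i <- iota 0 pr].
  by rewrite /ptaul /mkseq; elim: (iota 0 pr) => //= a l ->.
rewrite all_map; apply: eq_nall => i hi /=; rewrite all_prel; apply: eq_nall => j hj.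
by rewrite size_mkseq eqxx /mkseq all_map.
Qed.

Lemma wfAE : wf_struct (ptaul e) pstA = wfA. Proof. exact: wf_index. Qed.
Lemma wfBE : wf_struct (ptaul e) pstB = wfB. Proof. exact: wf_index. Qed.

Definition walkL i0 a0 i := wk pnA (m2A i0) a0 i.
Definition wkinjL i0 a0 := nall pnA (fun i => (walkL i0 a0 i < pnA) && nall i (fun j => walkL i0 a0 i != walkL i0 a0 j)).
Definition pathL i0 a0 := wkinjL i0 a0 &&
  (nall (e (offA i0)) (fun j => (ptau i0 == 2) && nex pnA.-1 (fun i =>
     (e (offA i0 + 1 + j * 2 + 0) == walkL i0 a0 i) && (e (offA i0 + 1 + j * 2 + 1) == walkL i0 a0 i.+1) ||
     (e (offA i0 + 1 + j * 2 + 0) == walkL i0 a0 i.+1) && (e (offA i0 + 1 + j * 2 + 1) == walkL i0 a0 i))) &&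
   nall pnA.-1 (fun i => m2A i0 (walkL i0 a0 i) (walkL i0 a0 i.+1) && m2A i0 (walkL i0 a0 i.+1) (walkL i0 a0 i))).
Definition colL i0 a i := [&& i != i0, ptau i == 1 &
  nall (e (offA i)) (fun j => (ptau i == 1) && (e (offA i + 1 + j * 1 + 0) == a)) && m1A i a].
Definition eL i0 := [&& ptau i0 == 2, nex pnA (pathL i0) & nall pnA (fun a => nex pr (colL i0 a))].
Definition pstarL := [&& 1 < pnA, pr == pnA.+1 & nex pr eL].

Lemma walkLE i0 a0 i : i0 < pr -> wk pnA (fun a b => [:: a; b] \in rel_of pstA i0) a0 i = walkL i0 a0 i.
Proof.
move=> h; rewrite /walkL; congr (wk _ _ _ _); apply: functional_extensionality => a.
by apply: functional_extensionality => c; rewrite mem2A.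
Qed.

Lemma pathLE i0 a0 : i0 < pr -> is_path pnA (rel_of pstA i0) a0 = pathL i0 a0.
Proof.
move=> h; rewrite /is_path /pathL; congr (_ && _).
  apply: eq_nall => i hi; rewrite walkLE //; congr (_ && _).
  by apply: eq_nall => j hj; rewrite !walkLE.
rewrite /same_set; congr (_ && _).
  rewrite [X in all _ X]rel_pstA // all_prel; apply: eq_nall => j hj.
  have [->|ne] := eqVneq (ptau i0) 2; last first.
    apply/negP => /flattenP[l /mapP[i _ ->]]; rewrite !inE => /orP[/eqP|/eqP] /(congr1 size);
    by rewrite size_mkseq /= => e2; rewrite e2 in ne.
  rewrite /mkseq /=; apply/mem_path_edges/nexP => [[i hi h']|[i hi h']]; exists i => //; move: h';
    rewrite !walkLE //.
    by case=> -[-> ->]; rewrite !eqxx ?orbT.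
  by case/orP=> /andP[/eqP -> /eqP ->]; auto.
apply/allP/nallP => [hh i hi|hh t /flattenP[l /mapP[i]]].
  have hi' := hi; rewrite -!mem2A // -!walkLE //.
  by apply/andP; split; apply: hh; apply/mem_path_edges; exists i; auto.
rewrite mem_iota add0n /= => hi ->; have /andP[h1 h2] := hh i hi.
by rewrite !inE !walkLE // => /orP[/eqP->|/eqP->]; rewrite mem2A.
Qed.

Lemma colLE i0 a i : i < pr -> colP (ptaul e) pstA i0 a i = colL i0 a i.
Proof.
move=> hi; rewrite /colP /colL nth_mkseq //; congr [&& _, _ & _ && _].
  rewrite rel_pstA // all_prel; apply: eq_nall => j hj.
  have [->|ne] := eqVneq (ptau i) 1; first by rewrite /mkseq /= inE eqseq_cons andbT.
  rewrite inE; apply/eqP => /(congr1 size); rewrite size_mkseq /= => e1.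
  by rewrite e1 in ne.
by rewrite /= andbT mem1A.
Qed.

Lemma eLE i0 : i0 < pr -> eP (ptaul e) pstA i0 = eL i0.
Proof.
move=> hi; rewrite /eP /eL nth_mkseq //; congr [&& _, _ & _].
  by apply: eq_nex => a ha; rewrite pathLE.
by apply: eq_nall => a ha; rewrite size_mkseq; apply: eq_nex => i hi'; rewrite colLE.
Qed.

Lemma pstarLE : in_Pstar (ptaul e) pstA = pstarL.
Proof.
rewrite in_PstarE size_mkseq; congr [&& _, _ & _].
by apply: eq_nex => i hi; rewrite eLE.
Qed.

Definition eiL := nmu pr eL.
Definition p0L := nmu pnA (pathL eiL).
Definition sgL i := walkL eiL p0L i.
Definition cixL a := nmu pr (colL eiL a).
Definition okL i prev y := [&& y < pnB, m1B (cixL (sgL i)) y &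
  (i == 0) || m2B eiL prev y && m2B eiL y prev].
Definition stL y i s := nif (s == 0) 0 (nif (okL i s.-1 y) y.+1 0).

Lemma eiLE : ei (ptaul e) pstA = eiL.
Proof. by rewrite /ei size_mkseq; apply: eq_nmu => i hi; rewrite eLE. Qed.

Lemma sgLE i : pstarL -> sgm (ptaul e) pstA i = sgL i.
Proof.
move=> h; have lt : eiL < pr by apply: (proj1 (nmu_lt _)); case/and3P: h.
rewrite /sgm eiLE /sgL -walkLE //; congr wk.
by rewrite /pth0 eiLE; apply: eq_nmu => a ha; rewrite pathLE.
Qed.

Lemma stLE y i s : pstarL -> i < pnA -> stt (ptaul e) pstA pstB y i s = stL y i s.
Proof.
move=> h hi; have lt : eiL < pr by apply: (proj1 (nmu_lt _)); case/and3P: h.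
have hs : in_Pstar (ptaul e) pstA by rewrite pstarLE.
rewrite /stt /stL; congr (nif _ _ (nif _ _ _)).
have ec : cix (ptaul e) pstA (sgm (ptaul e) pstA i) = cixL (sgL i).
  by rewrite /cix eiLE sgLE // size_mkseq; apply: eq_nmu => j hj; rewrite colLE.
rewrite /okst /okL ec eiLE !mem2B // mem1B //.
by rewrite -ec -[X in _ < X](size_mkseq ptau); apply: cix_sgm_lt.
Qed.

End Index.

(** * Membership *)

Lemma wks_le n E a0 i : wks n E a0 i <= npair (n + a0) (n + a0).
Proof.
have hw j : wk n E a0 j <= n + a0.
  rewrite /wk; case: j => [|j]; first by rewrite nsnd_pair leq_addl.
  by rewrite wksS nsnd_pair (leq_trans (nmu_le _ _)) ?leq_addr.
case: i => [|i]; first by apply: npair_mono; lia.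
by rewrite wksS; apply: npair_mono => //; rewrite (leq_trans (nmu_le _ _)) ?leq_addr.
Qed.

Ltac Lx5 ::= lazymatch goal with
  | |- L (fun w v => nfst (@?A w v)) => apply (@L_nfst A)
  | |- L (fun w v => nsnd (@?A w v)) => apply (@L_nsnd A)
  end.

Lemma L_zc P : L P -> L (fun w v => zc w (P w v)).
Proof. by move=> hP; rewrite /zc; Ls. Qed.

Lemma L_elt N J : L N -> L J -> L (fun w v => elt w (N w v) (J w v)).
Proof.
move=> hN hJ; rewrite /elt; apply: (L_sum (f := fun w v p => (inp w p == 1) && (zc w p == J w v))) => //.
have h := L_zc (L_var 0).
by Ls.
Qed.

Ltac Lx6 ::= lazymatch goal with
  | |- L (fun w v => zc w (@?A w v)) => apply (@L_zc A)
  | |- L (fun w v => elt w (@?A w v) (@?B w v)) => apply (@L_elt A B)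
  end.

Lemma poff_le e len tau o i : poff e len tau o i <= len + o + 1.
Proof.
elim: i => [|i IH]; first by rewrite /poff /nrec /=; lia.
by rewrite /poff /nrec /= -/(nrec i _ _) -/(poff e len tau o i) /nif; case: ifP; lia.
Qed.

Lemma L_poff N O I : L N -> L O -> L I ->
  L (fun w v => poff (elt w (N w v)) (zc w (N w v)) (ptau (elt w (N w v))) (O w v) (I w v)).
Proof.
move=> hN hO hI; apply: (L_rec_le (B := fun w v => zc w (N w v) + O w v + 1)
  (s := fun w v i o => nif (o + 1 + elt w (N w v) o * ptau (elt w (N w v)) i <= zc w (N w v))
          (o + 1 + elt w (N w v) o * ptau (elt w (N w v)) i) (zc w (N w v)).+1)) => //.
- by rewrite /ptau; Ls.
- by Ls.
- by move=> w v i _; apply: poff_le.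
Qed.

Ltac Lx7 ::= lazymatch goal with
  | |- L (fun w v => poff (elt w (@?N w v)) _ _ (@?O w v) (@?I w v)) => apply (@L_poff N O I)
  end.

Lemma L_off N I : L N -> L I ->
  L (fun w v => offA (elt w (N w v)) (zc w (N w v)) (I w v)) /\
  L (fun w v => offB (elt w (N w v)) (zc w (N w v)) (I w v)).
Proof. by move=> hN hI; rewrite /offB /pB /offA /pA /pr; split; Ls. Qed.

Ltac Lx8 ::= lazymatch goal with
  | |- L (fun w v => offA (elt w (@?N w v)) _ (@?I w v)) => refine (proj1 (@L_off N I _ _))
  | |- L (fun w v => offB (elt w (@?N w v)) _ (@?I w v)) => refine (proj2 (@L_off N I _ _))
  end.

Lemma L_walkL N I A J : L N -> L I -> L A -> L J ->
  L (fun w v => walkL (elt w (N w v)) (zc w (N w v)) (I w v) (A w v) (J w v)).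
Proof.
move=> hN hI hA hJ; apply: L_nsnd.
apply: (L_rec_le (B := fun w v => npair (pnA (elt w (N w v)) + A w v) (pnA (elt w (N w v)) + A w v))
  (s := fun w v _ z => npair (nsnd z) (nmu (pnA (elt w (N w v)))
    (fun c => m2A (elt w (N w v)) (zc w (N w v)) (I w v) (nsnd z) c && (c != nfst z))))) => //.
- by rewrite /pnA /pA /pr; Ls.
- by rewrite /m2A /row2 /ptau /pnA /pA /pr; Ls.
- by rewrite /pnA /pA /pr; Ls.
- by move=> w v i _; apply: wks_le.
Qed.

Ltac Lx9 ::= lazymatch goal with
  | |- L (fun w v => walkL (elt w (@?N w v)) _ (@?I w v) (@?A w v) (@?J w v)) =>
      refine (@L_walkL N I A J _ _ _ _)
  end.

Ltac Lindex := rewrite /parse_ok /wfA /wfB /pstarL /okL /cixL /p0L /eL /pathL /wkinjL /colL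
  /m1A /m2A /m1B /m2B /row1 /row2 /pnA /pnB /pB /pA /ptau /pr; Ls.

Lemma L_pstarL N : L N -> LB (fun w v => pstarL (elt w (N w v)) (zc w (N w v))).
Proof. by move=> hN; Lindex. Qed.

Lemma L_eiL N : L N -> L (fun w v => eiL (elt w (N w v)) (zc w (N w v))).
Proof. by move=> hN; rewrite /eiL; Lindex. Qed.

Ltac Lx10 ::= lazymatch goal with
  | |- L (fun w v => eiL (elt w (@?N w v)) _) => apply (@L_eiL N)
  end.

Lemma L_sgL N I : L N -> L I -> L (fun w v => sgL (elt w (N w v)) (zc w (N w v)) (I w v)).
Proof. by move=> hN hI; rewrite /sgL; Lindex. Qed.

Lemma L_cixL N A : L N -> L A -> L (fun w v => cixL (elt w (N w v)) (zc w (N w v)) (A w v)).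
Proof. by move=> hN hA; Lindex. Qed.

Lemma L_okL N I P Y : L N -> L I -> L P -> L Y ->
  LB (fun w v => okL (elt w (N w v)) (zc w (N w v)) (I w v) (P w v) (Y w v)).
Proof.
move=> hN hI hP hY.
have h1 C : L C -> LB (fun w v => m1B (elt w (N w v)) (zc w (N w v)) (C w v) (Y w v)) by move=> hC; Lindex.
have h2 E A C : L E -> L A -> L C -> LB (fun w v => m2B (elt w (N w v)) (zc w (N w v)) (E w v) (A w v) (C w v)).
  by move=> hE hA hC; Lindex.
have hE := L_eiL hN; apply: L_and; first by Lindex.
apply: L_and; first exact: h1 (L_cixL hN (L_sgL hN hI)).
apply: L_or; first by Ls.
by apply: L_and; apply: h2.
Qed.

Lemma gfold_step_ext b s0 st st' u : (forall y i s, i < b -> st y i s = st' y i s) ->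
  gfold b s0 st u = gfold b s0 st' u.
Proof.
elim: b => [|b IH] h; first by rewrite !gfold0.
by rewrite !gfoldS IH ?h // => y i s hi; apply: h; rewrite ltnW.
Qed.

Lemma elt_le w n j : elt w n j <= n.
Proof. by rewrite -[X in _ <= X]muln1; apply: nsum_le => i _; case: (_ && _). Qed.

Section Member.
Definition valid w k n := [&& okdec w n, parse_ok (elt w n) (zc w n), wfA (elt w n) (zc w n), wfB (elt w n) (zc w n),
  pstarL (elt w n) (zc w n) & pnA (elt w n) <= k].

Definition path_blocks w k n := nif (valid w k n) (pnA (elt w n)) 0.
Definition path_start w k n := nif (valid w k n) 1 0.
Definition path_step w n := stL (elt w n) (zc w n).

(** An invalid instance gets zero blocks and start state 0: the only function, the empty one, is
    rejected, which yields the value 0. *)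
Lemma p_hom_count x k (w := input_word x k) (n := size x) :
  p_hom_Pstar x k = #|[pred g : {ffun 'I_(path_blocks w k n) -> 'I_(2 ^ lg n)} |
    gfold (path_blocks w k n) (path_start w k n) (path_step w n) (ext_map g) != 0]|.
Proof.
have Ec b b' s s' l st : b = b' -> s = s' ->
    #|[pred g : {ffun 'I_b -> 'I_l} | gfold b s st (ext_map g) != 0]| =
    #|[pred g : {ffun 'I_b' -> 'I_l} | gfold b' s' st (ext_map g) != 0]| by move=> -> ->.
have inv : ~~ valid w k n -> 0 = #|[pred g : {ffun 'I_(path_blocks w k n) -> 'I_(2 ^ lg n)} |
    gfold (path_blocks w k n) (path_start w k n) (path_step w n) (ext_map g) != 0]|.
  move=> nv; rewrite (Ec _ 0 _ 0) ?/path_blocks ?/path_start ?/nif ?(negbTE nv) //.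
  by apply/esym/eq_card0 => g; rewrite inE gfold0.
rewrite /p_hom_Pstar; case E : (dec_nats 0 x) => [s|]; last first.
  by apply: inv; rewrite /valid okdecE E.
have [es ls] := dec_spec k E; rewrite -/w -/n in es ls.
rewrite /= (parse_instance_spec es ls); case P : parse_ok; last first.
  by apply: inv; rewrite /valid P andbF.
rewrite wfAE wfBE pstarLE; case V : [&& _, _, _ & _]; last first.
  by apply: inv; rewrite /valid okdecE E P /=; move: V => /= ->.
have vv : valid w k n by rewrite /valid okdecE E P.
rewrite (Ec _ (pnA (elt w n)) _ 1) ?/path_blocks ?/path_start ?/nif ?vv //.
have /and4P[_ _ ps _] := V.
(* Numbers are written in unary, so the size of [B] is at most [|x|] and an element fits into
   [lg |x|] bits. *)
rewrite (@nhom_gfold _ _ _ (2 ^ lg n)) ?pstarLE //; last first.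
  by apply: leq_trans (elt_le _ _ _) (ltnW (trunc_log_ltn n (isT : 1 < 2))).
apply: eq_card => g; rewrite !inE; congr (_ != 0); apply: gfold_step_ext => y i t hi.
by rewrite stLE.
Qed.

Theorem p_hom_member : sharp_para_beta_L p_hom_Pstar.
Proof.
have hv : LB (fun w v => valid w (nth 0 v 0) (nth 0 v 1)).
  have h1 := L_pstarL (L_var 1).
  by rewrite /valid /okdec; repeat (apply: L_and => //); Lindex.
have hb : L (fun w v => path_blocks w (nth 0 v 0) (nth 0 v 1)) by rewrite /path_blocks; Lindex.
have hs : L (fun w v => path_start w (nth 0 v 0) (nth 0 v 1)) by rewrite /path_start; Ls.
have hl : L (fun w v => lg (nth 0 v 1)) by Ls.
have hB : L (fun w v => 2 * nth 0 v 1 + 2) by Ls.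
have ht : L (fun w v => path_step w (nth 0 v 4) (nth 0 v 0) (nth 0 v 1) (nth 0 v 2)).
  have h := L_okL (L_var 4) (L_var 1) (L_pred (L_var 2)) (L_var 0).
  by rewrite /path_step /stL; Ls.
have ha : LB (fun w v => nth 0 v 0 != 0) by Ls.
(* There is one block per element of a domain of size at most [k], so at most [k * lg |x|] choice
   bits are read. *)
have cid : computable (fun k => k).
  have hex (k : nat) : exists T : nat, (fun _ _ : nat => true) T k by exists 0.
  exact: (@computable_L (fun _ _ => true) (L_const 1) hex (fun _ k => k) (L_var 1)).
apply: (nd_class hs hb hl hB ht ha cid) => x k /=; last exact: p_hom_count.
set w := input_word x k; set n := size x; split.
- by rewrite /path_start /nif; case: ifP => _; lia.
- move=> y i s; rewrite /path_step /stL /nif; case: eqP => // _; case: ifP => // /and3P[h _ _].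
  by have := elt_le w n (pB (elt w n) (zc w n)); move: h; rewrite /pnB; lia.
- exact: exp_lg.
- apply: leq_mul => //; rewrite /path_blocks /nif; case: ifP => // /and4P[_ _ _ /and3P[_ _ h]].
  exact: h.
Qed.
End Member.

Theorem theorem25 : complete_for sharp_para_beta_L plog_pars_red p_hom_Pstar.
Proof.
split; first exact: p_hom_member.
move=> F [M [[f1 [cf1 [c0 hsp]]] [f2 [cf2 hcp]] ro hF]].
exact: (hardness cf1 cf2 hsp hcp ro hF).
Qed.
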